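(* $\mathbf{obs}(\mathcal{A}_1(\mathcal{S}))=\mathcal{L}_0\cup\mathcal{L}_1$, where $\mathcal{L}_0$ is the set of 10 graphs and $\mathcal{L}_1$ the set of 19 graphs listed explicitly in the context (graphs being considered up to isomorphism).
   Context: All graphs are finite, undirected, without loops or multiple edges, and are considered up to isomorphism. A graph $H$ is a minor of $G$ if $H$ can be obtained from some subgraph of $G$ by contracting edges (multiple edges and loops created by a contraction being suppressed); it is a proper minor if it is not isomorphic to $G$. A graph is sub-unicyclic if it contains at most one cycle; $\mathcal{S}$ is the class of sub-unicyclic graphs. $\mathcal{A}_k(\mathcal{S})$ is the class of graphs $G$ for which some set of at most $k$ vertices can be removed to give a graph in $\mathcal{S}$. For a class $\mathcal{G}$, $\mathbf{obs}(\mathcal{G})$ is the set of minor-minimal graphs not in $\mathcal{G}$ (graphs not in $\mathcal{G}$ all of whose proper minors are in $\mathcal{G}$). Notation: $K_4^-$ is $K_4$ minus an edge, $K_5^-$ is $K_5$ minus an edge, and the butterfly $Z$ is the graph obtained from two disjoint triangles by identifying a vertex of one with a vertex of the other. $rG$ denotes $r$ disjoint copies of $G$. Below, $ij$ denotes the edge joining vertices $i$ and $j$. The set $\mathcal{L}_0$ consists of the following 10 graphs. $O^0_1=3K_3$. $O^0_2=2K_4^-$. $O^0_3=2Z$. $O^0_4$ = disjoint union of $K_4^-$ and $Z$. $O^0_5$ = disjoint union of $K_4$ and $K_3$. $O^0_6$ = disjoint union of $K_3$ and the 6-vertex graph with edges $12,13,23,14,24,25,35,16,36$ (a triangle $123$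 with, for each of its edges, a new vertex adjacent to both ends of that edge). $O^1_1$: a chain of four triangles, i.e. vertices $1,\dots,9$, edges $12,23,34,45,16,26,27,37,38,48,49,59$. $O^1_2$: vertices $1,\dots,8$, edges $12,13,23,34,35,45,46,56,67,68,78$ (a $K_4^-$ with a triangle attached at each of its two vertices of degree 2). $O^1_3$: vertices $1,\dots,8$, edges $12,13,23,34,35,45,56,57,67,68,78$. $O^1_4$: vertices $1,\dots,7$, edges $12,13,23,24,34,45,46,56,57,67$ (two copies of $K_4^-$ sharing a vertex that has degree 2 in each). The set $\mathcal{L}_1$ consists of the following 19 graphs, given by their edges. (1) $12,13,23,34,35,45,46,56,47,67,58,68$. (2) $12,13,23,34,35,45,46,57,67,68,78$. (3) $12,17,27,34,35,36,45,46,57,67$. (4) $12,13,23,34,35,36,45,46,56,57,67$. (5) $12,13,23,34,35,45,46,56,37,57,38,48,49,59$. (6) $12,13,15,16,24,34,45,46,25,36$. (7) $12,13,23,25,36,56,24,34,45,46$. (8) $23,36,56,25,12,13,38,68,46,45,57,27$. (9) $15,25,13,14,23,24,34,16,56,57,27$. (10) $12,15,25,23,26,35,36,56,34,46$. (11) $16,17,34,45,57,36,47,37,46,26,12$. (12) $14,13,34,23,27,37,47,45,78,58,56,68$. (13) $13,14,34,23,25,35,45,46,56,37,47,57$. (14) $12,13,23,24,35,46,47,56,57,67$. (15) $12,14,24,26,23,28,36,38,45,46,47,56,67$. (16) $34,35,45,13,14,38,48,23,25,37,57,46,56,49,59$ (a triangle $345$ with, for each of its edges, two new vertices each adjacent to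 both ends of that edge). (17) the triangular prism, with edges $12,13,23,45,46,56,14,25,36$. (18) $K_{3,3}$. (19) $K_5^-$. *)

(* Defs.v *)
From mathcomp Require Import all_boot.
From Stdlib Require List.

Set Implicit Arguments.
Unset Strict Implicit.
Unset Printing Implicit Defensive.

Record sgraph := SGraph {
  vertex :> finType;
  adj : rel vertex;
  adj_sym : symmetric adj;
  adj_irrefl : irreflexive adj
}.

Arguments adj {s} x y.

Definition graph_class := sgraph -> Prop.

Definition isomorphic (G H : sgraph) : Prop :=
  exists f : G -> H, bijective f /\ {mono f : x y / adj x y}.

Section InducedSubgraph.
Variables (G : sgraph) (A : {set G}).

Definition induced_rel (u v : {x : G | x \in A}) : bool :=
  adj (val u) (val v).

Lemma induced_sym : symmetric induced_rel.
Proof. by move=> u v; apply: adj_sym. Qed.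

Lemma induced_irrefl : irreflexive induced_rel.
Proof. by move=> u; apply: adj_irrefl. Qed.

Definition induced : sgraph := SGraph induced_sym induced_irrefl.
End InducedSubgraph.

(* Contraction of the edge xy: y is merged into x, so that the vertex left    *)
(* as x becomes adjacent to every other former neighbour of y.                *)
Section Contraction.
Variables (G : sgraph) (x y : G).

Definition contract_rel (u v : {z : G | z != y}) : bool :=
  (u != v) && [|| adj (val u) (val v),
                  (val u == x) && adj y (val v) |
                  (val v == x) && adj y (val u)].

Lemma contract_sym : symmetric contract_rel.
Proof.
move=> u v; rewrite /contract_rel eq_sym adj_sym.
by congr (_ && (_ || _)); rewrite orbC.
Qed.

Lemma contract_irrefl : irreflexive contract_rel.
Proof. by move=> u; rewrite /contract_rel eqxx. Qed.

Definition contract : sgraph := SGraph contract_sym contract_irrefl.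
End Contraction.

Definition subgraph (H G : sgraph) : Prop :=
  exists f : H -> G, injective f /\ {homo f : x y / adj x y}.

Inductive contracts_to : sgraph -> sgraph -> Prop :=
| contracts_refl (G : sgraph) : contracts_to G G
| contracts_step (G H : sgraph) (x y : G) :
    adj x y -> contracts_to (contract x y) H -> contracts_to G H.

Definition minor (H G : sgraph) : Prop :=
  exists G' K : sgraph,
    [/\ subgraph G' G, contracts_to G' K & isomorphic H K].

Definition proper_minor (H G : sgraph) : Prop :=
  minor H G /\ ~ isomorphic H G.

Definition is_cycle (G : sgraph) (s : seq G) : Prop :=
  2 < size s /\ ucycle adj s.

(* A cycle, as a subgraph, is determined by its edge set; distinct sequences  *)
(* (rotations, reversals) may trace the same cycle.                           *)
Definition cycle_edges (G : sgraph) (s : seq G) : {set {set G}} :=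
  [set [set x; next s x] | x in s].

Definition sub_unicyclic : graph_class := fun G =>
  forall s t : seq G, is_cycle s -> is_cycle t -> cycle_edges s = cycle_edges t.

Definition apex (k : nat) (C : graph_class) : graph_class := fun G =>
  exists X : {set G}, #|X| <= k /\ C (induced (~: X)).

Definition obs (C : graph_class) : graph_class := fun G =>
  ~ C G /\ forall H : sgraph, proper_minor H G -> C H.

Definition isomorphic_to_one_of (s : seq sgraph) : graph_class := fun G =>
  exists2 H : sgraph, List.In H s & isomorphic G H.

(* Vertices are labelled 1, ..., n in the edge list, hence the successors.    *)
Section EdgeList.
Variables (n : nat) (s : seq (nat * nat)).

Definition edge_list_rel (i j : 'I_n) : bool :=
  (i != j) && (((i.+1, j.+1) \in s) || ((j.+1, i.+1) \in s)).

Lemma edge_list_sym : symmetric edge_list_rel.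
Proof. by move=> i j; rewrite /edge_list_rel eq_sym orbC. Qed.

Lemma edge_list_irrefl : irreflexive edge_list_rel.
Proof. by move=> i; rewrite /edge_list_rel eqxx. Qed.

Definition of_edges : sgraph := SGraph edge_list_sym edge_list_irrefl.
End EdgeList.

Section Complete.
Variable n : nat.

Definition complete_rel (i j : 'I_n) : bool := i != j.

Lemma complete_sym : symmetric complete_rel.
Proof. by move=> i j; rewrite /complete_rel eq_sym. Qed.

Lemma complete_irrefl : irreflexive complete_rel.
Proof. by move=> i; rewrite /complete_rel eqxx. Qed.

Definition complete : sgraph := SGraph complete_sym complete_irrefl.
End Complete.

Section CompleteBipartite.
Variables m n : nat.

Definition bipartite_rel (u v : 'I_m + 'I_n) : bool :=
  match u, v with
  | inl _, inr _ | inr _, inl _ => true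
  | _, _ => false
  end.

Lemma bipartite_sym : symmetric bipartite_rel.
Proof. by case=> i [] j. Qed.

Lemma bipartite_irrefl : irreflexive bipartite_rel.
Proof. by case. Qed.

Definition complete_bipartite : sgraph := SGraph bipartite_sym bipartite_irrefl.
End CompleteBipartite.

Section DeleteEdge.
Variables (G : sgraph) (x y : G).

Definition del_edge_rel (u v : G) : bool :=
  adj u v && ~~ ((u == x) && (v == y) || (u == y) && (v == x)).

Lemma del_edge_sym : symmetric del_edge_rel.
Proof.
move=> u v; rewrite /del_edge_rel adj_sym orbC.
by rewrite [(u == y) && _]andbC [(u == x) && _]andbC.
Qed.

Lemma del_edge_irrefl : irreflexive del_edge_rel.
Proof. by move=> u; rewrite /del_edge_rel adj_irrefl. Qed.

Definition del_edge : sgraph := SGraph del_edge_sym del_edge_irrefl.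
End DeleteEdge.

Section DisjointUnion.
Variables G H : sgraph.

Definition union_rel (u v : G + H) : bool :=
  match u, v with
  | inl x, inl y => adj x y
  | inr x, inr y => adj x y
  | _, _ => false
  end.

Lemma union_sym : symmetric union_rel.
Proof. by case=> x [] y //=; apply: adj_sym. Qed.

Lemma union_irrefl : irreflexive union_rel.
Proof. by case=> x /=; apply: adj_irrefl. Qed.

Definition disjoint_union : sgraph := SGraph union_sym union_irrefl.
End DisjointUnion.

Definition K3 : sgraph := complete 3.
Definition K4 : sgraph := complete 4.
Definition K4_minus : sgraph := del_edge (ord0 : complete 4) ord_max.
Definition K5_minus : sgraph := del_edge (ord0 : complete 5) ord_max.
Definition K33 : sgraph := complete_bipartite 3 3.

Definition butterfly : sgraph := of_edges 5
    [:: (1, 2); (1, 3); (2, 3); (3, 4); (3, 5); (4, 5)].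

Definition triangle_with_ears : sgraph := of_edges 6
    [:: (1, 2); (1, 3); (2, 3); (1, 4); (2, 4); (2, 5); (3, 5); (1, 6); (3, 6)].

Definition O0_1 : sgraph := disjoint_union K3 (disjoint_union K3 K3).
Definition O0_2 : sgraph := disjoint_union K4_minus K4_minus.
Definition O0_3 : sgraph := disjoint_union butterfly butterfly.
Definition O0_4 : sgraph := disjoint_union K4_minus butterfly.
Definition O0_5 : sgraph := disjoint_union K4 K3.
Definition O0_6 : sgraph := disjoint_union K3 triangle_with_ears.

Definition O1_1 : sgraph := of_edges 9
    [:: (1, 2); (2, 3); (3, 4); (4, 5); (1, 6); (2, 6); (2, 7); (3, 7);
        (3, 8); (4, 8); (4, 9); (5, 9)].

Definition O1_2 : sgraph := of_edges 8
    [:: (1, 2); (1, 3); (2, 3); (3, 4); (3, 5); (4, 5); (4, 6); (5, 6);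
        (6, 7); (6, 8); (7, 8)].

Definition O1_3 : sgraph := of_edges 8
    [:: (1, 2); (1, 3); (2, 3); (3, 4); (3, 5); (4, 5); (5, 6); (5, 7);
        (6, 7); (6, 8); (7, 8)].

Definition O1_4 : sgraph := of_edges 7
    [:: (1, 2); (1, 3); (2, 3); (2, 4); (3, 4); (4, 5); (4, 6); (5, 6);
        (5, 7); (6, 7)].

Definition L0 : seq sgraph :=
  [:: O0_1; O0_2; O0_3; O0_4; O0_5; O0_6; O1_1; O1_2; O1_3; O1_4].

Definition L1_1 : sgraph := of_edges 8
    [:: (1, 2); (1, 3); (2, 3); (3, 4); (3, 5); (4, 5); (4, 6); (5, 6);
        (4, 7); (6, 7); (5, 8); (6, 8)].

Definition L1_2 : sgraph := of_edges 8
    [:: (1, 2); (1, 3); (2, 3); (3, 4); (3, 5); (4, 5); (4, 6); (5, 7);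
        (6, 7); (6, 8); (7, 8)].

Definition L1_3 : sgraph := of_edges 7
    [:: (1, 2); (1, 7); (2, 7); (3, 4); (3, 5); (3, 6); (4, 5); (4, 6);
        (5, 7); (6, 7)].

Definition L1_4 : sgraph := of_edges 7
    [:: (1, 2); (1, 3); (2, 3); (3, 4); (3, 5); (3, 6); (4, 5); (4, 6);
        (5, 6); (5, 7); (6, 7)].

Definition L1_5 : sgraph := of_edges 9
    [:: (1, 2); (1, 3); (2, 3); (3, 4); (3, 5); (4, 5); (4, 6); (5, 6);
        (3, 7); (5, 7); (3, 8); (4, 8); (4, 9); (5, 9)].

Definition L1_6 : sgraph := of_edges 6
    [:: (1, 2); (1, 3); (1, 5); (1, 6); (2, 4); (3, 4); (4, 5); (4, 6);
        (2, 5); (3, 6)].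

Definition L1_7 : sgraph := of_edges 6
    [:: (1, 2); (1, 3); (2, 3); (2, 5); (3, 6); (5, 6); (2, 4); (3, 4);
        (4, 5); (4, 6)].

Definition L1_8 : sgraph := of_edges 8
    [:: (2, 3); (3, 6); (5, 6); (2, 5); (1, 2); (1, 3); (3, 8); (6, 8);
        (4, 6); (4, 5); (5, 7); (2, 7)].

Definition L1_9 : sgraph := of_edges 7
    [:: (1, 5); (2, 5); (1, 3); (1, 4); (2, 3); (2, 4); (3, 4); (1, 6);
        (5, 6); (5, 7); (2, 7)].

Definition L1_10 : sgraph := of_edges 6
    [:: (1, 2); (1, 5); (2, 5); (2, 3); (2, 6); (3, 5); (3, 6); (5, 6);
        (3, 4); (4, 6)].

Definition L1_11 : sgraph := of_edges 7
    [:: (1, 6); (1, 7); (3, 4); (4, 5); (5, 7); (3, 6); (4, 7); (3, 7);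
        (4, 6); (2, 6); (1, 2)].

Definition L1_12 : sgraph := of_edges 8
    [:: (1, 4); (1, 3); (3, 4); (2, 3); (2, 7); (3, 7); (4, 7); (4, 5);
        (7, 8); (5, 8); (5, 6); (6, 8)].

Definition L1_13 : sgraph := of_edges 7
    [:: (1, 3); (1, 4); (3, 4); (2, 3); (2, 5); (3, 5); (4, 5); (4, 6);
        (5, 6); (3, 7); (4, 7); (5, 7)].

Definition L1_14 : sgraph := of_edges 7
    [:: (1, 2); (1, 3); (2, 3); (2, 4); (3, 5); (4, 6); (4, 7); (5, 6);
        (5, 7); (6, 7)].

Definition L1_15 : sgraph := of_edges 8
    [:: (1, 2); (1, 4); (2, 4); (2, 6); (2, 3); (2, 8); (3, 6); (3, 8);
        (4, 5); (4, 6); (4, 7); (5, 6); (6, 7)].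

Definition L1_16 : sgraph := of_edges 9
    [:: (3, 4); (3, 5); (4, 5); (1, 3); (1, 4); (3, 8); (4, 8); (2, 3);
        (2, 5); (3, 7); (5, 7); (4, 6); (5, 6); (4, 9); (5, 9)].

Definition prism : sgraph := of_edges 6
    [:: (1, 2); (1, 3); (2, 3); (4, 5); (4, 6); (5, 6); (1, 4); (2, 5); (3, 6)].

Definition L1 : seq sgraph :=
  [:: L1_1; L1_2; L1_3; L1_4; L1_5; L1_6; L1_7; L1_8; L1_9; L1_10;
      L1_11; L1_12; L1_13; L1_14; L1_15; L1_16; prism; K33; K5_minus].

(* Main.v *)
(* A graph G is outside A_1(S) iff G - x has cyclomatic number at least 2 for   *)
(* every vertex x.  Let G be minor-minimal with this property.  Deleting an    *)
(* edge e of G yields a graph with an apex v, hence G - v has cyclomatic number *)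
(* at most 2.  Keep this root v, and grow topological subgraphs H of G          *)
(* containing v, starting from the single vertex v.  If H - x has cyclomatic    *)
(* number at most 1 for some vertex x of H then, since G - x has more, G        *)
(* contains an ear of H avoiding x (a path between two points of H, a cycle     *)
(* through one point of H, or a cycle disjoint from H); adding it gives one of  *)
(* finitely many graphs H'.  Such an H' is impossible if H' - v has cyclomatic  *)
(* number above 2.  If no vertex of H' is an apex, then H' contracts to one of  *)
(* the listed graphs, which is then a minor of G, hence G itself.  Otherwise    *)
(* one goes on with H'.  Up to isomorphism and suppression of vertices of       *)
(* degree 2 this search meets fewer than 150 graphs and ends after eight        *)
(* rounds, which is checked by computation.                                     *)

Require Import Defs.
From mathcomp Require Import all_boot zify.
From Stdlib Require List.

Set Implicit Arguments.
Unset Strict Implicit.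
Unset Printing Implicit Defensive.

(** * Cyclomatic number through labellings *)

(** A graph has at most one cycle exactly when its cyclomatic number is at most 1
    ([sub_unicyclicP]), so the class consists of the graphs with cyclomatic number at most 1 after
    removal of at most one vertex ([apexP]). The number does not grow under subgraphs or
    contractions ([cyc_le_sub], [cyc_le_contract]); hence the class is closed under minors
    ([apex_minor]).

    That the listed graphs are obstructions is therefore a finite check: none of them has an apex,
    and each acquires one by the deletion or contraction of any single edge ([check_listed],
    [listed_obs]).

    Conversely, an obstruction [G] has a vertex [v] whose removal leaves cyclomatic number at most 2
    ([obs_root]). An abstract graph that is topologically contained in [G], with its vertex 0 at
    [v], and that has an apex can always be enlarged by an ear or by a disjoint cycle, because [G]
    itself has no apex ([ear_exists], [successors_complete]). The bound 2 prunes these enlargements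
    ([embeds_live]), and those without an apex are shown by computation to have a listed minor
    ([embeds_reduces], [explore_ok]). The search is exhaustive by [explore_sound], so [G] has a
    listed minor, and minimality makes it isomorphic to [G]. *)

Section CyclomaticBound.
Variable T : finType.
Implicit Types (e : rel T) (A B : {set T}) (k : nat).

(* With f a labelling by connected components, the inequality of [cyc_le] reads *)
(* |E| - |A| + c <= k (arcs count every edge twice); coarser labellings only    *)
(* weaken it.  So [cyc_le e A k] bounds the cyclomatic number of e on A, and    *)
(* does it without mentioning components.                                       *)
Definition arcs e A : {set T * T} :=
  [set p | [&& p.1 \in A, p.2 \in A & e p.1 p.2]].

Definition cyc_le e A k : Prop :=
  forall (L : finType) (f : T -> L),
    {in A &, forall u v, e u v -> f u = f v} ->
    #|arcs e A| + (#|f @: A|).*2 <= (#|A| + k).*2.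

Definition split_arcs e A (L : finType) (f : T -> L) : {set T * T} :=
  [set p in arcs e A | f p.1 != f p.2].

(** Identifying the two labels at the ends of a split edge loses one label and unsplits at least the
    two arcs of that edge; this is repeated until nothing is split. An arbitrary labelling thus
    becomes one to which [cyc_le] applies, at a price paid in arcs. *)
Lemma merge_labels e A (L : finType) (f : T -> L) :
  symmetric e -> irreflexive e ->
  exists2 g : T -> L, {in A &, forall u v, e u v -> g u = g v} &
    (#|f @: A|).*2 <= (#|g @: A|).*2 + #|split_arcs e A f|.
Proof.
move=> sym_e irr_e; have [n le_n] := ubnP #|split_arcs e A f|.
elim: n f le_n => // n IHn f le_n.
have [none|[[u v]]] := set_0Vmem (split_arcs e A f).
  exists f => [u v uA vA euv|]; last by rewrite leq_addr.
  apply/eqP/negPn/negP => neq; have := in_set0 (u, v).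
  by rewrite -none !inE /= uA vA euv neq.
move=> uv_split; have:= uv_split; rewrite !inE /= => /andP[/and3P[uA vA euv] neq].
pose f1 t := if f t == f u then f v else f t.
pose sub2 := split_arcs e A f :\ (u, v) :\ (v, u).
have sub : split_arcs e A f1 \subset sub2.
  apply/subsetP => -[a c]; rewrite /sub2 !inE /= /f1 => /andP[/and3P[aA cA eac]].
  rewrite aA cA eac /= => neq1.
  have fv : f1 v = f1 u by rewrite /f1 eqxx if_same.
  apply/and3P; split.
  - by apply: contraNneq neq1 => -[-> ->]; rewrite -/(f1 u) -/(f1 v) fv.
  - by apply: contraNneq neq1 => -[-> ->]; rewrite -/(f1 u) -/(f1 v) fv.
  - by apply: contraNneq neq1 => eq_ac; rewrite eq_ac.
have nvu : v != u by apply: contraNneq neq => ->.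
have card2 : #|split_arcs e A f| = #|sub2|.+2.
  rewrite (cardsD1 (u, v)) uv_split (cardsD1 (v, u)) !inE /= vA uA sym_e euv.
  by rewrite [f v == _]eq_sym neq xpair_eqE (negbTE nvu).
have [|g g_const le_g] := IHn f1.
  by have := subset_leq_card sub; move: le_n; rewrite card2; lia.
exists g => //.
have: #|f @: A| <= (#|f1 @: A|).+1.
  apply: leq_trans (_ : #|f u |: f1 @: A| <= _); last first.
    by rewrite cardsU1; case: (_ \notin _); rewrite ?leqnSn.
  apply/subset_leq_card/subsetP => _ /imsetP[t tA ->]; rewrite !inE.
  case: (altP (f t =P f u)) => //= nt; apply/imsetP; exists t => //.
  by rewrite /f1 (negbTE nt).
by have := subset_leq_card sub; move: le_g; rewrite card2; lia.
Qed.

(** A labelling of the smaller graph is extended by giving each vertex outside [A'] a label of its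
    own and then merged along [e]. The merging is paid for by the split arcs, which are arcs of [e]
    on [A] but not of [e'] on [A']. *)
Lemma cyc_le_sub e e' A A' k :
  symmetric e -> irreflexive e -> {in A' &, subrel e' e} -> A' \subset A ->
  cyc_le e A k -> cyc_le e' A' k.
Proof.
move=> sym_e irr_e sub_e sAA' cA L f f_const.
pose f0 t : L + T := if t \in A' then inl (f t) else inr t.
have [g g_const] := merge_labels A f0 sym_e irr_e.
have arcsI : #|arcs e' A'| + #|split_arcs e A f0| <= #|arcs e A|.
  rewrite -(cardsID (split_arcs e A f0) (arcs e A)) addnC leq_add //.
    by apply/subset_leq_card/subsetP => p; rewrite !inE => /andP[->].
  apply/subset_leq_card/subsetP => -[u v]; rewrite !inE /= => /and3P[uA vA euv].
  rewrite !(subsetP sAA') // sub_e //= andbT negbK /f0 uA vA.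
  by rewrite (f_const u v).
have image0 : #|f0 @: A| = #|f @: A'| + #|A :\: A'|.
  have -> : f0 @: A = inl @: (f @: A') :|: inr @: (A :\: A').
    apply/setP => y; rewrite !inE; apply/imsetP/orP.
      case=> t tA ->; rewrite /f0; case: ifPn => tA'; [left|right].
        by rewrite !imset_f.
      by rewrite imset_f // inE tA' tA.
    case=> /imsetP[].
      by move=> _ /imsetP[t tA' ->] ->; exists t; rewrite ?(subsetP sAA') /f0 ?tA'.
    by move=> t; rewrite inE => /andP[tA' tA] ->; exists t; rewrite // /f0 (negbTE tA').
  have inl_inj : injective (@inl L T) by move=> ? ? [].
  have inr_inj : injective (@inr L T) by move=> ? ? [].
  rewrite cardsU (card_imset _ inl_inj) (card_imset _ inr_inj).
  rewrite (_ : _ :&: _ = set0) ?cards0 ?subn0 //.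
  by apply/setP => y; rewrite !inE; apply/andP => -[/imsetP[? _ ->] /imsetP[]].
have := cA _ g g_const; have := cardsID A' A; rewrite (setIidPr sAA').
rewrite image0; lia.
Qed.

Lemma cyc_leW e A k l : k <= l -> cyc_le e A k -> cyc_le e A l.
Proof. by move=> le_kl cA L f /cA; lia. Qed.

Lemma cyc_le_add_edge e e' A x y k :
  {in A &, forall u v, e u v -> e' u v || ((u, v) \in [:: (x, y); (y, x)])} ->
  {in A &, subrel e' e} ->
  cyc_le e' A k -> cyc_le e A k.+1.
Proof.
move=> ee' e'e cA L f f_const.
have /cA : {in A &, forall u v, e' u v -> f u = f v}.
  by move=> u v uA vA /e'e -/(_ uA vA); apply: f_const.
have : #|arcs e A| <= #|arcs e' A :|: [set (x, y); (y, x)]|.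
  apply/subset_leq_card/subsetP => -[u v]; rewrite !inE /= => /and3P[uA vA].
  by move/ee' => /(_ uA vA); rewrite !inE uA vA /=.
have := (leq_card_setU (arcs e' A) [set (x, y); (y, x)]).1.
  rewrite cards2; case: (_ != _); lia.
Qed.

(** An isolated vertex adds one vertex and at most one label; a vertex of degree 1 adds one vertex
    and one edge but no label. The balance is kept in both cases. *)
Lemma cyc_le_pendant e A a k :
  symmetric e -> irreflexive e -> a \in A -> #|[set u in A | e a u]| <= 1 ->
  cyc_le e (A :\ a) k -> cyc_le e A k.
Proof.
move=> sym_e irr_e aA deg_a cA L f f_const.
have /cA : {in A :\ a &, forall u v, e u v -> f u = f v}.
  by move=> u v /setD1P[_ uA] /setD1P[_ vA]; apply: f_const.
set N := [set u in A | e a u] in deg_a.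
have arcsD1 : #|arcs e A| <= #|arcs e (A :\ a)| + #|N|.*2.
  have -> : #|N|.*2 = #|[set (a, u) | u in N]| + #|[set (u, a) | u in N]|.
    by rewrite !card_imset ?addnn // => ? ? [].
  set row := [set (a, u) | u in N]; set col := [set (u, a) | u in N].
  have /subset_leq_card : arcs e A \subset arcs e (A :\ a) :|: row :|: col.
    apply/subsetP => -[u v]; rewrite !inE /= => /and3P[uA vA euv].
    rewrite uA vA euv /= !andbT; case: (eqVneq u a) => [eq_u|nu] /=.
      by apply/orP; left; apply/imsetP; exists v; rewrite ?inE ?vA -eq_u.
    case: (eqVneq v a) => [eq_v|nv] //=.
    by apply/orP; right; apply/imsetP; exists u; rewrite ?inE ?uA ?eq_v // sym_e -eq_v.
  move/leq_trans; apply; apply: leq_trans (leq_card_setU _ _).1 _.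
  by rewrite addnA leq_add2r (leq_card_setU _ _).1.
have cardA := cardsD1 a A; rewrite aA add1n in cardA.
have image : #|f @: A| + #|N| <= (#|f @: (A :\ a)|).+1.
  have [N0|[u uN]] := set_0Vmem N.
    rewrite N0 cards0 addn0 -{1}(setD1K aA) imsetU1 cardsU1.
    by case: (_ \notin _); rewrite ?leqnSn.
  have [uA eau] : u \in A /\ e a u by move: uN; rewrite inE => /andP.
  suff -> : f @: A = f @: (A :\ a) by rewrite -addn1 leq_add2l.
  have ua : u != a by apply: contraTneq eau => ->; rewrite irr_e.
  rewrite -{1}(setD1K aA) imsetU1; apply/setUidPr; rewrite sub1set.
  by apply/imsetP; exists u; rewrite ?inE ?ua //; apply: f_const.
move: arcsD1 image deg_a; rewrite cardA; lia.
Qed.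
End CyclomaticBound.

(** * Behaviour under injections and contractions *)

Section Transfer.
Variables (T T' : finType) (g : T' -> T).
Hypothesis g_inj : injective g.

Lemma cyc_le_preim (e : rel T) (A' : {set T'}) k :
  cyc_le (relpre g e) A' k <-> cyc_le e (g @: A') k.
Proof.
have arcsE : #|arcs (relpre g e) A'| = #|arcs e (g @: A')|.
  have gg_inj : injective (fun p : T' * T' => (g p.1, g p.2)).
    by move=> [a b] [c d] [/g_inj-> /g_inj->].
  rewrite -(card_imset _ gg_inj); congr #|pred_of_set _|; apply/setP => -[u v].
  rewrite !inE /=; apply/imsetP/and3P => [[[a b]]|[/imsetP[a aA ->] /imsetP[b bA ->] eab]]; last first.
    by exists (a, b); rewrite // inE /= aA bA.
  by rewrite inE => /and3P[aA bA eab] [-> ->]; rewrite !imset_f.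
split=> cA L f f_const.
  have /cA: {in A' &, forall u v, relpre g e u v -> (f \o g) u = (f \o g) v}.
    by move=> u v uA vA /= euv; apply: f_const; rewrite ?imset_f.
  by rewrite arcsE imset_comp (card_imset _ g_inj).
(* The labelling is pushed forward along [g]; points outside its image receive the label [None]. *)
pose F t := if [pick u | g u == t] is Some u then Some (f u) else None.
have FE u : F (g u) = Some (f u).
  rewrite /F; case: pickP => [v /eqP/g_inj->|/(_ u)] //.
  by rewrite eqxx.
have /cA: {in g @: A' &, forall u v, e u v -> F u = F v}.
  move=> _ _ /imsetP[a aA ->] /imsetP[b bA ->] eab.
  by rewrite !FE (f_const a b).
have -> : F @: (g @: A') = Some @: (f @: A').
  by rewrite -!imset_comp; apply: eq_imset => u /=; rewrite FE.
rewrite arcsE (card_imset _ g_inj) [#|Some @: _|]card_imset //.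
by move=> ? ? [].
Qed.

Lemma cyc_le_inj (e : rel T) (e' : rel T') (A : {set T}) (A' : {set T'}) k :
  symmetric e -> irreflexive e ->
  {in A' &, forall u v, e' u v -> e (g u) (g v)} -> g @: A' \subset A ->
  cyc_le e A k -> cyc_le e' A' k.
Proof.
move=> sym_e irr_e ee' sub cA.
apply: (@cyc_le_sub _ (relpre g e)) (subxx _) _ => //.
- by move=> u v /=; rewrite sym_e.
- by move=> u /=; rewrite irr_e.
by apply/cyc_le_preim; apply: cyc_le_sub sub cA => // u v _ _.
Qed.
End Transfer.

Definition contracted_rel (T : finType) (e : rel T) (x y : T) : rel T :=
  fun u v => (u != v) && [|| e u v, (u == x) && e y v | (v == x) && e y u].

(** Giving [y] the label of [x] creates no new label, [y] counts for one more vertex, and the arcs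
    after contraction inject into the arcs of [e] other than the two between [x] and [y]. *)
Lemma cyc_le_contract (T : finType) (e : rel T) (A : {set T}) x y k :
  symmetric e -> irreflexive e -> e x y -> x \in A -> y \notin A ->
  cyc_le e (y |: A) k -> cyc_le (contracted_rel e x y) A k.
Proof.
move=> sym_e irr_e exy xA yA cA L f f_const.
have Ay z : z \in A -> z != y by apply: contraTneq => ->.
have xy : x != y := Ay x xA.
pose f1 z := if z == y then f x else f z.
have f1E z : z \in A -> f1 z = f z by rewrite /f1 => /Ay/negbTE->.
have f1y : f1 y = f x by rewrite /f1 eqxx.
have step z : z \in A -> e y z -> f x = f z.
  move=> zA eyz; case: (eqVneq z x) => [->//|zx]; apply: f_const => //.
  by rewrite /contracted_rel eq_sym zx eqxx eyz orbT.
have /cA : {in y |: A &, forall u v, e u v -> f1 u = f1 v}.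
  move=> u v /setU1P[->|uA] /setU1P[->|vA]; rewrite ?irr_e ?f1y ?(f1E u) ?(f1E v) //.
  - exact: step vA.
  - by rewrite sym_e => /(step _ uA)->.
  move=> euv; apply: f_const; rewrite // /contracted_rel euv.
  by rewrite (contraTneq _ euv) // => ->; rewrite irr_e.
rewrite cardsU1 yA add1n.
have -> : f1 @: (y |: A) = f @: A.
  rewrite imsetU1 (eq_in_imset f1E) /f1 eqxx; apply/setUidPr.
  by rewrite sub1set imset_f.
(* An arc already present in [e] is kept; any other one has [x] as an end and came from an arc at
   [y], to which it is lifted back. *)
pose lift_arc (p : T * T) :=
  if e p.1 p.2 then p else if p.1 == x then (y, p.2) else (p.1, y).
pose c := contracted_rel e x y.
have lift_inj : {in arcs c A &, injective lift_arc}.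
  move=> [a b] [a' b'].
  rewrite !inE /= => /and3P[aA bA /andP[nab cab]] /and3P[aA' bA' /andP[nab' cab']].
  have [ya yb ya' yb'] := And4 (Ay _ aA) (Ay _ bA) (Ay _ aA') (Ay _ bA').
  move: cab cab'; rewrite /lift_arc /=.
  case: (e a b) => /= [_|c1]; case: (e a' b') => /= [_|c2] //.
  - by case: (a' == x) => -[ea eb]; [rewrite ea eqxx in ya | rewrite eb eqxx in yb].
  - by case: (a == x) => -[ea eb]; [rewrite -ea eqxx in ya' | rewrite -eb eqxx in yb'].
  move: c1 c2; case: (eqVneq a x) => [->|_] /=; case: (eqVneq a' x) => [->|_] //=.
  - by move=> _ _ [->].
  - by move=> _ _ [ea]; rewrite -ea eqxx in ya'.
  - by move=> _ _ [ea]; rewrite ea eqxx in ya.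
  by case/andP=> /eqP-> _ /andP[/eqP-> _] [->].
have : #|arcs c A| + 2 <= #|arcs e (y |: A)|.
  rewrite -(card_in_imset lift_inj).
  have <- : #|[set (x, y); (y, x)]| = 2 by rewrite cards2 xpair_eqE (negbTE xy).
  rewrite -cardsUI (_ : _ :&: _ = set0) ?cards0 ?addn0.
    apply/subset_leq_card/subsetP => p; case/setUP => [/imsetP[[a b]]|].
      rewrite !inE /= => /and3P[aA bA /andP[nab cab]] -> {p}; rewrite /lift_arc /=.
      move: cab; case: ifP => /= [->|_]; first by rewrite aA bA !orbT.
      case: (eqVneq a x) => /= [ea|_].
        case/orP=> [->|/andP[/eqP eb]]; first by rewrite eqxx bA orbT.
        by rewrite ea eb eqxx in nab.
      by case/andP=> _; rewrite sym_e => ->; rewrite eqxx aA orbT.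
    by rewrite !inE => /orP[]/eqP->; rewrite /= eqxx xA ?orbT //= sym_e.
  apply/setP => p; rewrite !inE; apply/andP => -[/imsetP[[a b]]].
  rewrite !inE /= => /and3P[aA bA /andP[nab _]] -> {p}; rewrite /lift_arc /=.
  have [ya yb] := (Ay _ aA, Ay _ bA).
  case: ifP => _; rewrite ?xpair_eqE /=; first by rewrite (negbTE ya) (negbTE yb) andbF.
  case: (eqVneq a x) => [ea|/negbTE nax]; rewrite ?xpair_eqE.
    by rewrite eqxx [y == x]eq_sym (negbTE xy) -ea [b == a]eq_sym (negbTE nab).
  by rewrite nax (negbTE ya).
rewrite -/c; lia.
Qed.

(** * Ears, cycles and sub-unicyclic graphs *)

Section Walks.
Variables (T : finType) (e : rel T) (W U : {set T}).
Hypotheses (sym_e : symmetric e) (irr_e : irreflexive e).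
Hypothesis disjWU : [disjoint W & U].
Hypothesis two_neighbours : forall w z, w \in W ->
  exists y, [/\ y \in W :|: U, e w y & y != z].

Definition cycle_in (A : {set T}) (s : seq T) : Prop :=
  [/\ 2 < size s, ucycle e s & {subset s <= A}].

(* z stands for the vertex visited before x. *)
Lemma extend_walk z x p :
  path e x p -> uniq (x :: p) -> {subset x :: p <= W} ->
  (exists s, cycle_in W s) \/
  exists r u, [/\ path e x (p ++ r), uniq (x :: p ++ r), {subset x :: p ++ r <= W},
    u \in U & e (last x (p ++ r)) u && (u != last z (belast x (p ++ r)))].
Proof.
have [n le_n] := ubnP (#|W| - size p).
elim: n p le_n => // n IHn p le_n e_p uniq_p subW.
have lW : last x p \in W by apply: subW; apply: mem_last.
have [y [+ ely y_prev]] := two_neighbours (last z (belast x p)) lW.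
case/setUP=> [yW|yU]; last first.
  by right; exists [::], y; rewrite cats0 ely y_prev.
have [y_p|y_p] := boolP (y \in x :: p).
  left; move: e_p uniq_p subW ely y_prev; case/splitPl: y_p => p1 p2 y_last.
  rewrite cat_path last_cat y_last belast_cat last_cat y_last -cat_cons.
  move=> /andP[_ e_p2] uniq_p subW ely y_prev; exists (y :: p2).
  have uniq_p2 : uniq (y :: p2).
    move: uniq_p; rewrite lastI cat_rcons y_last cat_uniq => /and3P[]//.
  split.
  - case: p2 e_p2 ely y_prev {uniq_p subW uniq_p2} => [|a [|b p2]] //=.
      by rewrite irr_e.
    by rewrite eqxx.
  - by rewrite /ucycle uniq_p2 andbT /= rcons_path e_p2.
  move=> a; rewrite lastI cat_rcons y_last in subW => aP.
  by apply: subW; rewrite mem_cat aP orbT.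
have le_W : size (x :: rcons p y) <= #|W|.
  rewrite -(card_uniqP _); last first.
    by rewrite -rcons_cons rcons_uniq y_p.
  apply/subset_leq_card/subsetP => a; rewrite -rcons_cons mem_rcons in_cons.
  by case/predU1P => [->|/subW].
have [|||||] := IHn (rcons p y).
- by move: le_W le_n; rewrite /= size_rcons; lia.
- by rewrite rcons_path e_p.
- by rewrite -rcons_cons rcons_uniq y_p.
- move=> a; rewrite -rcons_cons mem_rcons in_cons.
  by case/predU1P => [->|/subW].
- by left.
by case=> r [u]; rewrite cat_rcons => ?; right; exists (y :: r), u.
Qed.

(** Every vertex of [W] can be left by a neighbour other than the one it was entered from, so a walk
    through [w], continued in both directions, closes up inside [W] or reaches [U] at both ends. *)
Lemma ear_or_cycle w : w \in W ->
  (exists s, cycle_in W s) \/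
  exists u1 u2 s, [/\ s != [::] /\ (u1 = u2 -> 1 < size s), uniq s,
    {subset s <= W}, u1 \in U /\ u2 \in U & path e u1 (rcons s u2)].
Proof.
move=> wW; have [||||] := @extend_walk w w [::]; rewrite //=.
- by move=> a; rewrite inE => /eqP->.
- by left.
case=> r [u1 [e_r uniq_r subW u1U /andP[elu1 _]]].
case: (lastP r) e_r uniq_r subW elu1 => [|r' l].
  (* Here [w] itself is next to [U]. The second walk starts at [w] with [u1] as predecessor, so that
     an ear with the single inner vertex [w] has two different ends. *)
  move=> _ _ subW ewu1; have [||||] := @extend_walk u1 w [::]; rewrite //=.
  - by left.
  case=> q [u2 [e_q uniq_q subWq u2U /andP[elu2 u21]]]; right.
  exists u1, u2, (w :: q); split=> //=.
    by split=> // eq_u; case: (q) u21; rewrite //= eq_u eqxx.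
  by rewrite sym_e ewu1 rcons_path e_q.
rewrite last_rcons => e_r uniq_r subW elu1.
(* The walk is reversed so that the second application prolongs it beyond its starting point [w]. *)
pose p := rev (w :: r').
have rev_p : l :: p = rev (w :: rcons r' l) by rewrite -rcons_cons rev_rcons.
have [||||] := @extend_walk u1 l p.
- move: e_r; rewrite -rev_path last_rcons belast_rcons -/p.
  by rewrite (eq_path (e' := e)) // => a b /=; rewrite sym_e.
- by rewrite rev_p rev_uniq.
- by move=> a; rewrite rev_p mem_rev; apply: subW.
- by left.
case=> q [u2 [e_p uniq_p subWp u2U /andP[elu2 _]]]; right.
exists u1, u2, (l :: p ++ q); split=> //=.
  by split=> // _; rewrite size_cat /p size_rev.
by rewrite sym_e elu1 rcons_path e_p.
Qed.
End Walks.

Section CyclesAndCounting.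
Variables (T : finType) (e : rel T).
Implicit Type A : {set T}.
Hypotheses (sym_e : symmetric e) (irr_e : irreflexive e).

Lemma two_neighboursP (A : {set T}) w z : 1 < #|[set u in A | e w u]| ->
  exists y, [/\ y \in A, e w y & y != z].
Proof.
move=> deg_w; have /card_gt0P[y] : 0 < #|[set u in A | e w u] :\ z|.
  by have := cardsD1 z [set u in A | e w u]; case: (_ \in _); lia.
by rewrite !inE => /and3P[yz yA ewy]; exists y.
Qed.

(** Vertices of degree at most 1 are peeled off without affecting the bound; if there is none,
    [ear_or_cycle] with empty [U] can only return a cycle. *)
Lemma forest_or_cycle A : cyc_le e A 0 \/ exists s, cycle_in e A s.
Proof.
have [n le_n] := ubnP #|A|; elim: n A le_n => // n IHn A le_n.
have [A0|[w wA]] := set_0Vmem A.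
  left=> L f _; rewrite A0 imset0 (_ : arcs e set0 = set0) ?cards0 //.
  by apply/setP => p; rewrite !inE.
have [/existsP[a /andP[aA deg_a]]|no_leaf] :=
    boolP [exists a, (a \in A) && (#|[set u in A | e a u]| <= 1)].
  have [||[s [sz cyc_s sub_s]]] := IHn (A :\ a).
  - by move: le_n; rewrite (cardsD1 a A) aA.
  - by move/(cyc_le_pendant sym_e irr_e aA deg_a); left.
  by right; exists s; split=> // x /sub_s /setD1P[].
have two v z : v \in A -> exists y, [/\ y \in A :|: set0, e v y & y != z].
  move=> vA; rewrite setU0; apply: two_neighboursP; rewrite ltnNge.
  by apply: contra no_leaf => deg; apply/existsP; exists v; rewrite vA.
have dis : [disjoint A & set0] by rewrite -setI_eq0 setI0.
have [|[u1 [u2 [s [_ _ _ []]]]]] := ear_or_cycle sym_e irr_e dis two wA; first by right.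
by rewrite inE.
Qed.

Definition without_arc (x y : T) : rel T :=
  fun u v => e u v && ~~ ((u == x) && (v == y) || (u == y) && (v == x)).

Lemma without_arc_sym x y : symmetric (without_arc x y).
Proof.
move=> u v; rewrite /without_arc sym_e orbC.
by rewrite [(u == y) && _]andbC [(u == x) && _]andbC.
Qed.

Lemma without_arc_irr x y : irreflexive (without_arc x y).
Proof. by move=> u; rewrite /without_arc irr_e. Qed.

Lemma cyc_le_without_arc A x y k :
  cyc_le (without_arc x y) A k -> cyc_le e A k.+1.
Proof.
apply: (@cyc_le_add_edge _ _ _ _ x y) => u v _ _.
  rewrite !inE !xpair_eqE /without_arc => ->.
  by case: ((u == x) && _ || _).
by case/andP.
Qed.

Lemma path_const (r : rel T) (L : finType) (f : T -> L) x p :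
  (forall u v, r u v -> f u = f v) -> path r x p -> f x = f (last x p).
Proof.
by move=> f_const; elim: p x => //= y p IHp x /andP[/f_const-> /IHp].
Qed.

(** The other edges of the cycle form a path from [y] back to [x]; [q != [::]] ensures that its last
    edge is not [xy] itself. *)
Lemma cycle_connects x y q (L : finType) (f : T -> L) :
  cycle e (x :: y :: q) -> uniq (x :: y :: q) -> q != [::] ->
  (forall u v, without_arc x y u v -> f u = f v) -> f x = f y.
Proof.
rewrite /= rcons_path => /and3P[_ e_q elx] /and3P[x_yq y_q uniq_q] q0 f_const.
have path_q : path (without_arc x y) y q.
  apply: (@sub_in_path _ (predC1 x) e) e_q; last first.
    by apply/allP => u uP; apply: contraNneq x_yq => <-.
  move=> u v; rewrite !inE /without_arc => /negbTE-> /negbTE->.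
  by rewrite andbF => ->.
rewrite (path_const f_const path_q); apply/esym/f_const.
have lq : last y q \in q.
  by case: (q) q0 => //= a q' _; apply: mem_last.
have /negbTE lx : last y q != x by apply: contraNneq x_yq => <-; apply: mem_last.
have /negbTE ly : last y q != y by apply: contraNneq y_q => <-.
by rewrite /without_arc elx lx ly.
Qed.

(** Deleting an edge of a cycle does not separate its ends, so the same labellings are admissible
    before and after while two arcs disappear: the cyclomatic number drops by one. Writing [+ 2] on
    the left avoids a subtraction and keeps the case [k = 0] meaningful. *)
Lemma cyc_le_cycle s x k : cycle_in e setT s -> x \in s ->
  cyc_le e setT k -> forall (L : finType) (f : T -> L),
    (forall u v, without_arc x (next s x) u v -> f u = f v) ->
    #|arcs (without_arc x (next s x)) setT| + 2 + (#|f @: setT|).*2 <= (#|T| + k).*2.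
Proof.
case=> sz /andP[cyc_s uniq_s] _ xs cA L f f_const.
have [i [|y q] def_s] := rot_to xs; first by move: sz; rewrite -(size_rot i) def_s.
have next_y : next s x = y.
  by rewrite -(next_rot i) // def_s /= eqxx.
rewrite next_y in f_const *.
have cyc_rot : cycle e (x :: y :: q) by rewrite -def_s rot_cycle.
have uniq_rot : uniq (x :: y :: q) by rewrite -def_s rot_uniq.
have q0 : q != [::] by move: sz; rewrite -(size_rot i) def_s; case: (q).
have exy : e x y by case/andP: cyc_rot.
have fxy := cycle_connects cyc_rot uniq_rot q0 f_const.
have nxy : x != y by apply: contraTneq exy => ->; rewrite irr_e.
have arcsE : #|arcs e setT| = #|arcs (without_arc x y) setT| + 2.
  have <- : #|[set (x, y); (y, x)]| = 2 by rewrite cards2 xpair_eqE (negbTE nxy).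
  rewrite -cardsUI (_ : _ :&: _ = set0) ?cards0 ?addn0.
    congr #|pred_of_set _|; apply/setP => -[u v]; rewrite !inE /= !xpair_eqE /without_arc.
    have [/orP[]/andP[/eqP-> /eqP->]|] :=
      boolP ((u == x) && (v == y) || (u == y) && (v == x)); rewrite ?andbT ?orbF //=.
      by rewrite exy orbT.
    by rewrite sym_e exy orbT.
  apply/setP => -[u v]; rewrite !inE /= !xpair_eqE /without_arc.
  by case: (_ || _); rewrite ?andbF.
rewrite -arcsE -cardsT; apply: cA => u v _ _ euv.
have [/orP[]/andP[/eqP-> /eqP->]//|no] :=
  boolP ((u == x) && (v == y) || (u == y) && (v == x)).
by apply: f_const; rewrite /without_arc euv.
Qed.
End CyclesAndCounting.

(** * At most one cycle means cyclomatic number at most 1 *)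

Section SubUnicyclic.
Variable G : sgraph.
Let sym_adj := @adj_sym G.
Let irr_adj := @adj_irrefl G.

Lemma cycle_in_adj (s : seq G) : is_cycle s <-> cycle_in adj setT s.
Proof. by split=> [[sz uc]|[sz uc _]]; split=> // u _; rewrite inE. Qed.

(** If an edge of [s] were missing from [t], its deletion would leave the bound 0 together with the
    cycle [t]; deleting an edge of [t] too would make the cyclomatic number negative. *)
Lemma cyc_le_unique_cycle (s t : seq G) : cyc_le (@adj G) setT 1 ->
  is_cycle s -> is_cycle t -> {subset cycle_edges s <= cycle_edges t}.
Proof.
move=> c1 /cycle_in_adj cyc_s /cycle_in_adj cyc_t E /imsetP[x xs ->].
apply/negPn/negP => not_t.
set y := next s x in not_t.
pose e1 := without_arc adj x y.
have sym1 : symmetric e1 := without_arc_sym sym_adj x y.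
have irr1 : irreflexive e1 := without_arc_irr irr_adj x y.
have c0 : cyc_le e1 setT 0.
  move=> L f f_const; have f_const' u v : e1 u v -> f u = f v by apply: f_const.
  by have := cyc_le_cycle sym_adj irr_adj cyc_s xs c1 f_const'; rewrite -/y -/e1 cardsT; lia.
have cyc_t1 : cycle_in e1 setT t.
  case: cyc_t => sz /andP[cyc_t uniq_t] _; split=> [//||u _]; last by rewrite inE.
  rewrite /ucycle uniq_t andbT.
  apply: cycle_from_next => // u ut; rewrite /e1 /without_arc (next_cycle cyc_t) //=.
  apply: contra not_t => /orP[]/andP[/eqP eq_u /eqP eq_n].
    by apply/imsetP; exists u; rewrite // eq_n eq_u.
  by apply/imsetP; exists u; rewrite // eq_n eq_u setUC.
have [z zt] : exists z, z \in t by case: cyc_t1; case: (t) => // z t' *; exists z; apply: mem_head.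
(* Merging from the identity labelling bounds twice the number of vertices by twice the number of
   labels of [g] plus the number of arcs: a cyclomatic number is never negative. *)
have [g g_const] := merge_labels [set: G] id
  (without_arc_sym sym1 z (next t z)) (without_arc_irr irr1 z (next t z)).
have g_const' u v : without_arc e1 z (next t z) u v -> g u = g v by apply: g_const.
have := cyc_le_cycle sym1 irr1 cyc_t1 zt c0 g_const'.
rewrite imset_id cardsT addn0.
have : #|split_arcs (without_arc e1 z (next t z)) setT id|
   <= #|arcs (without_arc e1 z (next t z)) [set: G]|.
  by apply/subset_leq_card/subsetP => p; rewrite inE => /andP[].
lia.
Qed.

(** If there is a cycle, delete one of its edges: a cycle surviving this would have another edge
    set, so a forest is left, and restoring the edge adds at most one. *)
Lemma sub_unicyclicP : sub_unicyclic G <-> cyc_le (@adj G) setT 1.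
Proof.
split=> [uni|c1 s t cyc_s cyc_t]; last first.
  by apply/setP/subset_eqP/andP; split; apply/subsetP; apply: cyc_le_unique_cycle.
have [c0|[s cyc_s]] := forest_or_cycle sym_adj irr_adj setT; first exact: cyc_leW c0.
have [x xs] : exists x, x \in s.
  by case: cyc_s; case: (s) => // z s' *; exists z; apply: mem_head.
set y := next s x.
have sym1 := without_arc_sym sym_adj x y.
have irr1 := without_arc_irr irr_adj x y.
have [c0|[t [sz /andP[cyc_t uniq_t] _]]] := forest_or_cycle sym1 irr1 setT.
  exact: cyc_le_without_arc c0.
have is_s : is_cycle s by apply/cycle_in_adj.
have is_t : is_cycle t.
  split=> //; rewrite /ucycle ?uniq_t ?andbT.
  by apply: sub_cycle cyc_t => u v /andP[].
have : [set x; y] \in cycle_edges s by apply/imsetP; exists x.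
rewrite (uni s t is_s is_t) => /imsetP[z zt eq_xy].
have /andP[adj_z /negP[]] := next_cycle cyc_t zt.
have nz : next t z != z by apply: contraTneq adj_z => ->; rewrite irr_adj.
have := set21 z (next t z); have := set22 z (next t z); rewrite -eq_xy !inE.
move: nz; move: (next t z) => z'.
by move=> nz /orP[]/eqP ez /orP[]/eqP ey; rewrite ?ez ?ey ?eqxx ?orbT // in nz *.
Qed.
End SubUnicyclic.

(** * Minors *)

Lemma val_imsetT (T : finType) (P : pred T) (A : {set {x : T | P x}}) :
  val @: A = [set x | P x] :\: val @: ~: A.
Proof.
apply/setP => x; rewrite !inE; apply/imsetP/andP => [[u uA ->]|[xA Px]].
  rewrite (valP u) mem_imset ?inE ?uA //; exact: val_inj.
exists (Sub x Px : {x : T | P x}); last by rewrite SubK.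
by apply: contraNT xA => uA; apply/imsetP; exists (Sub x Px); rewrite ?inE // SubK.
Qed.

Lemma apexP (G : sgraph) : apex 1 sub_unicyclic G <->
  exists X : {set G}, #|X| <= 1 /\ cyc_le (@adj G) (~: X) 1.
Proof.
have E (X : {set G}) : sub_unicyclic (induced (~: X)) <-> cyc_le (@adj G) (~: X) 1.
  rewrite sub_unicyclicP; have := cyc_le_preim val_inj (@adj G) [set: induced (~: X)] 1.
  rewrite val_imsetT setCT imset0 setD0 (_ : [set x | _] = ~: X) //.
  by apply/setP => x; rewrite inE.
by split=> -[X [X1 /E]]; exists X.
Qed.

Section Closure.
Implicit Types G H : sgraph.

Lemma cyc_le_subgraph G H (f : H -> G) (A : {set G}) (B : {set H}) k :
  injective f -> {homo f : x y / adj x y} -> f @: B \subset A ->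
  cyc_le adj A k -> cyc_le adj B k.
Proof.
move=> f_inj f_hom; apply: (cyc_le_inj f_inj (@adj_sym G) (@adj_irrefl G)).
by move=> u v _ _; apply: f_hom.
Qed.

Lemma apex_subgraph G H : subgraph H G ->
  apex 1 sub_unicyclic G -> apex 1 sub_unicyclic H.
Proof.
move=> [f [f_inj f_hom]] /apexP[X [X1 cX]]; apply/apexP.
exists (f @^-1: X); split.
  rewrite -(card_imset _ f_inj); apply: leq_trans X1; apply/subset_leq_card/subsetP.
  by move=> _ /imsetP[u + ->]; rewrite !inE.
apply: (cyc_le_subgraph f_inj f_hom _ cX).
by apply/subsetP => _ /imsetP[u + ->]; rewrite !inE.
Qed.

Lemma isomorphic_sym G H : isomorphic G H -> isomorphic H G.
Proof.
case=> f [[g fK gK] f_mono]; exists g; split; first by exists f.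
by move=> x y; rewrite -f_mono !gK.
Qed.

Lemma isomorphic_subgraph G H : isomorphic G H -> subgraph G H.
Proof.
by case=> f [f_bij f_mono]; exists f; split=> [|x y]; [apply: bij_inj | rewrite f_mono].
Qed.

Lemma contracted_adj_sym G (x y : G) : symmetric (contracted_rel adj x y).
Proof.
move=> u v; rewrite /contracted_rel eq_sym adj_sym.
by congr (_ && (_ || _)); rewrite orbC.
Qed.

Lemma contracted_adj_irrefl G (x y : G) : irreflexive (contracted_rel adj x y).
Proof. by move=> u; rewrite /contracted_rel eqxx. Qed.

Lemma cyc_le_contract_adj G (x y : G) k : adj x y ->
  cyc_le (@adj G) setT k -> cyc_le (@adj (contract x y)) setT k.
Proof.
move=> xy cG; apply/(cyc_le_preim val_inj (contracted_rel adj x y)).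
have -> : val @: [set: contract x y] = ~: [set y].
  by rewrite val_imsetT setCT imset0 setD0; apply/setP => z; rewrite !inE.
apply: cyc_le_contract => //; first exact: adj_sym.
- exact: adj_irrefl.
- by rewrite !inE; apply: contraTneq xy => ->; rewrite adj_irrefl.
- by rewrite !inE eqxx.
by rewrite setUCr.
Qed.

Lemma cyc_le_contracts_to G H k : contracts_to G H ->
  cyc_le (@adj G) setT k -> cyc_le (@adj H) setT k.
Proof.
by elim=> // {}G {}H x y xy _ IH /(cyc_le_contract_adj xy).
Qed.

Lemma cyc_le_minor G H k : minor H G ->
  cyc_le (@adj G) setT k -> cyc_le (@adj H) setT k.
Proof.
case=> G' [K [[f [f_inj f_hom]] c_to /isomorphic_subgraph[g [g_inj g_hom]]]] cG.
apply: cyc_le_subgraph g_inj g_hom (subsetT _) _; apply: cyc_le_contracts_to c_to _.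
exact: cyc_le_subgraph f_inj f_hom (subsetT _) cG.
Qed.

(** If the removed vertex is an end of the contracted edge, or if nothing is removed, the merged
    vertex is removed instead and what is left lies in the graph without [x] and [y]. Otherwise
    removal and contraction commute. *)
Lemma apex_contract G (x y : G) : adj x y ->
  apex 1 sub_unicyclic G -> apex 1 sub_unicyclic (contract x y).
Proof.
move=> xy /apexP[X [X1 cX]].
have nxy : x != y by apply: contraTneq xy => ->; rewrite adj_irrefl.
have sym_c := contracted_adj_sym x y; have irr_c := contracted_adj_irrefl x y.
have apexI a : cyc_le (contracted_rel adj x y) ((~: [set y]) :\ a) 1 ->
    apex 1 sub_unicyclic (contract x y).
  move=> ca; apply/apexP; exists (val @^-1: [set a]); split.
    rewrite -(card_imset _ val_inj) -(cards1 a); apply/subset_leq_card/subsetP.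
    by move=> _ /imsetP[u + ->]; rewrite !inE.
  apply: (cyc_le_inj val_inj sym_c irr_c _ _ ca) => [u v _ _ //|].
  by apply/subsetP => _ /imsetP[u + ->]; rewrite !inE (valP u) => ->.
have sub_x : cyc_le adj (~: [set x; y]) 1 -> apex 1 sub_unicyclic (contract x y).
  move=> cxy; apply: (apexI x).
  apply: (cyc_le_sub (@adj_sym G) (@adj_irrefl G) _ _ cxy) => [u v|].
    rewrite !inE => /andP[/negbTE ux _] /andP[/negbTE vx _].
    by rewrite /contracted_rel ux vx /= orbF => /andP[].
  by apply/subsetP => u; rewrite !inE negb_or.
have monoX (B : {set G}) : ~: B \subset ~: X -> cyc_le adj (~: B) 1.
  by move=> sub; apply: (cyc_le_sub (@adj_sym G) (@adj_irrefl G) _ sub cX).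
have [X0|[a aX]] := set_0Vmem X.
  by apply: sub_x; apply: monoX; rewrite X0 setC0 subsetT.
have XE : X = [set a].
  by apply/eqP; rewrite eq_sym eqEcard sub1set aX cards1.
have [a_xy|] := boolP (a \in [set x; y]).
  by apply: sub_x; apply: monoX; rewrite XE setCS sub1set.
rewrite !inE negb_or => /andP[ax ay]; apply: (apexI a).
apply: cyc_le_contract; rewrite ?inE ?eqxx ?andbF //.
- exact: adj_sym.
- exact: adj_irrefl.
- by rewrite nxy eq_sym ax.
have -> : y |: (~: [set y]) :\ a = ~: [set a]; last by rewrite -XE.
by apply/setP => z; rewrite !inE; case: (eqVneq z y) => [->|]; rewrite ?andbT //= eq_sym ay.
Qed.

Lemma apex_minor G H : minor H G ->
  apex 1 sub_unicyclic G -> apex 1 sub_unicyclic H.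
Proof.
case=> G' [K [sub c_to /isomorphic_subgraph sub']] /(apex_subgraph sub) aG'.
apply: apex_subgraph sub' _; elim: c_to aG' => // G1 K1 x y xy _ IH.
by move/(apex_contract xy).
Qed.
End Closure.

Lemma connect_map (T T' : finType) (r : rel T) (r' : rel T') (f : T -> T') u v :
  (forall a b, r a b -> connect r' (f a) (f b)) ->
  connect r u v -> connect r' (f u) (f v).
Proof.
move=> f_hom /connectP[p r_p ->]; elim: p u r_p => //= b p IHp u /andP[rub r_p].
exact: connect_trans (f_hom _ _ rub) (IHp _ r_p).
Qed.

(** * Minors from branch sets *)

Section Minors.
Implicit Types G H K : sgraph.

Lemma contracts_onto K n H (f : H -> K) :
  #|H| < n ->
  (forall x, exists u, f u = x) ->
  (forall u v, f u = f v -> connect [rel a b | adj a b && (f a == f b)] u v) ->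
  (forall u v, adj u v -> f u = f v \/ adj (f u) (f v)) ->
  (forall x y, adj x y -> exists u v, [/\ f u = x, f v = y & adj u v]) ->
  exists2 K', contracts_to H K' & isomorphic K K'.
Proof.
elim: n H f => // n IHn H f le_n f_surj f_conn f_hom f_lift.
have [/injectiveP f_inj|/injectivePn[u [v nuv fuv]]] := boolP (injectiveb f).
  exists H; first exact: contracts_refl.
  apply: isomorphic_sym; exists f; split.
    have g_ex x : exists u, f u == x by have [u <-] := f_surj x; exists u.
    exists (fun x => xchoose (g_ex x)) => [u|x]; last exact/eqP/(xchooseP (g_ex x)).
    exact/f_inj/eqP/(xchooseP (g_ex (f u))).
  move=> u v; apply/idP/idP => [/f_lift[a [b [/f_inj-> /f_inj->]]]//|uv].
  have [/f_inj eq_uv|//] := f_hom u v uv.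
  by rewrite eq_uv adj_irrefl in uv.
have [y [xy fxy]] : exists y, adj u y /\ f u = f y.
  have /connectP[[|y p] /= ] := f_conn u v fuv; first by move=> _ eq_v; rewrite eq_v eqxx in nuv.
  by case/andP=> /andP[uy /eqP fuy] _ _; exists y.
move: u xy fxy {v nuv fuv} => x xy fxy.
have nxy : x != y by apply: contraTneq xy => ->; rewrite adj_irrefl.
pose H' := contract x y.
pose x' : H' := Sub x nxy.
(* The default value of [insubd] sends [y] to [x], so [pi] is the quotient map of the
   contraction. *)
pose pi z : H' := insubd x' z.
have piE z : z != y -> val (pi z) = z by move=> zy; rewrite val_insubd zy.
have piy : val (pi y) = x by rewrite val_insubd eqxx.
have fpi z : f (val (pi z)) = f z.
  by case: (eqVneq z y) => [->|/piE->//]; rewrite piy.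
have pi_val z : pi (val z) = z by rewrite /pi valKd.
have pi_adj a b : adj a b -> pi a != pi b -> adj (pi a) (pi b).
  move=> ab n_ab; rewrite /= /contract_rel n_ab /=.
  case: (eqVneq a y) ab => [->|/piE->] ab; case: (eqVneq b y) ab => [->|/piE->] ab.
  - by rewrite adj_irrefl in ab.
  - by rewrite piy eqxx ab orbT.
  - by rewrite piy eqxx [adj y a]adj_sym ab !orbT.
  - by rewrite ab.
have [|||||K' cK' iK] := IHn H' (f \o val).
- rewrite -ltnS; apply: leq_trans le_n; rewrite ltnS /= card_sig.
  have -> : #|[pred z | z != y]| = #|H|.-1 by rewrite -(cardC1 y); apply: eq_card.
  by rewrite prednK //; apply/card_gt0P; exists x.
- by move=> k; have [u <-] := f_surj k; exists (pi u); rewrite /= fpi.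
- move=> a b /= /f_conn; rewrite -{2}[a]pi_val -{2}[b]pi_val; apply: connect_map.
  move=> {}a {}b /= /andP[ab /eqP fab].
  have [->|n_ab] := eqVneq (pi a) (pi b); first exact: connect0.
  by apply: connect1; rewrite /= !fpi fab eqxx andbT; apply: pi_adj.
- move=> a b /= /andP[_ /or3P[/f_hom//|/andP[/eqP-> ]|/andP[/eqP->]]].
    by rewrite fxy => /f_hom.
  by rewrite fxy adj_sym => /f_hom.
- move=> k l kl; have [a [b [fa fb ab]]] := f_lift k l kl.
  exists (pi a), (pi b); rewrite /= !fpi; split=> //; apply: pi_adj => //.
  apply: contraTneq kl => /(congr1 (f \o val)) /=; rewrite !fpi fa fb => ->.
  by rewrite adj_irrefl.
by exists K' => //; apply: contracts_step xy cK'.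
Qed.

Definition connected_in G (B : {set G}) : Prop :=
  {in B &, forall u v, connect [rel a b | [&& a \in B, b \in B & adj a b]] u v}.

(** The subgraph to be contracted keeps only the edges inside one branch set or between the branch
    sets of adjacent vertices of [K]; any other edge would survive as an unwanted edge of the
    quotient. *)
Lemma minor_of_branch_sets G K (A : {set G}) (B : K -> {set G}) :
  (forall x, B x != set0) -> (forall x, B x \subset A) ->
  (forall x, connected_in (B x)) ->
  (forall x y z, z \in B x -> z \in B y -> x = y) ->
  (forall x y, adj x y -> exists u v, [/\ u \in B x, v \in B y & adj u v]) ->
  minor K (induced A).
Proof.
move=> B0 BA B_conn B_inj B_adj.
pose V := {z : G | [exists x, z \in B x]}.
pose f (z : V) : K := xchoose (existsP (valP z)).
have fP z : val z \in B (f z) := xchooseP (existsP (valP z)).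
have fE x z : val z \in B x -> f z = x by apply: B_inj.
pose r (u v : V) := adj (val u) (val v) && ((f u == f v) || adj (f u) (f v)).
have sym_r : symmetric r by move=> u v; rewrite /r adj_sym eq_sym [adj (f u) _]adj_sym.
have irr_r : irreflexive r by move=> u; rewrite /r adj_irrefl.
pose H := SGraph sym_r irr_r.
have in_V x u : u \in B x -> [exists x, u \in B x] by move=> uB; apply/existsP; exists x.
pose toV x u (uB : u \in B x) : V := Sub u (in_V x u uB).
have toVE x u (uB : u \in B x) : f (toV x u uB) = x by apply: fE; rewrite SubK.
have [||||K' cK' iK] := @contracts_onto K #|H|.+1 H f (leqnn _).
- by move=> x; have /set0Pn[u uB] := B0 x; exists (toV x u uB); apply: toVE.
- move=> u v fuv; rewrite -[u](valKd u) -[v](valKd u).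
  apply: (@connect_map _ _ [rel a b | [&& a \in B (f u), b \in B (f u) & adj a b]]); last first.
    by apply: B_conn => //; rewrite fuv.
  move=> a b /= /and3P[aB bB ab]; apply: connect1 => /=.
  have insub_a : val (insubd u a) = a by rewrite val_insubd (in_V _ _ aB).
  have insub_b : val (insubd u b) = b by rewrite val_insubd (in_V _ _ bB).
  have fa : f (insubd u a) = f u by apply: fE; rewrite insub_a.
  have fb : f (insubd u b) = f u by apply: fE; rewrite insub_b.
  by rewrite /r insub_a insub_b ab fa fb eqxx.
- by move=> u v /andP[_ /orP[/eqP|]]; [left|right].
- move=> x y xy; have [u [v [uB vB uv]]] := B_adj x y xy.
  by exists (toV x u uB), (toV y v vB); rewrite !toVE /= /r !toVE !SubK uv xy orbT.
exists H, K'; split=> //.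
have inA (z : V) : val z \in A by apply: (subsetP (BA (f z))).
exists (fun z => Sub (val z) (inA z) : induced A); split.
  by move=> u v /(congr1 val); rewrite !SubK => /val_inj.
by move=> u v /andP[uv _]; rewrite /= /induced_rel !SubK.
Qed.

Lemma induced_subgraph G (A : {set G}) : subgraph (induced A) G.
Proof. by exists val; split=> //; apply: val_inj. Qed.

Lemma subgraph_trans G H K : subgraph K H -> subgraph H G -> subgraph K G.
Proof.
move=> [f [f_inj f_hom]] [g [g_inj g_hom]]; exists (g \o f).
by split; [apply: inj_comp | move=> x y /f_hom/g_hom].
Qed.

Lemma minor_subgraph G H K : minor K H -> subgraph H G -> minor K G.
Proof.
by case=> G' [K' [/subgraph_trans sub c i]] /sub ?; exists G', K'.
Qed.
End Minors.

(** * Topological embeddings of abstract graphs *)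

Definition edge := (nat * nat)%type.
Implicit Types (es : seq edge) (vs : seq nat).

(* Cyclomatic number of a multigraph given by its edges: contract the edges one *)
(* after the other and count the loops that are met.                            *)
Definition merge_into (x y z : nat) := if z == y then x else z.

Definition merge_edge (x y : nat) (e : edge) : edge :=
  (merge_into x y e.1, merge_into x y e.2).

Fixpoint cyc_rec n es : nat :=
  match n, es with
  | n'.+1, e :: es' =>
    if e.1 == e.2 then (cyc_rec n' es').+1
    else cyc_rec n' (map (merge_edge e.1 e.2) es')
  | _, _ => 0
  end.

Definition cyc es := cyc_rec (size es) es.

Definition within vs es := all (fun e => (e.1 \in vs) && (e.2 \in vs)) es.

Definition avoid (x : nat) es := [seq e <- es | (e.1 != x) && (e.2 != x)].

Fixpoint simple es : bool :=
  if es is e :: es' then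
    [&& e.1 != e.2, e \notin es', (e.2, e.1) \notin es' & simple es']
  else true.

Lemma withinP vs es : reflect (forall e, e \in es -> e.1 \in vs /\ e.2 \in vs) (within vs es).
Proof. by apply: (iffP allP) => w e /w /andP. Qed.

Lemma within_merge x y vs es : x \in vs -> x != y -> within vs es ->
  within [seq z <- vs | z != y] (map (merge_edge x y) es).
Proof.
move=> xvs xy /withinP w; apply/withinP => _ /mapP[e /w[e1 e2] ->].
have merge_in z : z \in vs -> merge_into x y z \in [seq z <- vs | z != y].
  by rewrite mem_filter /merge_into; case: (eqVneq z y) => [_|->]; rewrite ?xy.
by split; apply: merge_in.
Qed.

Lemma size_rem_vertex y vs : uniq vs -> y \in vs ->
  size vs = (size [seq z <- vs | z != y]).+1.
Proof.
move=> uniq_vs y_vs; rewrite -rem_filter // size_rem // prednK //.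
by case: (vs) y_vs.
Qed.

Lemma cyc_recE n es : size es <= n -> cyc_rec n es = cyc es.
Proof.
rewrite /cyc; have [m le_m] := ubnP (size es).
elim: m n es le_m => // m IHm [|n] [|e es] //= le_m le_n.
case: ifP => _; first by rewrite (IHm n).
by rewrite (IHm n) ?size_map // (IHm (size es)) ?size_map.
Qed.

Lemma cyc_cons e es : cyc (e :: es) =
  if e.1 == e.2 then (cyc es).+1 else cyc (map (merge_edge e.1 e.2) es).
Proof. by rewrite {1}/cyc /=; case: ifP => _ //; rewrite cyc_recE ?size_map. Qed.

Lemma cyc_ind (P : seq nat -> seq edge -> Prop) :
  (forall vs, P vs [::]) ->
  (forall vs x es, x \in vs -> within vs es -> P vs es -> P vs ((x, x) :: es)) ->
  (forall vs x y es, x \in vs -> y \in vs -> x != y -> within vs es ->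
    P [seq z <- vs | z != y] (map (merge_edge x y) es) -> P vs ((x, y) :: es)) ->
  forall vs es, within vs es -> P vs es.
Proof.
move=> P0 P1 P2 vs es; have [n le_n] := ubnP (size es).
elim: n vs es le_n => // n IHn vs [|[x y] es] //= le_n /andP[/andP[/= xvs yvs] w].
have [<-|xy] := eqVneq x y; first by apply: P1 => //; apply: IHn.
by apply: P2 => //; apply: IHn; rewrite ?size_map ?within_merge.
Qed.

(** A loop adds one edge and one to [cyc]; any other edge joins vertices with the same label, so its
    contraction loses one edge, one vertex and no label. *)
Lemma cyc_ge_labels (L : eqType) (f : nat -> L) vs es :
  within vs es -> uniq vs -> (forall e, e \in es -> f e.1 = f e.2) ->
  size es + size (undup (map f vs)) <= size vs + cyc es.
Proof.
move=> w; move: w f; apply: (@cyc_ind (fun vs es => forall f : nat -> L, _)) vs es.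
- by move=> vs f _ _; rewrite addn0 add0n (leq_trans (size_undup _)) ?size_map.
- move=> vs x es _ _ IH f u_vs f_const; rewrite cyc_cons eqxx /= addSn addnS ltnS.
  by apply: IH => // e es_e; apply: f_const; rewrite inE es_e orbT.
move=> vs x y es x_vs y_vs xy w IH f u_vs f_const.
have fxy : f x = f y by apply: (f_const (x, y)); apply: mem_head.
have f_merge z : f (merge_into x y z) = f z by rewrite /merge_into; case: eqP => // ->.
rewrite cyc_cons /= (negbTE xy) (size_rem_vertex u_vs y_vs) !addSn ltnS.
have {}IH := IH f (filter_uniq _ u_vs).
rewrite size_map in IH; apply: leq_trans (IH _) => [|_ /mapP[e es_e ->]].
  rewrite leq_add2l uniq_leq_size ?undup_uniq // => l; rewrite !mem_undup.
  case/mapP=> z z_vs ->; apply/mapP; exists (merge_into x y z); last by rewrite f_merge.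
  by rewrite mem_filter /merge_into; case: (eqVneq z y) => [_|->]; rewrite ?xy.
by rewrite /= !f_merge; apply: f_const; rewrite inE es_e orbT.
Qed.

(** The labelling by representatives of the connected components attains the bound of
    [cyc_ge_labels]. Its values lie in [vs], so that [b] can carry them into a graph later. *)
Lemma cyc_le_labels vs es : within vs es -> uniq vs ->
  exists f : nat -> nat,
    [/\ forall e, e \in es -> f e.1 = f e.2, {in vs, forall z, f z \in vs} &
        size vs + cyc es <= size es + size (undup (map f vs))].
Proof.
move: vs es; apply: cyc_ind => [vs u_vs|vs x es _ _ IH u_vs|vs x y es x_vs y_vs xy w IH u_vs].
- by exists id; split=> //; rewrite map_id undup_id // addn0.
- have [f [f_const f_in f_le]] := IH u_vs; exists f; split=> //.
    by move=> e; rewrite inE => /predU1P[->//|/f_const].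
  by rewrite cyc_cons eqxx addSn addnS ltnS.
have [|f [f_const f_in f_le]] := IH; first exact: filter_uniq.
have m_in z : z \in vs -> merge_into x y z \in [seq z <- vs | z != y].
  by rewrite mem_filter /merge_into; case: (eqVneq z y) => [_|->]; rewrite ?xy.
exists (f \o merge_into x y); split.
- move=> e; rewrite inE => /predU1P[->|es_e].
    by rewrite /= /merge_into eqxx (negbTE xy).
  by apply: (f_const (merge_edge x y e)); apply: map_f.
- by move=> z /m_in/f_in; rewrite mem_filter => /andP[].
rewrite cyc_cons /= (negbTE xy) (size_rem_vertex u_vs y_vs) !addSn ltnS.
rewrite size_map in f_le; apply: leq_trans f_le _; rewrite leq_add2l.
rewrite uniq_leq_size ?undup_uniq // => l; rewrite !mem_undup.
case/mapP=> z; rewrite mem_filter => /andP[zy z_vs] ->.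
by apply/mapP; exists z; rewrite //= /merge_into (negbTE zy).
Qed.

Lemma simpleP es : reflect
  (uniq es /\ forall x y, (x, y) \in es -> x != y /\ (y, x) \notin es) (simple es).
Proof.
elim: es => [|[a c] es IHes] /=; first by constructor.
apply: (iffP and4P) => [[ac es1 es2 /IHes[u_es sim]]|[/andP[es1 u_es] sim]].
  split=> [|x y]; first by rewrite es1.
  rewrite !inE => /predU1P[[-> ->]|xy_es].
    by rewrite ac negb_or es2 xpair_eqE eq_sym (negbTE ac).
  have [xy yx_es] := sim _ _ xy_es; rewrite xy negb_or yx_es andbT; split=> //.
  by apply: contraNneq es2 => -[<- <-].
have [ac ca_es] := sim a c (mem_head _ _).
split=> //; first by apply: contra ca_es; rewrite inE => ->; rewrite orbT.
apply/IHes; split=> // x y xy_es; have [|xy] := sim x y; first by rewrite inE xy_es orbT.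
by rewrite inE negb_or => /andP[_ yx_es].
Qed.

Lemma simple_uniq_arcs (T : eqType) (b : nat -> T) vs es :
  {in vs &, injective b} -> within vs es -> simple es ->
  uniq ([seq (b e.1, b e.2) | e <- es] ++ [seq (b e.2, b e.1) | e <- es]).
Proof.
move=> b_inj /withinP w /simpleP[u_es sim].
rewrite cat_uniq !map_inj_in_uniq ?u_es //=; last 2 first.
- move=> [a c] [a' c'] /w[/= ? ?] /w[/= ? ?] [ea ec].
  by rewrite (b_inj _ _ _ _ ea) // (b_inj _ _ _ _ ec).
- move=> [a c] [a' c'] /w[/= ? ?] /w[/= ? ?] [ea ec].
  by rewrite (b_inj _ _ _ _ ea) // (b_inj _ _ _ _ ec).
rewrite andbT; apply/hasPn => _ /mapP[[a c] ac ->]; apply/mapP => -[[a' c'] ac' [/= ea ec]].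
have [/= ? ?] := w _ ac; have [/= ? ?] := w _ ac'; have [_ /negP[]] := sim a c ac.
by rewrite (b_inj _ _ _ _ ea) // (b_inj _ _ _ _ ec).
Qed.

(** The component labelling of [es], transported by [b], is fed to the bound for the subgraph formed
    by the images of the abstract edges; simplicity gives two distinct arcs per abstract edge. *)
Lemma cyc_le_cyc (T : finType) (e : rel T) (A : {set T}) k (b : nat -> T) vs es :
  symmetric e -> irreflexive e ->
  {in vs &, injective b} -> uniq vs -> {in vs, forall i, b i \in A} ->
  within vs es -> simple es -> (forall i j, (i, j) \in es -> e (b i) (b j)) ->
  cyc_le e A k -> cyc es <= k.
Proof.
move=> sym_e irr_e b_inj u_vs bA w sim e_es cA.
pose bvs := map b vs.
have u_bvs : uniq bvs by rewrite map_inj_in_uniq.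
pose r u v := ((u, v) \in [seq (b p.1, b p.2) | p <- es]) ||
  ((u, v) \in [seq (b p.2, b p.1) | p <- es]).
have sub_r : {in [set u in bvs] &, subrel r e}.
  move=> u v _ _ /orP[]/mapP[[i j] ij [-> ->]]; rewrite /= ?[e (b j) _]sym_e;
    exact: e_es.
have {}cA : cyc_le r [set u in bvs] k.
  apply: (cyc_le_sub sym_e irr_e sub_r _ cA).
  by apply/subsetP => u; rewrite inE => /mapP[i i_vs ->]; apply: bA.
have [f [f_const f_in f_le]] := cyc_le_labels w u_vs.
pose F u := b (f (nth 0 vs (index u bvs))).
have FE i : i \in vs -> F (b i) = b (f i).
  move=> i_vs; have -> : b i = nth (b 0) bvs (index i vs).
    by rewrite (nth_map 0) ?index_mem // nth_index.
  by rewrite /F index_uniq ?size_map ?index_mem // nth_index.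
have {}cA : #|arcs r [set u in bvs]| + (#|F @: [set u in bvs]|).*2 <= (#|[set u in bvs]| + k).*2.
  apply: cA => u v _ _ /orP[]/mapP[p p_es [-> ->]].
    by have [? ?] := withinP _ _ w _ p_es; rewrite !FE ?f_const.
  by have [? ?] := withinP _ _ w _ p_es; rewrite !FE ?f_const.
have card_bvs : #|[set u in bvs]| = size vs.
  by rewrite cardsE (card_uniqP u_bvs) size_map.
have card_F : size (undup (map f vs)) <= #|F @: [set u in bvs]|.
  rewrite -(size_map b) -(card_uniqP _); last first.
    rewrite map_inj_in_uniq ?undup_uniq // => i j.
    rewrite !mem_undup => /mapP[i' i'_vs ->] /mapP[j' j'_vs ->].
    by apply: b_inj; apply: f_in.
  apply/subset_leq_card/subsetP => _ /mapP[i + ->]; rewrite mem_undup => /mapP[i' i'_vs ->].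
  by rewrite -FE //; apply: imset_f; rewrite inE map_f.
have card_arcs : (size es).*2 <= #|arcs r [set u in bvs]|.
  have u_arcs := simple_uniq_arcs b_inj w sim.
  have -> : (size es).*2 = size ([seq (b p.1, b p.2) | p <- es] ++ [seq (b p.2, b p.1) | p <- es]).
    by rewrite size_cat !size_map addnn.
  rewrite -(card_uniqP u_arcs); apply/subset_leq_card/subsetP => -[u v].
  rewrite mem_cat => uv; rewrite inE /= /r uv andbT !inE.
  case/orP: uv => /mapP[p p_es [-> ->]]; have [? ?] := withinP _ _ w _ p_es;
    by rewrite !map_f.
move: cA; rewrite card_bvs; lia.
Qed.

(** * Subdivisions inside a graph and the existence of ears *)

Section Embedding.
Variable G : sgraph.
Implicit Types (b : nat -> G).

(* A strand realizes the abstract edge (i, j) as a path of G from b i to b j;   *)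
(* it records the inner vertices of that path.                                  *)
Definition strand := (edge * seq G)%type.
Implicit Types (m : strand) (ms : seq strand).

Definition strand_path b m := path adj (b m.1.1) (rcons m.2 (b m.1.2)).

Definition edges_of ms : seq edge := map fst ms.

Definition interiors ms : seq G := flatten (map snd ms).

Definition points b vs ms := map b vs ++ interiors ms.

(** Distinctness of all points makes the strands internally disjoint, so this is a subdivision of
    the abstract graph in [G]. Since the abstract graph is simple, an edge determines its strand. *)
Definition embedding b vs ms : Prop :=
  [/\ uniq (points b vs ms), within vs (edges_of ms), all (strand_path b) ms
    & simple (edges_of ms)].

Definition steps (x : G) (p : seq G) : seq (G * G) := zip (x :: p) p.

Definition links b ms : seq (G * G) :=
  flatten [seq steps (b m.1.1) (rcons m.2 (b m.1.2)) | m <- ms].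

Definition linked b ms (u v : G) := ((u, v) \in links b ms) || ((v, u) \in links b ms).

Lemma embedding_inj b vs ms : embedding b vs ms -> {in vs &, injective b}.
Proof.
case=> + _ _ _; rewrite cat_uniq => /and3P[u_b _ _] i j i_vs j_vs eq_b.
have nth_b l : l \in vs -> nth (b 0) (map b vs) (index l vs) = b l.
  by move=> l_vs; rewrite (nth_map 0) ?index_mem // nth_index.
have /eqP : index i vs = index j vs.
  apply/eqP; rewrite -(nth_uniq (b 0) _ _ u_b) ?size_map ?index_mem //.
  by rewrite !nth_b // eq_b.
by move/eqP/(congr1 (nth 0 vs)); rewrite !nth_index.
Qed.

Lemma embedding_uniq b vs ms : embedding b vs ms -> uniq vs.
Proof. by case=> + _ _ _; rewrite cat_uniq => /and3P[/map_uniq]. Qed.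

Lemma size_steps x p : size (steps x p) = size p.
Proof. by rewrite size_zip /=; apply/minn_idPr. Qed.

Lemma interiorsP ms u :
  reflect (exists2 m, m \in ms & u \in m.2) (u \in interiors ms).
Proof.
apply: (iffP flatten_mapP) => [[m m_ms um]|[m m_ms um]]; by exists m.
Qed.

Lemma interior_not_vertex b vs ms u i : embedding b vs ms ->
  u \in interiors ms -> i \in vs -> u != b i.
Proof.
case=> + _ _ _; rewrite cat_uniq => /and3P[_ /hasPn dis _] /dis + i_vs.
by apply: contraNneq => ->; apply: map_f.
Qed.

(** A strand with [n] inner vertices has [n.+1] links, at least one of which meets [b x] when [x] is
    an end of the strand. *)
Lemma links_avoiding b vs ms x : x \in vs -> within vs (edges_of ms) ->
  size [seq p <- links b ms | (p.1 != b x) && (p.2 != b x)]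
    <= size (interiors ms) + size (avoid x (edges_of ms)).
Proof.
move=> x_vs; elim: ms => // [[[i j] s] ms] IHms /=.
case/andP=> /andP[/= i_vs j_vs] /IHms le_ms.
rewrite /links /interiors /= filter_cat !size_cat -/(links b ms) -/(interiors ms).
set p := rcons _ _.
have sz : size (steps (b i) p) = (size s).+1 by rewrite size_steps size_rcons.
have le_i : size [seq q <- steps (b i) p | (q.1 != b x) && (q.2 != b x)] <= (size s).+1.
  by rewrite -sz size_filter count_size.
suff : size [seq q <- steps (b i) p | (q.1 != b x) && (q.2 != b x)]
    <= size s + ((i != x) && (j != x)).
  by move: le_ms; rewrite /avoid /=; case: (_ && _) => /=; lia.
case: (boolP (_ && _)) => [_|]; first by rewrite addn1.
rewrite negb_and !negbK addn0 => ij.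
rewrite size_filter -ltnS -sz -(count_predC (fun q : G * G => (q.1 != b x) && (q.2 != b x)) (steps _ _)).
rewrite -addn1 leq_add2l -has_count; apply/hasP => /=.
case/orP: ij => [/eqP->|/eqP ejx].
  case def_p : p => [|a p']; first by have := size_rcons s (b j); rewrite -/p def_p.
  by exists (b x, a); rewrite ?mem_head //= eqxx.
exists (last (b i) s, b j); last by rewrite /= ejx eqxx andbF.
rewrite /steps /p; elim: (s) (b i) => [|a s' IHs] c /=; first by rewrite inE.
by rewrite inE IHs orbT.
Qed.

Lemma path_const_in (A : {set G}) (L : finType) (f : G -> L) x p :
  {in A &, forall u v, adj u v -> f u = f v} -> {subset x :: p <= A} ->
  path adj x p -> f x = f (last x p).
Proof.
move=> f_const; elim: p x => //= y p IHp x sub /andP[xy e_p].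
rewrite (f_const x y) ?sub ?inE ?eqxx ?orbT // IHp // => z zP.
by apply: sub; rewrite inE zP orbT.
Qed.

(** When [G] has no further edges on [U], it is there a subdivision of the abstract graph without
    [x], with remnants of the strands at [x] hanging on; neither subdividing nor these remnants
    change the cyclomatic number. *)
Lemma embedding_cyc_le b vs ms x (U := [set u in points b vs ms] :\ b x) :
  embedding b vs ms -> x \in vs -> cyc (avoid x (edges_of ms)) <= 1 ->
  {in U &, forall u v, adj u v -> linked b ms u v} -> cyc_le adj U 1.
Proof.
move=> emb x_vs c1 U_linked L f f_const.
have [u_pts w paths sim] := emb.
have b_inj := embedding_inj emb; have u_vs := embedding_uniq emb.
have bU i : i \in vs -> i != x -> b i \in U.
  move=> i_vs ix; rewrite !inE mem_cat map_f // andbT.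
  by apply: contraNneq ix => /b_inj->.
have intU u : u \in interiors ms -> u \in U.
  move=> u_int; rewrite !inE mem_cat u_int orbT andbT.
  exact: interior_not_vertex emb u_int x_vs.
pose good (p : G * G) := (p.1 != b x) && (p.2 != b x).
have card_arcs : #|arcs adj U| <= (size [seq p <- links b ms | good p]).*2.
  set fx := filter _ _; pose fx2 := fx ++ [seq (p.2, p.1) | p <- fx].
  have <- : size fx2 = (size fx).*2 by rewrite size_cat size_map addnn.
  apply: leq_trans (card_size fx2); apply/subset_leq_card/subsetP => -[u v].
  rewrite inE => /and3P[/= uU vU uv]; have := U_linked u v uU vU uv.
  move: uU vU; rewrite in_setD1 in_setD1 => /andP[ux _] /andP[vx _].
  rewrite mem_cat; case/orP => uv_l; apply/orP; [left|right].
    by rewrite mem_filter uv_l /good /= ux vx.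
  by apply/mapP; exists (v, u); rewrite // mem_filter uv_l /good /= ux vx.
have := links_avoiding b x_vs w; rewrite -/good => le_good.
have card_U : (#|U|).+1 = size vs + size (interiors ms).
  rewrite -add1n -[1](_ : nat_of_bool (b x \in [set u in points b vs ms]) = 1); last first.
    by rewrite inE mem_cat map_f.
  by rewrite -cardsD1 cardsE (card_uniqP u_pts) size_cat size_map.
have pathU m : m \in ms -> path adj (b m.1.1) (rcons m.2 (b m.1.2)).
  by move/(allP paths).
have endsP m : m \in ms -> m.1.1 \in vs /\ m.1.2 \in vs.
  by move=> m_ms; apply: (withinP _ _ w); apply: map_f.
pose vs' := [seq z <- vs | z != x].
have w' : within vs' (avoid x (edges_of ms)).
  apply/withinP => e; rewrite !mem_filter => /andP[/andP[-> ->] e_es].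
  exact: (withinP _ _ w).
have fb_const e : e \in avoid x (edges_of ms) -> f (b e.1) = f (b e.2).
  rewrite mem_filter => /andP[/andP[e1 e2] /mapP[m m_ms eq_e]]; subst e.
  have [m1 m2] := endsP m m_ms.
  rewrite (path_const_in f_const _ (pathU m m_ms)) ?last_rcons // => u.
  rewrite inE mem_rcons inE => /or3P[/eqP->|/eqP->|um]; try exact: bU.
  by apply/intU/interiorsP; exists m.
have im_f : #|f @: U| <= size (undup (map (f \o b) vs')).
  apply: leq_trans (card_size _); apply/subset_leq_card/subsetP => _ /imsetP[u uU ->].
  rewrite mem_undup; suff [i [i_vs ix ->]] : exists i, [/\ i \in vs, i != x & f u = f (b i)].
    by apply: (map_f (f \o b)); rewrite mem_filter ix.
  move: uU; rewrite !inE mem_cat => /andP[ux /orP[/mapP[i i_vs eq_u]|u_int]].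
    by exists i; split; rewrite -?eq_u //; apply: contraNneq ux => <-; rewrite eq_u.
  have [[[i j] s] m_ms /= u_s] := interiorsP _ _ u_int.
  have [/= i_vs j_vs] := endsP _ m_ms.
  have /= := pathU _ m_ms.
  have subI z : z \in s -> z \in U by move=> zs; apply/intU/interiorsP; exists ((i, j), s).
  move: subI; case/splitPr: u_s m_ms => s1 s2 m_ms subI.
  rewrite rcons_cat cat_path /= => /and3P[p1 adj_u p2].
  (* At most one end of the strand is [x]; the inner vertex [u] is joined along the strand to the
     other end and shares its label. *)
  have [eix|ix] := eqVneq i x.
    have jx : j != x.
      have [_ sim'] := simpleP _ sim; rewrite -eix eq_sym.
      by case: (sim' i j); rewrite ?(map_f fst m_ms).
    exists j; split=> //; rewrite (path_const_in f_const _ p2) ?last_rcons // => z.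
    rewrite inE mem_rcons inE => /or3P[/eqP->|/eqP->|z2]; last 1 first.
    - by apply: subI; rewrite mem_cat inE z2 !orbT.
    - by apply: subI; rewrite mem_cat inE eqxx !orbT.
    exact: bU.
  exists i; split=> //; symmetry.
  have p1u : path adj (b i) (rcons s1 u) by rewrite rcons_path p1.
  rewrite (path_const_in f_const _ p1u) ?last_rcons // => z.
  rewrite inE mem_rcons inE => /or3P[/eqP->|/eqP->|z1]; first exact: bU.
    by apply: subI; rewrite mem_cat inE eqxx !orbT.
  by apply: subI; rewrite mem_cat z1.
have le_labels := @cyc_ge_labels _ (f \o b) _ _ w' (filter_uniq _ u_vs) fb_const.
have arith a l i s u v v' c d g : a <= l.*2 -> l <= i + s -> u.+1 = v + i -> g <= d ->
    c <= 1 -> v = v'.+1 -> s + d <= v' + c -> a + g.*2 <= (u + 1).*2 by lia.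
exact: arith card_arcs le_good card_U im_f c1 (size_rem_vertex u_vs x_vs) le_labels.
Qed.

(** The last two conditions exclude degenerate ears: a closed ear must be a genuine cycle, and a
    single edge must not already belong to the subdivision. *)
Definition ear b vs ms x u1 u2 s : Prop :=
  [/\ [/\ u1 \in points b vs ms, u2 \in points b vs ms, u1 != b x & u2 != b x],
      uniq s /\ {in s, forall u, u \notin points b vs ms},
      path adj u1 (rcons s u2), (u1 = u2 -> 1 < size s)
    & s = [::] -> ~~ linked b ms u1 u2].

Lemma ear_exists b vs ms x :
  embedding b vs ms -> x \in vs -> cyc (avoid x (edges_of ms)) <= 1 ->
  [\/ cyc_le adj (~: [set b x]) 1,
      exists s, is_cycle s /\ {in s, forall u, u \notin points b vs ms} |
      exists u1 u2 s, ear b vs ms x u1 u2 s].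
Proof.
move=> emb x_vs c1; set P := [set u in points b vs ms].
pose U := P :\ b x.
have bxP : b x \in P by rewrite inE mem_cat map_f.
suff /(_ (~: P) (subxx _)) : forall W : {set G}, W \subset ~: P ->
  [\/ cyc_le adj (W :|: U) 1,
      exists s, is_cycle s /\ {in s, forall u, u \notin points b vs ms} |
      exists u1 u2 s, ear b vs ms x u1 u2 s].
  have -> // : ~: P :|: U = ~: [set b x].
  apply/setP => u; rewrite !inE; case: (eqVneq u (b x)) => [->|_] /=.
    by move: bxP; rewrite inE => ->.
  by rewrite orNb.
move=> W; have [n le_n] := ubnP #|W|; elim: n W le_n => // n IHn W le_n subW.
have subWP u : u \in W -> u \notin points b vs ms.
  by move/(subsetP subW); rewrite !inE.
have disWU : [disjoint W & U].
  rewrite -setI_eq0; apply/eqP/setP => u; rewrite !inE; apply/and3P => -[/subWP uW _].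
  by apply/negP.
have [W0|[w wW]] := set_0Vmem W.
  rewrite W0 set0U.
  have [/existsP[u /existsP[v /and4P[uU vU uv nl]]]|all_linked] :=
    boolP [exists u, exists v, [&& u \in U, v \in U, adj u v & ~~ linked b ms u v]].
    constructor 3; exists u, v, [::].
    move: uU vU; rewrite !in_setD1 !inE => /andP[ux uP] /andP[vx vP].
    by split=> //=; [rewrite uv | move=> eq_uv; rewrite eq_uv adj_irrefl in uv].
  constructor 1; apply: embedding_cyc_le => // u v uU vU uv.
  apply: contraNT all_linked => nl; apply/existsP; exists u; apply/existsP; exists v.
  by rewrite uU vU uv.
have [/existsP[a /andP[aW deg_a]]|no_leaf] :=
    boolP [exists a, (a \in W) && (#|[set u in W :|: U | adj a u]| <= 1)].
  have [||c|?|?] := IHn (W :\ a).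
  - by move: le_n; rewrite (cardsD1 a W) aW.
  - by apply: subset_trans subW; apply: subD1set.
  - constructor 1.
    apply: (cyc_le_pendant (@adj_sym G) (@adj_irrefl G) _ deg_a); first by rewrite inE aW.
    have -> // : (W :|: U) :\ a = W :\ a :|: U.
    apply/setP => u; rewrite !inE; case: (eqVneq u a) => [->|] //=.
    by rewrite (negbTE (subWP a aW)) andbF.
  - by constructor 2.
  - by constructor 3.
have two v z : v \in W -> exists y, [/\ y \in W :|: U, adj v y & y != z].
  move=> vW; apply: two_neighboursP; rewrite ltnNge.
  by apply: contra no_leaf => deg; apply/existsP; exists v; rewrite vW.
have [[s [sz cyc_s sub_s]]|[u1 [u2 [s [[s0 s2] u_s sub_s [u1U u2U] p_s]]]]] :=
  ear_or_cycle (@adj_sym G) (@adj_irrefl G) disWU two wW.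
  by constructor 2; exists s; split=> // u /sub_s /subWP.
constructor 3; exists u1, u2, s.
move: u1U u2U; rewrite !in_setD1 !inE => /andP[u1x u1P] /andP[u2x u2P].
split=> //; first by split=> // u /sub_s /subWP.
by move=> eq_s; rewrite eq_s in s0.
Qed.
End Embedding.

(** * Enlarging abstract graphs by ears and triangles *)

Definition graph := (seq nat * seq edge)%type.
Implicit Type g : graph.

Definition fresh vs := (foldr maxn 0 vs).+1.

Definition adjacent es p q := ((p, q) \in es) || ((q, p) \in es).

Definition split_edge (n : nat) (e : edge) g : graph :=
  (n :: g.1, (e.1, n) :: (n, e.2) :: [seq f <- g.2 | f != e]).

(* Abstract graphs are kept simple: a closed ear, or an ear parallel to an edge, *)
(* is subdivided by vertices with the fresh names n and n.+1.                   *)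
Definition add_ear (n p q : nat) g : graph :=
  if p == q then (n :: n.+1 :: g.1, (p, n) :: (n, n.+1) :: (n.+1, p) :: g.2)
  else if adjacent g.2 p q then (n :: g.1, (p, n) :: (n, q) :: g.2)
  else (g.1, (p, q) :: g.2).

Definition new_triangle g : graph :=
  let n := fresh g.1 in
  (n :: n.+1 :: n.+2 :: g.1, (n, n.+1) :: (n.+1, n.+2) :: (n.+2, n) :: g.2).

(* The points of g other than x to which an ear can be attached, each with the  *)
(* graph in which that point is a vertex.                                       *)
Definition attachments (x : nat) g : seq (graph * nat) :=
  [seq (g, p) | p <- g.1 & p != x] ++
  [seq (split_edge (fresh g.1) e g, fresh g.1) | e <- g.2].

(* Vertex 0 is the root; ears ending there are listed once, not per direction.  *)
Definition successors (x : nat) g : seq graph :=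
  (if x == 0 then [::]
   else [seq add_ear (fresh c.1.1) 0 c.2 c.1 | c <- attachments x g]) ++
  [seq add_ear (fresh d.1.1) c.2 d.2 d.1 |
     c <- [seq c <- attachments x g | c.2 != 0],
     d <- [seq d <- attachments x c.1 | d.2 != 0]] ++
  [:: new_triangle g].

Lemma fresh_gt vs i : i \in vs -> i < fresh vs.
Proof.
rewrite /fresh ltnS; elim: vs => //= j vs IHvs; rewrite inE leq_max.
by case/predU1P=> [->|/IHvs->]; rewrite ?leqnn ?orbT.
Qed.

Lemma simple_perm es es' : perm_eq es es' -> simple es -> simple es'.
Proof.
move=> eq_es /simpleP[u_es sim]; apply/simpleP; split.
  by rewrite -(perm_uniq eq_es).
by move=> x y; rewrite -!(perm_mem eq_es); apply: sim.
Qed.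

Section RootedEmbeddings.
Variables (G : sgraph) (v : G).
Implicit Types (b : nat -> G) (ms : seq (strand G)).

Definition rooted g b ms : Prop :=
  [/\ embedding b g.1 ms, perm_eq (edges_of ms) g.2, b 0 = v & 0 \in g.1].

Definition embeds g : Prop := exists b ms, rooted g b ms.

Definition upd b n u i := if i == n then u else b i.

Lemma upd_in b n u vs : n \notin vs -> {in vs, upd b n u =1 b}.
Proof. by move=> n_vs i i_vs; rewrite /upd; case: eqP n_vs => // <-; rewrite i_vs. Qed.

Lemma strand_path_upd b n u vs ms : n \notin vs -> within vs (edges_of ms) ->
  all (strand_path (upd b n u)) ms = all (strand_path b) ms.
Proof.
move=> n_vs /withinP w; apply: eq_in_all => m m_ms.
by have [? ?] := w _ (map_f fst m_ms); rewrite /strand_path !(upd_in _ _ n_vs).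
Qed.

Lemma embedding_perm b vs ms ms' : perm_eq ms ms' ->
  embedding b vs ms -> embedding b vs ms'.
Proof.
move=> eq_ms [u_pts w paths sim].
have eq_es : perm_eq (edges_of ms) (edges_of ms') := perm_map _ eq_ms.
have eq_int : perm_eq (interiors ms) (interiors ms').
  by apply: perm_flatten; apply: perm_map.
split.
- by rewrite (perm_uniq (s2 := points b vs ms)) // perm_cat2l perm_sym.
- by rewrite /within -(perm_all _ eq_es).
- by rewrite -(perm_all _ eq_ms).
exact: simple_perm sim.
Qed.

Lemma rooted_pull g b ms m : rooted g b ms -> m \in ms ->
  exists2 ms', perm_eq ms (m :: ms') & rooted g b (m :: ms').
Proof.
move=> [emb eq_es b0 g0] m_ms; exists (rem m ms); first exact: perm_to_rem.
have eq_ms := perm_to_rem m_ms; split=> //; first exact: embedding_perm emb.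
by rewrite -(permPl (perm_map fst eq_ms)).
Qed.

Lemma within_fresh vs es n p : n \notin vs -> within vs es ->
  ((p, n) \notin es) && ((n, p) \notin es).
Proof.
move=> n_vs /withinP w; apply/andP; split; apply: contra n_vs => /w[] //.
Qed.

Lemma within_cons n vs es : within vs es -> within (n :: vs) es.
Proof.
by move=> /withinP w; apply/withinP => e /w[]; rewrite !inE => -> ->; rewrite !orbT.
Qed.

Lemma perm_edges_head ms e es : perm_eq (e :: edges_of ms) es -> uniq es ->
  perm_eq (edges_of ms) [seq f <- es | f != e].
Proof.
move=> eq_es u_es; have := u_es; rewrite -(perm_uniq eq_es) /= => /andP[e_ms _].
have := perm_filter (fun f => f != e) eq_es; rewrite /= eqxx /=.
rewrite (_ : filter _ (edges_of ms) = edges_of ms) //; apply/all_filterP/allP => f f_ms.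
by apply: contraNneq e_ms => <-.
Qed.

Lemma embedding_split b vs ms i j s1 u s2 n : n \notin vs ->
  embedding b vs (((i, j), s1 ++ u :: s2) :: ms) ->
  embedding (upd b n u) (n :: vs) (((i, n), s1) :: ((n, j), s2) :: ms).
Proof.
move=> n_vs [u_pts /= /andP[/andP[/= i_vs j_vs] w] /andP[p_s paths] sim].
have map_upd : map (upd b n u) vs = map b vs by apply/eq_in_map/upd_in.
split.
- rewrite (perm_uniq (s2 := points b vs (((i, j), s1 ++ u :: s2) :: ms))) //.
  rewrite /points /= map_upd /interiors /= {1}/upd eqxx.
  by apply/permP => a; rewrite ?count_cat /= ?count_cat /= ?count_cat; lia.
- by rewrite /within /= !inE !eqxx i_vs j_vs ?orbT /=; apply: within_cons.
- rewrite /= (strand_path_upd _ _ n_vs) // paths andbT /strand_path /=.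
  have -> : upd b n u n = u by rewrite /upd eqxx.
  rewrite !(upd_in _ _ n_vs) //.
  move: p_s; rewrite /strand_path /= rcons_cat cat_path /= => /and3P[p1 adj_u p2].
  by rewrite rcons_path p1 adj_u p2.
have ne k : k \in vs -> (k == n) = false by apply: contraTF => /eqP->.
have ne' k : k \in vs -> (n == k) = false by rewrite eq_sym; apply: ne.
have [/andP[pn np] [/andP[qn nq] /and4P[ij _ _ sim_ms]]] :=
  (within_fresh i n_vs w, (within_fresh j n_vs w, sim)).
rewrite /= !inE !xpair_eqE (ne i) // (ne' j) // eqxx (negbTE ij) /=.
by rewrite pn np qn nq.
Qed.

Lemma links_split b vs ms i j s1 u s2 n : n \notin vs ->
  embedding b vs (((i, j), s1 ++ u :: s2) :: ms) ->
  {subset links (upd b n u) (((i, n), s1) :: ((n, j), s2) :: ms)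
     <= links b (((i, j), s1 ++ u :: s2) :: ms)}.
Proof.
move=> n_vs [_ /= /andP[/andP[/= i_vs j_vs] w] _ _] q.
have eq_ms : [seq steps (upd b n u m.1.1) (rcons m.2 (upd b n u m.1.2)) | m <- ms] =
    [seq steps (b m.1.1) (rcons m.2 (b m.1.2)) | m <- ms].
  apply/eq_in_map => m m_ms; have [? ?] := withinP _ _ w _ (map_f fst m_ms).
  by rewrite !(upd_in _ _ n_vs).
rewrite /links /= eq_ms (upd_in b u n_vs i_vs) (upd_in b u n_vs j_vs).
have -> : upd b n u n = u by rewrite /upd eqxx.
suff -> : steps (b i) (rcons (s1 ++ u :: s2) (b j)) =
    steps (b i) (rcons s1 u) ++ steps u (rcons s2 (b j)) by rewrite catA.
by elim: s1 (b i) => //= a s1 IHs c; congr cons; apply: IHs.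
Qed.

Lemma links_perm b ms ms' : perm_eq ms ms' -> links b ms =i links b ms'.
Proof. by move=> eq_ms; apply: perm_mem; apply: perm_flatten; apply: perm_map. Qed.

Lemma points_perm b vs ms ms' : perm_eq ms ms' -> points b vs ms =i points b vs ms'.
Proof.
move=> eq_ms; apply: perm_mem; rewrite perm_cat2l.
by apply: perm_flatten; apply: perm_map.
Qed.

(** An inner vertex of a strand becomes an abstract vertex by splitting the edge of that strand. The
    points stay the same and no link is added, so the conditions on an ear survive the change. *)
Lemma promote g b ms x u : rooted g b ms -> x \in g.1 ->
  u \in points b g.1 ms -> u != b x ->
  exists c b' ms', [/\ c \in attachments x g,
    rooted c.1 b' ms' /\ {in g.1, b' =1 b},
    c.2 \in c.1.1 /\ {subset g.1 <= c.1.1}, b' c.2 = u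
    & points b' c.1.1 ms' =i points b g.1 ms /\ {subset links b' ms' <= links b ms}].
Proof.
move=> root x_g u_pts ux; have [emb eq_es b0 g0] := root.
move: u_pts; rewrite mem_cat => /orP[/mapP[p p_g eq_u]|].
  exists (g, p), b, ms; split=> //; [|by split=> // q|by split].
  rewrite mem_cat; apply/orP; left; apply/mapP; exists p => //.
  by rewrite mem_filter p_g andbT; apply: contraNneq ux => <-; rewrite eq_u.
case/interiorsP => -[[i j] s] m_ms /= u_s.
have [ms1 eq_ms [emb1 eq_es1 _ _]] := rooted_pull root m_ms.
case/splitPr: u_s m_ms eq_ms emb1 eq_es1 => s1 s2 m_ms eq_ms emb1 eq_es1.
set n := fresh g.1.
have n_g : n \notin g.1 by apply/negP => /fresh_gt; rewrite ltnn.
have ij_g : (i, j) \in g.2 by rewrite -(perm_mem eq_es1) mem_head.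
exists (split_edge n (i, j) g, n), (upd b n u), (((i, n), s1) :: ((n, j), s2) :: ms1).
split.
- by rewrite mem_cat; apply/orP; right; apply/mapP; exists (i, j).
- split; last exact: upd_in.
  split; first exact: embedding_split.
  - rewrite /= !perm_cons; apply: perm_edges_head eq_es1 _.
    by rewrite -(perm_uniq eq_es); case: emb => _ _ _ /simpleP[].
  - by rewrite (upd_in b u n_g g0).
  by rewrite inE g0 orbT.
- by split=> [|k]; rewrite inE ?eqxx // => ->; rewrite orbT.
- by rewrite /upd eqxx.
split=> q; last by rewrite (links_perm _ eq_ms); apply: (links_split n_g emb1).
rewrite (points_perm _ _ eq_ms) /points /= (_ : map (upd b n u) g.1 = map b g.1); last first.
  exact/eq_in_map/upd_in.
rewrite /interiors /= /upd eqxx !(mem_cat, inE).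
by case: (q == u); case: (_ \in map _ _); case: (_ \in s1); case: (_ \in s2).
Qed.
End RootedEmbeddings.

Section Ears.
Variables (G : sgraph) (v : G).
Implicit Types (b : nat -> G) (ms : seq (strand G)).

Lemma embedding_add_vertex b vs ms n u : n \notin vs -> u \notin points b vs ms ->
  embedding b vs ms -> embedding (upd b n u) (n :: vs) ms.
Proof.
move=> n_vs u_pts [u_p w paths sim]; split=> //.
- rewrite /points /= {1}/upd eqxx (_ : map (upd b n u) vs = map b vs).
    by rewrite u_pts.
  exact/eq_in_map/upd_in.
- exact: within_cons.
by rewrite (strand_path_upd _ _ n_vs w).
Qed.

Lemma points_upd b vs ms n u : n \notin vs ->
  points (upd b n u) (n :: vs) ms = u :: points b vs ms.
Proof.
move=> n_vs; rewrite /points /= {1}/upd eqxx (_ : map (upd b n u) vs = map b vs) //.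
exact/eq_in_map/upd_in.
Qed.

Lemma embedding_add_strand b vs ms p q s : p \in vs -> q \in vs -> p != q ->
  ~~ adjacent (edges_of ms) p q -> uniq s -> {in s, forall u, u \notin points b vs ms} ->
  path adj (b p) (rcons s (b q)) -> embedding b vs ms ->
  embedding b vs (((p, q), s) :: ms).
Proof.
rewrite /adjacent negb_or => p_vs q_vs pq /andP[pq_ms qp_ms] u_s dis_s path_s.
move=> [u_p w paths sim]; split.
- rewrite (perm_uniq (s2 := s ++ points b vs ms)); last first.
    by rewrite /points /interiors /= perm_catCA.
  by rewrite cat_uniq u_s u_p andbT; apply/hasPn => u u_pts; apply: contraL u_pts => /dis_s.
- by rewrite /= p_vs q_vs.
- by rewrite /= paths andbT.
by rewrite /= pq pq_ms qp_ms.
Qed.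

Lemma adjacent_perm es es' : perm_eq es es' -> adjacent es =2 adjacent es'.
Proof. by move=> eq_es p q; rewrite /adjacent !(perm_mem eq_es). Qed.

Lemma adjacent_fresh vs es n p : n \notin vs -> within vs es ->
  (adjacent es p n = false) * (adjacent es n p = false).
Proof.
move=> n_vs w; have /andP[/negbTE pn /negbTE np] := within_fresh p n_vs w.
by rewrite /adjacent pn np.
Qed.

(** Naming the first inner vertex [w] of the ear keeps the abstract graph simple even when [p] and
    [q] are adjacent. *)
Lemma rooted_subdivided_ear g b ms n p q w s : rooted v g b ms -> n \notin g.1 ->
  p \in g.1 -> q \in g.1 -> p != q -> uniq (w :: s) ->
  {in w :: s, forall u, u \notin points b g.1 ms} ->
  path adj (b p) (rcons (w :: s) (b q)) ->
  rooted v (n :: g.1, (p, n) :: (n, q) :: g.2) (upd b n w) (((p, n), [::]) :: ((n, q), s) :: ms).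
Proof.
move=> [emb eq_es b0 g0] n_g p_g q_g pq /= /andP[w_s u_s] dis /andP[pw path_s].
have [_ wi _ _] := emb.
have b'E i : i \in g.1 -> upd b n w i = b i by move=> i_g; rewrite (upd_in b w n_g).
have b'n : upd b n w n = w by rewrite /upd eqxx.
have ne i : i \in g.1 -> (i == n = false) * (n == i = false).
  by move=> i_g; rewrite [n == i]eq_sym; split; apply: contraTF i_g => /eqP->.
have emb1 : embedding (upd b n w) (n :: g.1) ms.
  by apply: embedding_add_vertex => //; apply: dis; apply: mem_head.
have emb2 : embedding (upd b n w) (n :: g.1) (((n, q), s) :: ms).
  apply: embedding_add_strand; rewrite ?inE ?eqxx ?q_g ?orbT //.
  - by rewrite ne.
  - by rewrite (adjacent_fresh _ n_g wi).2.
  - move=> u us; rewrite points_upd // inE negb_or dis ?inE ?us ?orbT // andbT.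
    by apply: contraNneq w_s => <-.
  - by rewrite b'n b'E.
split=> /=; rewrite ?inE ?g0 ?orbT ?perm_cons ?(upd_in b w n_g) //.
apply: embedding_add_strand; rewrite ?inE ?eqxx ?p_g ?orbT //.
- by rewrite ne.
- rewrite /adjacent /= !inE !xpair_eqE eqxx !(ne p p_g) /= (negbTE pq) /=.
  by have /andP[/negbTE-> /negbTE->] := within_fresh p n_g wi.
by rewrite /= b'n b'E // pw.
Qed.

Lemma rooted_add_ear g b ms p q s (n := fresh g.1) : rooted v g b ms ->
  p \in g.1 -> q \in g.1 -> uniq s -> {in s, forall u, u \notin points b g.1 ms} ->
  path adj (b p) (rcons s (b q)) -> (b p = b q -> 1 < size s) ->
  (s = [::] -> ~~ linked b ms (b p) (b q)) ->
  embeds v (add_ear n p q g).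
Proof.
move=> root p_g q_g u_s dis path_s loop_s link_s.
have [emb eq_es b0 g0] := root; have [u_p w paths sim] := emb.
have n_g : n \notin g.1 by apply/negP => /fresh_gt; rewrite ltnn.
have n1_g : n.+1 \notin g.1 by apply/negP => /fresh_gt; rewrite ltnNge leqnSn.
rewrite /add_ear; case: eqP => [eq_pq|/eqP pq].
  subst q; have := loop_s erefl; case: s u_s dis path_s {loop_s link_s} => [|w1 s] //.
  (* A closed ear has at least two inner vertices; its first and last ones receive the names [n] and
     [n.+1]. *)
  case: (lastP s) => [|s' w2] // u_s dis path_s _.
  have [w1s u_s'] : w1 \notin rcons s' w2 /\ uniq (rcons s' w2) by apply/andP.
  have dis2 : w2 \notin points b g.1 ms.
    by apply: dis; rewrite inE mem_rcons mem_head orbT.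
  have ne12 : w1 != w2 by apply: contraNneq w1s => ->; rewrite mem_rcons mem_head.
  have emb1 : embedding (upd b n.+1 w2) (n.+1 :: g.1) ms by apply: embedding_add_vertex.
  have n_g1 : n \notin n.+1 :: g.1 by rewrite inE negb_or n_g neq_ltn ltnSn.
  pose b2 := upd (upd b n.+1 w2) n w1.
  have pts2 : points b2 (n :: n.+1 :: g.1) ms = w1 :: w2 :: points b g.1 ms.
    by rewrite !points_upd.
  have emb2 : embedding b2 (n :: n.+1 :: g.1) ms.
    apply: embedding_add_vertex => //; rewrite points_upd // inE negb_or ne12.
    by apply: dis; apply: mem_head.
  have ne i : i \in g.1 -> [&& i != n, i != n.+1, n != i & n.+1 != i].
    by move=> /fresh_gt; rewrite -/n => lt_i; rewrite !neq_ltn lt_i (leqW lt_i) !orbT.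
  have b2E i : i \in g.1 -> b2 i = b i.
    by case/ne/and4P=> /negbTE i1 /negbTE i2 _ _; rewrite /b2 /upd i1 i2.
  have b2n : b2 n = w1 by rewrite /b2 /upd eqxx.
  have b2n1 : b2 n.+1 = w2 by rewrite /b2 /upd eqxx eqn_leq ltnn.
  have /and4P[pn pn1 np n1p] := ne p p_g.
  have w2' : within (n.+1 :: g.1) (edges_of ms) by apply: within_cons.
  have adjn i := adjacent_fresh i n_g w.
  have adjn1 i := adjacent_fresh i n1_g w.
  have n_n1 : n != n.+1 by rewrite neq_ltn ltnSn.
  move: path_s; rewrite /= !rcons_path last_rcons => /and3P[pw1 path_s w2p].
  have emb3 : embedding b2 (n :: n.+1 :: g.1) (((n.+1, p), [::]) :: ms).
    apply: embedding_add_strand; rewrite ?inE ?eqxx ?p_g ?orbT ?adjn1 //.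
    by rewrite /= b2n1 b2E // w2p.
  have emb4 : embedding b2 (n :: n.+1 :: g.1) (((n, n.+1), s') :: ((n.+1, p), [::]) :: ms).
    apply: embedding_add_strand; rewrite ?inE ?eqxx ?orbT //.
    - rewrite /adjacent /= !inE !xpair_eqE (negbTE n_n1) (negbTE np) !andbF /=.
      by have /andP[/negbTE-> /negbTE->] := within_fresh n.+1 n_g w.
    - by move: u_s'; rewrite rcons_uniq => /andP[].
    - move=> u us; rewrite [points _ _ _]pts2 !inE !negb_or dis; last first.
        by rewrite inE mem_rcons inE us !orbT.
      rewrite andbT; apply/andP; split.
        by apply: contraNneq w1s => <-; rewrite mem_rcons inE us orbT.
      by move: u_s'; rewrite rcons_uniq => /andP[+ _]; apply: contraNneq => <-.
    - by rewrite b2n b2n1 rcons_path.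
  exists b2, (((p, n), [::]) :: ((n, n.+1), s') :: ((n.+1, p), [::]) :: ms).
  split=> /=; rewrite ?inE ?g0 ?orbT ?perm_cons ?b2E //.
  apply: embedding_add_strand; rewrite ?inE ?eqxx ?p_g ?orbT //.
  - rewrite /adjacent /= !inE !xpair_eqE !eqxx (negbTE pn) (negbTE pn1) (negbTE n_n1) !andbF /=.
    by have /andP[/negbTE-> /negbTE->] := within_fresh p n_g w.
  - by rewrite /= b2n b2E // pw1.
case: ifPn => [pq_g|npq_g]; last first.
  exists b, (((p, q), s) :: ms); split; rewrite /= ?perm_cons //.
  by apply: embedding_add_strand; rewrite ?(adjacent_perm eq_es).
case: s u_s dis path_s loop_s link_s => [|w1 s] u_s dis path_s _ link_s; last first.
  by eexists; eexists; apply: rooted_subdivided_ear root n_g p_g q_g pq u_s dis path_s.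
(* The ear is a single edge of [G] parallel to an abstract edge. As it is not a link, the strand of
   that abstract edge has an inner vertex. The two exchange roles: the edge of [G] becomes the
   strand, and the old strand becomes the subdivided ear. *)
have {link_s} nl := link_s erefl.
have [bpq _] : adj (b p) (b q) /\ true by move: path_s; rewrite /= andbT.
have swap e t : (e, t) \in ms -> (e = (p, q) \/ e = (q, p)) ->
    exists w1 s, [/\ uniq (w1 :: s),
      path adj (b p) (rcons (w1 :: s) (b q)) & perm_eq (w1 :: s) t].
  move=> et_ms e_pq; have := allP paths _ et_ms; rewrite /strand_path /=.
  have u_t : uniq t.
    move: u_p; rewrite cat_uniq => /and3P[_ _].
    by have /perm_to_rem/(perm_map snd)/perm_flatten/perm_uniq-> := et_ms; rewrite /= cat_uniq => /andP[].
  have t0 : t != [::].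
    apply: contraNneq nl => t0; rewrite /linked /links.
    have in_links : (b e.1, b e.2) \in links b ms.
      by apply/flatten_mapP; exists (e, t); rewrite // t0 /= mem_head.
    by move: in_links; case: e_pq => ->; rewrite /links => ->; rewrite ?orbT.
  case: e_pq => -> /=.
    by case: t u_t t0 {et_ms} => // w1 s u_t _ path_t; exists w1, s.
  move=> path_t; have := path_t; rewrite -rev_path.
  rewrite last_rcons belast_rcons rev_cons.
  rewrite (eq_path (e' := adj)) => [path_t'|x y]; last by rewrite /= adj_sym.
  have pr : perm_eq (rev t) t by rewrite perm_rev.
  case def_t: (rev t) pr path_t' => [|w1 s] pr path_t'.
    by move: t0; rewrite -size_eq0 -size_rev def_t.
  by exists w1, s; split=> //; rewrite -(perm_uniq pr) in u_t.
have [e e_pq e_g] : exists2 e, e = (p, q) \/ e = (q, p) & e \in g.2.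
  by case/orP: pq_g => ?; [exists (p, q); first by left | exists (q, p); first by right].
have /mapP[[e' t] et_ms /= eq_e] : e \in edges_of ms by rewrite (perm_mem eq_es).
subst e'; have [w1 [s [u_s' path_s' eq_t]]] := swap _ _ et_ms e_pq.
have [ms1 eq_ms [emb1 eq_es1 _ _]] := rooted_pull root et_ms.
have root1 : rooted v g b ((e, [::]) :: ms1).
  have [u_p1 /= w1' /= /andP[_ paths1] /= sim1] := emb1.
  split=> //; split=> //=.
    move: u_p1; rewrite /points /interiors /= !cat_uniq has_cat negb_or.
    by case/and3P=> -> /andP[_ ->] /andP[_ /andP[_ ->]].
  rewrite paths1 andbT /strand_path /=.
  by case: e_pq => -> /=; rewrite ?[adj (b q) _]adj_sym bpq.
eexists; eexists.
apply: (rooted_subdivided_ear root1 n_g p_g q_g pq u_s' _ path_s') => u.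
rewrite (perm_mem eq_t) => ut.
have [u_p1 _ _ _] := emb1; move: u_p1; rewrite /points /interiors /= cat_uniq.
case/and3P=> _ /hasPn dis1; rewrite cat_uniq => /and3P[_ /hasPn dis2 _].
rewrite mem_cat negb_or; apply/andP; split.
  by apply: dis1; rewrite mem_cat ut.
by apply: contraL ut; apply: dis2.
Qed.
End Ears.

(** The recursion contracts in the order of the list, but the characterization by labellings does
    not depend on that order. *)
Lemma cyc_perm vs es es' : uniq vs -> within vs es -> perm_eq es es' -> cyc es = cyc es'.
Proof.
have le : forall es es', uniq vs -> within vs es -> perm_eq es es' -> cyc es' <= cyc es.
  move=> {}es {}es' u_vs w eq_es.
  have w' : within vs es' by rewrite /within -(perm_all _ eq_es).
  have [f [f_const _ f_le]] := cyc_le_labels w' u_vs.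
  have f_const' e : e \in es -> f e.1 = f e.2 by rewrite (perm_mem eq_es); apply: f_const.
  have := cyc_ge_labels w u_vs f_const'; rewrite (perm_size eq_es) => f_ge.
  by rewrite -(leq_add2l (size vs)); apply: leq_trans f_le f_ge.
move=> u_vs w eq_es; apply/eqP; rewrite eqn_leq !le ?(perm_sym es') //.
by rewrite /within -(perm_all _ eq_es).
Qed.

Section Successors.
Variables (G : sgraph) (v : G).
Implicit Types (b : nat -> G) (ms : seq (strand G)).

Lemma rooted_new_triangle g b ms s : rooted v g b ms -> is_cycle s ->
  {in s, forall u, u \notin points b g.1 ms} -> embeds v (new_triangle g).
Proof.
move=> [emb eq_es b0 g0] [sz /andP[cyc_s u_s]] dis.
have [u_p w paths sim] := emb.
set n := fresh g.1.
have [e01 e10] : (n == n.+1 = false) /\ (n.+1 == n = false).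
  by rewrite [n.+1 == n]eq_sym; split; apply/negbTE; rewrite neq_ltn ltnSn.
have [e02 e20] : (n == n.+2 = false) /\ (n.+2 == n = false).
  by rewrite [n.+2 == n]eq_sym; split; apply/negbTE; rewrite neq_ltn leqnSn.
have [e12 e21] : (n.+1 == n.+2 = false) /\ (n.+2 == n.+1 = false) by rewrite !eqSS.
have n_le1 : n <= n.+1 by exact: leqnSn.
have n_le2 : n <= n.+2 by exact: leqW.
(* The first, second and last vertices of the cycle become the vertices of the new triangle; all the
   others lie on the strand from [w2] to [w3]. *)
case: s sz cyc_s u_s dis => [|w1 [|w2 s]] // sz; case: (lastP s) sz => [|s' w3] // _.
move=> cyc_s u_s dis.
have ng k : n <= k -> k \notin g.1.
  by move=> le_k; apply/negP => /fresh_gt; rewrite -/n ltnNge le_k.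
have ne i k : i \in g.1 -> n <= k -> (i == k = false) * (k == i = false).
  move=> i_g /ng k_g; rewrite [k == i]eq_sym; split; apply: contraNF k_g => /eqP<- //.
have uniq3 : uniq [:: w1, w2, w3 & s'].
  rewrite (perm_uniq (s2 := [:: w1, w2 & rcons s' w3])) // !perm_cons perm_sym.
  by rewrite perm_rcons.
have dis3 u : u \in [:: w1, w2, w3 & s'] -> u \notin points b g.1 ms.
  move=> u3; apply: dis; move: u3; rewrite !inE mem_rcons inE.
  by case/or4P=> ->; rewrite ?orbT.
move: uniq3; rewrite /= !inE !negb_or => /and4P[/and3P[n12 n13 n1s] /andP[n23 n2s] n3s u_s'].
move: cyc_s; rewrite /= !rcons_path last_rcons => /and3P[a12 /andP[p23 a23] a31].
have n1 : n.+1 \notin n.+2 :: g.1 by rewrite inE negb_or ng // e12.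
have n0 : n \notin [:: n.+1, n.+2 & g.1].
  by rewrite !inE !negb_or ng // e01 e02.
have emb1 : embedding (upd b n.+2 w3) (n.+2 :: g.1) ms.
  by apply: embedding_add_vertex => //; [exact: ng | apply: dis3; rewrite !inE eqxx !orbT].
have pts1 : points (upd b n.+2 w3) (n.+2 :: g.1) ms = w3 :: points b g.1 ms.
  by apply: points_upd; apply: ng.
have emb2 : embedding (upd (upd b n.+2 w3) n.+1 w2) [:: n.+1, n.+2 & g.1] ms.
  apply: embedding_add_vertex => //; rewrite pts1 inE negb_or n23.
  by apply: dis3; rewrite !inE eqxx !orbT.
have pts2 : points (upd (upd b n.+2 w3) n.+1 w2) [:: n.+1, n.+2 & g.1] ms =
    [:: w2, w3 & points b g.1 ms] by rewrite points_upd // pts1.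
pose b3 := upd (upd (upd b n.+2 w3) n.+1 w2) n w1.
pose vs3 := [:: n, n.+1, n.+2 & g.1].
have emb3 : embedding b3 vs3 ms.
  apply: embedding_add_vertex => //; rewrite pts2 !inE !negb_or n12 n13.
  by apply: dis3; rewrite !inE eqxx.
have pts3 : points b3 vs3 ms = [:: w1, w2, w3 & points b g.1 ms].
  by rewrite points_upd // pts2.
have b3E i : i \in g.1 -> b3 i = b i.
  by move=> i_g; rewrite /b3 /upd (ne i n) // (ne i n.+1) // (ne i n.+2).
have b3n : b3 n = w1 by rewrite /b3 /upd eqxx.
have b3n1 : b3 n.+1 = w2 by rewrite /b3 /upd eqxx e10.
have b3n2 : b3 n.+2 = w3 by rewrite /b3 /upd eqxx e20 e21.
have adjF i k : n <= k -> adjacent (edges_of ms) i k = false.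
  by move=> /ng k_g; rewrite (adjacent_fresh _ k_g w).1.
have memF i k : n <= k -> ((i, k) \in edges_of ms = false) * ((k, i) \in edges_of ms = false).
  by move=> /ng k_g; have /andP[/negbTE ? /negbTE ?] := within_fresh i k_g w.
have in0 : n \in vs3 by rewrite !inE eqxx.
have in1 : n.+1 \in vs3 by rewrite !inE eqxx orbT.
have in2 : n.+2 \in vs3 by rewrite !inE eqxx !orbT.
exists b3, (((n, n.+1), [::]) :: ((n.+1, n.+2), s') :: ((n.+2, n), [::]) :: ms).
split=> /=; rewrite ?inE ?g0 ?orbT ?perm_cons ?(b3E 0) //.
have emb4 : embedding b3 vs3 (((n.+2, n), [::]) :: ms).
  apply: embedding_add_strand => //; rewrite ?adjF ?e20 //.
  by rewrite /= b3n b3n2 a31.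
have emb5 : embedding b3 vs3 (((n.+1, n.+2), s') :: ((n.+2, n), [::]) :: ms).
  apply: embedding_add_strand => //; rewrite ?e12 //.
  - by rewrite /adjacent /= !inE !xpair_eqE !(memF _ n.+2 n_le2) e12 e10 /= andbF.
  - move=> u us; rewrite [points _ _ _]pts3 !inE !negb_or dis3 ?inE ?us ?orbT // andbT.
    by apply/and3P; split; [move: n1s|move: n2s|move: n3s]; apply: contraNneq => <-.
  by rewrite b3n1 b3n2 rcons_path p23.
apply: embedding_add_strand => //; rewrite ?e01 //.
  rewrite /adjacent /= !inE !xpair_eqE e01 e02 e12 e10 /= !(memF _ n.+1 n_le1).
  by rewrite eqxx.
by rewrite /= b3n b3n1 a12.
Qed.

Lemma linked_sym b ms : symmetric (linked b ms).
Proof. by move=> x y; rewrite /linked orbC. Qed.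

(** The ends of the ear given by [ear_exists] are promoted one after the other, the second in the
    graph obtained from the first. An ear ending at the root is reversed so as to start there, which
    is how [successors] lists it. *)
Lemma successors_complete g b ms x : rooted v g b ms -> x \in g.1 ->
  cyc (avoid x g.2) <= 1 -> ~ cyc_le adj (~: [set b x]) 1 ->
  exists2 g', g' \in successors x g & embeds v g'.
Proof.
move=> root x_g c1 not_apex; have [emb eq_es b0 g0] := root.
have {}c1 : cyc (avoid x (edges_of ms)) <= 1.
  rewrite (@cyc_perm g.1 _ (avoid x g.2)) //.
  - exact: embedding_uniq emb.
  - have [_ /withinP w _ _] := emb.
    by apply/withinP => e; rewrite mem_filter => /andP[_ /w].
  exact: perm_filter.
have [//|[s [cyc_s dis]]|] := ear_exists emb x_g c1.
  exists (new_triangle g); last exact: rooted_new_triangle root cyc_s dis.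
  by rewrite !mem_cat inE eqxx !orbT.
have rooted_ear u2 s : u2 \in points b g.1 ms -> u2 != b x -> v != b x ->
    uniq s -> {in s, forall u, u \notin points b g.1 ms} ->
    path adj v (rcons s u2) -> (v = u2 -> 1 < size s) ->
    (s = [::] -> ~~ linked b ms v u2) ->
    exists2 g', g' \in successors x g & embeds v g'.
  move=> u2P u2x vx u_s dis path_s loop_s link_s.
  have [c [b' [ms' [c_att [root' b'E] [c2 sub] b'c [ptsE links_sub]]]]] :=
    promote root x_g u2P u2x.
  have x0 : x == 0 = false by apply: contra_neqF vx => /eqP->.
  have b'0 : b' 0 = v by rewrite b'E.
  exists (add_ear (fresh c.1.1) 0 c.2 c.1).
    by rewrite /successors x0 mem_cat; apply/orP; left; apply: map_f.
  apply: (rooted_add_ear root' (sub _ g0) c2 u_s); rewrite ?b'0 ?b'c //.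
    by move=> u /dis; rewrite ptsE.
  by move=> /link_s; apply: contra => /orP[]/links_sub; rewrite /linked => ->; rewrite ?orbT.
case=> u1 [u2 [s [[u1P u2P u1x u2x] [u_s dis] path_s loop_s link_s]]].
have [eq_u1|u1v] := eqVneq u1 v; first by subst u1; apply: (rooted_ear u2 s).
have [eq_u2|u2v] := eqVneq u2 v.
  subst u2; apply: (rooted_ear u1 (rev s)); rewrite ?rev_uniq ?size_rev //.
  - by move=> u; rewrite mem_rev; apply: dis.
  - have := path_s; rewrite -rev_path last_rcons belast_rcons rev_cons.
    by rewrite (eq_path (e' := adj)) // => a c /=; rewrite adj_sym.
  - by move/esym.
  by move/eqP; rewrite -size_eq0 size_rev size_eq0 => /eqP/link_s; rewrite linked_sym.
have [c [b' [ms' [c_att [root' b'E] [c2 sub] b'c [ptsE links_sub]]]]] :=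
  promote root x_g u1P u1x.
have u2P' : u2 \in points b' c.1.1 ms' by rewrite ptsE.
have u2x' : u2 != b' x by rewrite b'E.
have [d [b2 [ms2 [d_att [root2 b2E] [d2 sub2] b2d [ptsE2 links_sub2]]]]] :=
  promote root' (sub _ x_g) u2P' u2x'.
exists (add_ear (fresh d.1.1) c.2 d.2 d.1).
  rewrite !mem_cat; apply/orP; right; apply/orP; left.
  apply/allpairsPdep; exists c, d; split=> //; rewrite mem_filter ?c_att ?d_att andbT.
    by apply: contraNneq u1v => c0; rewrite -b'c c0 b'E // b0.
  apply: contraNneq u2v => d0; rewrite -b2d d0 b2E ?sub //.
  by rewrite b'E ?b0.
have b2c : b2 c.2 = u1 by rewrite b2E.
apply: (rooted_add_ear root2 (sub2 _ c2) d2 u_s); rewrite ?b2c ?b2d //.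
  by move=> u /dis; rewrite ptsE2 ptsE.
move=> /link_s; apply: contra => /orP[]/links_sub2/links_sub; rewrite /linked => ->; rewrite ?orbT //.
Qed.
End Successors.

(** * Normal forms of abstract graphs *)

Definition incident (w : nat) (e : edge) := if e.1 == w then true else e.2 == w.

Definition other_end (w : nat) (e : edge) := if e.1 == w then e.2 else e.1.

(** A vertex of degree 2 stays if its neighbours are adjacent, because abstract graphs have to
    remain simple. *)
Definition suppress (w : nat) g : graph :=
  if [seq e <- g.2 | incident w e] is [:: e1; e2] then
    let x := other_end w e1 in let y := other_end w e2 in
    if adjacent g.2 x y then g
    else ([seq z <- g.1 | z != w], (x, y) :: [seq e <- g.2 | ~~ incident w e])
  else g.

(** Sorting puts vertex 0 first, so the root keeps its number. *)
Definition renumber g : graph :=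
  let m := sort leq g.1 in
  (iota 0 (size m), [seq (index e.1 m, index e.2 m) | e <- g.2]).

Definition normalize g : graph :=
  renumber (foldr suppress g [seq w <- g.1 | w != 0]).

(** The list [m] gives the images of 0, 1, and so on under an injective homomorphism into [g]; it
    may be neither onto nor induced. *)
Definition is_image es (m : seq nat) g :=
  [&& simple es, within (iota 0 (size m)) es, uniq m, all (mem g.1) m &
    all (fun e => adjacent g.2 (nth 0 m e.1) (nth 0 m e.2)) es].

Lemma perm_swap (T : eqType) (x y : T) s : perm_eq (x :: y :: s) (y :: x :: s).
Proof. by apply/permP => a /=; rewrite addnCA. Qed.

Lemma perm_move_in (T : eqType) (u : T) p s1 s2 r :
  perm_eq ((u :: p) ++ s1 ++ s2 ++ r) (p ++ (s1 ++ u :: s2) ++ r).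
Proof. by apply/permP => a; rewrite ?count_cat /= ?count_cat /= ?count_cat /=; lia. Qed.

Section Reshaping.
Variables (G : sgraph) (v : G).
Implicit Types (b : nat -> G) (ms : seq (strand G)).

Lemma embedding_flip b vs ms x y s : embedding b vs (((x, y), s) :: ms) ->
  embedding b vs (((y, x), rev s) :: ms).
Proof.
move=> [u_p /= /andP[/andP[xvs yvs] w] /andP[path_s paths] /and4P[xy xy_ms yx_ms sim]].
split; rewrite /= ?xvs ?yvs ?paths ?andbT //.
- rewrite (perm_uniq (s2 := points b vs (((x, y), s) :: ms))) //.
  by rewrite perm_cat2l /interiors /= perm_cat2r perm_rev.
- move: path_s; rewrite /strand_path /= -rev_path last_rcons belast_rcons rev_cons.
  by rewrite (eq_path (e' := adj)) // => a c /=; rewrite adj_sym.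
by rewrite eq_sym xy yx_ms xy_ms.
Qed.

Lemma orient b vs ms e s w : embedding b vs ((e, s) :: ms) -> incident w e ->
  (exists s', embedding b vs (((other_end w e, w), s') :: ms)) /\
  (exists s', embedding b vs (((w, other_end w e), s') :: ms)).
Proof.
case: e => x y emb; rewrite /incident /other_end /=.
case: (eqVneq x w) => [eq_x _|_ /eqP eq_y]; subst w.
  by split; [exists (rev s); apply: embedding_flip | exists s].
by split; [exists s | exists (rev s); apply: embedding_flip].
Qed.

Lemma embedding_suppress b vs ms x w y s1 s2 :
  all (fun e => ~~ incident w e) (edges_of ms) -> ~~ adjacent (edges_of ms) x y ->
  embedding b vs (((x, w), s1) :: ((w, y), s2) :: ms) ->
  embedding b [seq z <- vs | z != w] (((x, y), s1 ++ b w :: s2) :: ms).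
Proof.
move=> no_w; rewrite /adjacent negb_or => /andP[xy_ms yx_ms] emb.
have u_vs := embedding_uniq emb.
have [u_p /= /and3P[/andP[/= xvs wvs] /andP[_ yvs] wi] /and3P[/= p1 p2 paths]] := emb.
rewrite /= !inE !xpair_eqE !eqxx !negb_or /= => /and4P[xw _ /andP[yx _] /and4P[wy _ _ sim]].
split=> /=.
- rewrite (perm_uniq (s2 := points b vs (((x, w), s1) :: ((w, y), s2) :: ms))) //.
  have eq_vs : perm_eq vs (w :: [seq z <- vs | z != w]).
    by rewrite -rem_filter // perm_to_rem.
  rewrite perm_sym; apply: perm_trans (perm_cat (perm_map b eq_vs) (perm_refl _)) _.
  exact: perm_move_in.
- rewrite !mem_filter xvs xw yvs eq_sym wy /=.
  apply/withinP => e e_ms; have [? ?] := withinP _ _ wi _ e_ms.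
  have := allP no_w _ e_ms; rewrite /incident !mem_filter.
  by case: ifPn => //= _ e2w; rewrite e2w; split.
- rewrite paths andbT; move: p1 p2; rewrite /strand_path /= rcons_cat cat_path /= rcons_path.
  by case/andP=> -> -> ->.
by rewrite yx xy_ms yx_ms sim.
Qed.

Lemma embeds_suppress w g : w != 0 -> embeds v g -> embeds v (suppress w g).
Proof.
move=> w0 [b [ms root]]; rewrite /suppress.
case def_inc: [seq e <- g.2 | incident w e] => [|e1 [|e2 [|? ?]]]; try by exists b, ms.
case: ifPn => [_|nadj]; first by exists b, ms.
have [emb eq_es b0 g0] := root.
have eq_g : perm_eq g.2 (e1 :: e2 :: [seq e <- g.2 | ~~ incident w e]).
  by rewrite -[e1 :: _]/([:: e1; e2] ++ _) -def_inc perm_sym; apply/permPl/perm_filterC.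
have /andP[inc1 /andP[inc2 _]] : all (incident w) [:: e1; e2].
  by rewrite -def_inc filter_all.
have eq_ms : perm_eq (edges_of ms) (e1 :: e2 :: [seq e <- g.2 | ~~ incident w e]).
  exact: perm_trans eq_es eq_g.
have /mapP[[e1' t1] m1 /= eq1] : e1 \in edges_of ms by rewrite (perm_mem eq_ms) mem_head.
subst e1'; have [ms1 eq_ms1 [emb1 eq_es1 _ _]] := rooted_pull root m1.
have eq_es1' : perm_eq (edges_of ms1) (e2 :: [seq e <- g.2 | ~~ incident w e]).
  by rewrite -(perm_cons e1); apply: perm_trans eq_es1 eq_g.
have /mapP[[e2' t2] m2 /= eq2] : e2 \in edges_of ms1 by rewrite (perm_mem eq_es1') mem_head.
subst e2'; have eq_ms2 := perm_to_rem m2; set ms2 := rem _ _ in eq_ms2.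
have eq_es2 : perm_eq (edges_of ms2) [seq e <- g.2 | ~~ incident w e].
  rewrite -(perm_cons e2); apply: perm_trans eq_es1'; rewrite perm_sym.
  exact: (perm_map fst eq_ms2).
have emb2 : embedding b g.1 ((e1, t1) :: (e2, t2) :: ms2).
  by apply: embedding_perm emb1; rewrite perm_cons.
have [[s1 emb3] _] := orient emb2 inc1.
have emb4 : embedding b g.1 ((e2, t2) :: ((other_end w e1, w), s1) :: ms2).
  by apply: embedding_perm emb3; apply: perm_swap.
have [_ [s2 emb5]] := orient emb4 inc2.
have emb6 : embedding b g.1 (((other_end w e1, w), s1) :: ((w, other_end w e2), s2) :: ms2).
  by apply: embedding_perm emb5; apply: perm_swap.
exists b, (((other_end w e1, other_end w e2), s1 ++ b w :: s2) :: ms2).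
split=> //=; last by rewrite mem_filter g0 eq_sym w0.
  apply: embedding_suppress emb6.
    by rewrite (perm_all _ eq_es2) filter_all.
  rewrite (adjacent_perm eq_es2); apply: contra nadj.
  by rewrite /adjacent !mem_filter => /orP[]/andP[_ ->]; rewrite ?orbT.
by rewrite perm_cons.
Qed.

(** As [es] is simple and [m] injective, distinct edges of [es] are sent to distinct edges; each can
    therefore take its strand out of [ms], reversed if the orientations differ. *)
Lemma image_strands b b2 m es ms :
  (forall i, i < size m -> b2 i = b (nth 0 m i)) -> uniq m ->
  uniq (interiors ms) -> all (strand_path b) ms ->
  simple es -> within (iota 0 (size m)) es ->
  (forall e, e \in es -> adjacent (edges_of ms) (nth 0 m e.1) (nth 0 m e.2)) ->
  exists ms2, [/\ edges_of ms2 = es, uniq (interiors ms2),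
    {subset interiors ms2 <= interiors ms} & all (strand_path b2) ms2].
Proof.
move=> b2E u_m; elim: es ms => [|[i j] es IHes] ms u_int paths.
  by exists [::]; split.
move=> /= /and4P[ij ij_es ji_es sim] /andP[/andP[/= i_m j_m] w] adj_es.
rewrite !mem_iota !add0n /= in i_m j_m.
have [e [t [et_ms e_ij]]] : exists e t, (e, t) \in ms /\
    (e = (nth 0 m i, nth 0 m j) \/ e = (nth 0 m j, nth 0 m i)).
  have := adj_es _ (mem_head _ _); rewrite /adjacent /= => /orP[]/mapP[[e t] et_ms /= eq_e].
    by exists e, t; split; [|left].
  by exists e, t; split; [|right].
have eq_ms := perm_to_rem et_ms; set ms1 := rem _ _ in eq_ms.
have eq_int : perm_eq (interiors ms) (t ++ interiors ms1).
  exact: (perm_flatten (perm_map snd eq_ms)).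
have {u_int} : uniq (t ++ interiors ms1) by rewrite -(perm_uniq eq_int).
rewrite cat_uniq => /and3P[u_t dis u_int1].
have := paths; rewrite (perm_all _ eq_ms) /= => /andP[path_t paths1].
have [|||||ms2 [eq_es2 u_int2 sub2 paths2]] := IHes ms1 => //.
  move=> [k l] kl_es /=.
  have /= [k_m l_m] := withinP _ _ w _ kl_es; rewrite !mem_iota !add0n /= in k_m l_m.
  have nth_eq x y : x < size m -> y < size m -> nth 0 m x = nth 0 m y -> x = y.
    by move=> x_m y_m /eqP; rewrite nth_uniq // => /eqP.
  have : adjacent (edges_of ms) (nth 0 m k) (nth 0 m l).
    by apply: (adj_es (k, l)); rewrite inE kl_es orbT.
  rewrite (adjacent_perm (perm_map fst eq_ms)) /adjacent /= !inE.
  have kl_ij : (k, l) <> (i, j) by move=> eq_kl; rewrite -eq_kl kl_es in ij_es.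
  have kl_ji : (k, l) <> (j, i) by move=> eq_kl; rewrite -eq_kl kl_es in ji_es.
  case/orP=> /predU1P[eq_e|->]; rewrite ?orbT //.
    by case: e_ij; rewrite -eq_e => -[/nth_eq e1 /nth_eq e2];
      [case: kl_ij | case: kl_ji]; rewrite e1 // e2.
  by case: e_ij; rewrite -eq_e => -[/nth_eq e1 /nth_eq e2];
    [case: kl_ji | case: kl_ij]; rewrite e1 // e2.
have [t' eq_t path_t'] : exists2 t', perm_eq t' t & path adj (b2 i) (rcons t' (b2 j)).
  rewrite !b2E //; case: e_ij path_t => -> /=; first by exists t.
  rewrite /strand_path /= => path_t; exists (rev t); first by rewrite perm_rev.
  move: path_t; rewrite -rev_path last_rcons belast_rcons rev_cons.
  by rewrite (eq_path (e' := adj)) // => a c /=; rewrite adj_sym.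
exists (((i, j), t') :: ms2); split=> /=.
- by rewrite eq_es2.
- rewrite /interiors /= cat_uniq (perm_uniq eq_t) u_t u_int2 andbT.
  apply/hasPn => u /sub2 u_int; rewrite (perm_mem eq_t).
  exact: (hasPn dis).
- move=> u; rewrite /interiors /= mem_cat (perm_mem eq_t) (perm_mem eq_int) mem_cat.
  by case/orP=> [->//|/sub2->]; rewrite orbT.
by rewrite /strand_path /= path_t'.
Qed.

(** A subgraph containing the root inherits the embedding. The default 1 in [nth 1 m 0 = 0] rules
    out an empty [m]. *)
Lemma embeds_image es m g : is_image es m g -> nth 1 m 0 = 0 -> embeds v g ->
  embeds v (iota 0 (size m), es).
Proof.
case/and5P=> sim w u_m /allP m_g /allP adj_es m0 [b [ms [emb eq_es b0 g0]]].
have [u_p wi paths _] := emb.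
pose b2 i := b (nth 0 m i).
have u_int : uniq (interiors ms) by move: u_p; rewrite cat_uniq => /and3P[].
have adj_ms e : e \in es -> adjacent (edges_of ms) (nth 0 m e.1) (nth 0 m e.2).
  by move=> e_es; rewrite (adjacent_perm eq_es) adj_es.
have [ms2 [eq_es2 u_int2 sub2 paths2]] :=
  @image_strands b b2 m es ms (fun _ _ => erefl) u_m u_int paths sim w adj_ms.
have m_pos : 0 < size m by case: (m) m0.
have map_b2 : map b2 (iota 0 (size m)) = map b m.
  by rewrite (map_comp b (nth 0 m)) map_nth_iota0 // take_size.
exists b2, ms2; split=> /=; rewrite ?eq_es2 ?mem_iota //.
- split; rewrite ?eq_es2 //.
  rewrite /points map_b2 cat_uniq u_int2 andbT; apply/andP; split.
    rewrite map_inj_in_uniq // => i j /m_g i_g /m_g j_g.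
    exact: (embedding_inj emb).
  apply/hasPn => u /sub2 u_int'; apply/mapP => -[i /m_g i_g eq_u].
  by have := interior_not_vertex emb u_int' i_g; rewrite eq_u eqxx.
by rewrite /b2 (set_nth_default 1) // m0.
Qed.

Lemma simple_renumber vs es : within vs es -> simple es ->
  simple [seq (index e.1 vs, index e.2 vs) | e <- es].
Proof.
move=> /withinP w /simpleP[u_es sim]; apply/simpleP.
have inj x y : x \in vs -> index x vs = index y vs -> x = y.
  move=> x_vs eq_xy; have y_vs : y \in vs by rewrite -index_mem -eq_xy index_mem.
  by rewrite -[x](nth_index 0 x_vs) eq_xy nth_index.
split=> [|_ _ /mapP[[x y] xy_es [-> ->]]].
  rewrite map_inj_in_uniq // => -[x y] [x' y'] /w[/= xvs yvs] _ [ex ey].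
  by rewrite (inj _ _ xvs ex) (inj _ _ yvs ey).
have [/= xvs yvs] := w _ xy_es; have [xy yx_es] := sim _ _ xy_es; split.
  by apply: contraNneq xy => /inj->.
apply: contra yx_es => /mapP[[y' x'] es' [ey ex]].
by rewrite (inj _ _ xvs ex) (inj _ _ yvs ey).
Qed.

Lemma embeds_renumber g : embeds v g -> embeds v (renumber g).
Proof.
move=> emb_g; have [b [ms [emb eq_es b0 g0]]] := emb_g.
set m := sort leq g.1.
have m_g : m =i g.1 by apply: mem_sort.
have [_ w _ sim] := emb.
have w' : within m g.2.
  apply/withinP => e e_g; rewrite !m_g; apply: (withinP _ _ w).
  by rewrite (perm_mem eq_es).
apply: (@embeds_image _ m g) => //; last first.
  have : 0 \in m by rewrite m_g.
  have := sort_sorted leq_total g.1; rewrite -/m; case: (m) => //= x m' path_m.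
  rewrite inE => /predU1P[//|m'0].
  by have := allP (order_path_min leq_trans path_m) _ m'0; rewrite leqn0 => /eqP.
apply/and5P; split.
- exact: simple_renumber w' (simple_perm eq_es sim).
- apply/withinP => _ /mapP[e e_g ->]; rewrite !mem_iota !add0n /= !index_mem.
  exact: (withinP _ _ w').
- by rewrite sort_uniq; apply: embedding_uniq emb.
- by apply/allP => i; rewrite m_g.
apply/allP => _ /mapP[e e_g ->] /=; have [? ?] := withinP _ _ w' _ e_g.
by rewrite !nth_index // /adjacent -surjective_pairing e_g.
Qed.

Lemma embeds_normalize g : embeds v g -> embeds v (normalize g).
Proof.
move=> emb_g; apply: embeds_renumber.
have : all (fun w => w != 0) [seq w <- g.1 | w != 0] by apply: filter_all.
elim: (filter _ _) => //= w ws IHws /andP[w0 /IHws]; exact: embeds_suppress.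
Qed.
End Reshaping.

(** * Branch sets and reduction of abstract graphs *)

(* The first test is a shortcut: with that many edges, cyc es' >= 2.            *)
Fixpoint find_apex n vs es : option nat :=
  if vs is x :: vs' then
    let es' := avoid x es in
    if n <= size es' then find_apex n vs' es
    else if cyc es' <= 1 then Some x else find_apex n vs' es
  else None.

Definition apex_of g := find_apex (size g.1) g.1 g.2.

Definition has_apex g := if apex_of g is Some _ then true else false.

Lemma apex_ofP g x : apex_of g = Some x -> x \in g.1 /\ cyc (avoid x g.2) <= 1.
Proof.
rewrite /apex_of; move: (size g.1) => n; elim: (g.1) => //= y vs IHvs.
case: ifP => _; last case: ifP => [c1 [<-]|_]; rewrite ?mem_head //.
  by case/IHvs=> x_vs ->; rewrite inE x_vs orbT.
by case/IHvs=> x_vs ->; rewrite inE x_vs orbT.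
Qed.

Definition simplify es : seq edge :=
  foldr (fun e r => if e.1 == e.2 then r else if adjacent r e.1 e.2 then r else e :: r)
    [::] es.

Definition contract_edge (x y : nat) g : graph :=
  ([seq z <- g.1 | z != y], simplify (map (merge_edge x y) g.2)).

Definition delete_edge (x y : nat) g : graph :=
  (g.1, [seq e <- g.2 | (e != (x, y)) && (e != (y, x))]).

(** Edges are contracted, or failing that deleted, as long as no apex appears, in order to come
    close to a minor-minimal graph. The argument [n] is fuel; that the result is a minor is
    [model_reduce]. *)
Fixpoint reduce n (todo : seq edge) g : graph :=
  match n, todo with
  | n'.+1, (x, y) :: todo' =>
    if x == y then reduce n' todo' g
    else if adjacent g.2 x y then
      let g1 := contract_edge x y g in
      if has_apex g1 then
        let g2 := delete_edge x y g in
        if has_apex g2 then reduce n' todo' g else reduce n' todo' g2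
      else reduce n' (map (merge_edge x y) todo') g1
    else reduce n' todo' g
  | _, _ => g
  end.

Lemma simplifyP es e : e \in simplify es -> e \in es /\ e.1 != e.2.
Proof.
elim: es => //= f es IHes; case: ifPn => [_ /IHes[] | f12].
  by rewrite inE => -> ->; rewrite orbT.
case: ifP => _; first by case/IHes; rewrite inE => -> ->; rewrite orbT.
by rewrite !inE => /predU1P[->|/IHes[-> ->]]; rewrite ?eqxx ?orbT.
Qed.

Section Models.
Variables (G : sgraph) (A : {set G}).
Implicit Types (B : {set G}).

(** Branch sets inside [A]: weaker than an embedding, but stable under the contractions made by
    [reduce]. *)
Definition model g : Prop := exists B : nat -> {set G},
  [/\ within g.1 g.2,
      forall i, i \in g.1 -> [/\ B i != set0, B i \subset A & connected_in (B i)],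
      forall i j u, i \in g.1 -> j \in g.1 -> u \in B i -> u \in B j -> i = j &
      forall e, e \in g.2 -> exists u v, [/\ u \in B e.1, v \in B e.2 & adj u v]].

Lemma connected_in_sub (B B' : {set G}) u v : B \subset B' ->
  connect [rel a b | [&& a \in B, b \in B & adj a b]] u v ->
  connect [rel a b | [&& a \in B', b \in B' & adj a b]] u v.
Proof.
move=> /subsetP sub; apply: connect_sub => a b /= /and3P[aB bB ab].
by apply: connect1; rewrite /= !sub.
Qed.

Lemma connected_inU (B C : {set G}) u v : connected_in B -> connected_in C ->
  u \in B -> v \in C -> adj u v -> connected_in (B :|: C).
Proof.
move=> cB cC uB vC uv.
have sym_c : connect_sym [rel a b | [&& a \in B :|: C, b \in B :|: C & adj a b]].
  by apply: sym_connect_sym => a b /=; rewrite adj_sym andbCA.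
have to_u a : a \in B :|: C ->
    connect [rel a b | [&& a \in B :|: C, b \in B :|: C & adj a b]] a u.
  case/setUP=> [aB|aC].
    by apply: (connected_in_sub (subsetUl B C)); apply: cB.
  apply: (@connect_trans _ _ v).
    by apply: (connected_in_sub (subsetUr B C)); apply: cC.
  by apply: connect1; rewrite /= !inE uB vC orbT adj_sym.
by move=> a b aBC bBC; apply: connect_trans (to_u a aBC) _; rewrite sym_c to_u.
Qed.

Lemma model_contract x y g : x != y -> adjacent g.2 x y -> model g -> model (contract_edge x y g).
Proof.
move=> xy adj_xy [B [w B_ok B_dis B_adj]].
have [[x_g y_g] [u [v [uB vB uv]]]] :
    (x \in g.1 /\ y \in g.1) /\ exists u v, [/\ u \in B x, v \in B y & adj u v].
  case/orP: adj_xy => xy_g; have [/= ? ?] := withinP _ _ w _ xy_g.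
    by split=> //; apply: (B_adj _ xy_g).
  split=> //; have [u [v [uB vB uv]]] := B_adj _ xy_g.
  by exists v, u; rewrite adj_sym.
have merge_in z : z \in g.1 -> merge_into x y z \in [seq z <- g.1 | z != y].
  by rewrite mem_filter /merge_into; case: (eqVneq z y) => [_|->]; rewrite ?xy.
exists (fun i => if i == x then B x :|: B y else B i); split.
- apply/withinP => e /simplifyP[/mapP[f f_g ->] _].
  by have [f1 f2] := withinP _ _ w _ f_g; split; apply: merge_in.
- move=> i; rewrite mem_filter => /andP[iy i_g]; case: (eqVneq i x) => [_|_]; last exact: B_ok.
  have [[Bx0 BxA Bx_c] [_ ByA By_c]] := (B_ok x x_g, B_ok y y_g); split.
  + by apply/set0Pn; exists u; rewrite inE uB.
  + by rewrite subUset BxA.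
  exact: connected_inU Bx_c By_c uB vB uv.
- move=> i j z; rewrite !mem_filter => /andP[iy i_g] /andP[jy j_g].
  case: (eqVneq i x) => [->|/eqP ix]; case: (eqVneq j x) => [->|/eqP jx] //; rewrite ?inE.
  + case/orP=> zB zBj; first by case: jx; apply: (B_dis _ _ z).
    by rewrite (B_dis j y z) ?eqxx // in jy.
  + move=> zBi /orP[] zB; first by case: ix; apply: (B_dis _ _ z).
    by rewrite (B_dis i y z) ?eqxx // in iy.
  exact: B_dis.
move=> _ /simplifyP[/mapP[f f_g ->] _]; have [a [c [aB cB ac]]] := B_adj _ f_g.
have in_B' z k : z \in B k ->
    z \in (if merge_into x y k == x then B x :|: B y else B (merge_into x y k)).
  rewrite /merge_into; case: (eqVneq k y) => [->|_]; rewrite ?eqxx ?inE.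
    by move=> ->; rewrite orbT.
  by case: eqP => [->|//]; rewrite inE => ->.
by exists a, c; split=> //; apply: in_B'.
Qed.

Lemma model_sub vs' es' g : {subset es' <= g.2} -> {subset vs' <= g.1} -> within vs' es' ->
  model g -> model (vs', es').
Proof.
move=> sub_e sub_v w' [B [w B_ok B_dis B_adj]]; exists B; split=> //=.
- by move=> i /sub_v/B_ok.
- by move=> i j u /sub_v i_g /sub_v j_g; apply: B_dis.
by move=> e /sub_e/B_adj.
Qed.

Lemma model_within g : model g -> within g.1 g.2.
Proof. by case=> B []. Qed.

Lemma model_reduce n todo g : model g -> model (reduce n todo g).
Proof.
elim: n todo g => [|n IHn] [|[x y] todo] g //= mod_g.
case: ifPn => [_|xy]; first exact: IHn.
case: ifP => adj_xy; last exact: IHn.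
case: ifP => _; last by apply: IHn; apply: model_contract.
case: ifP => _; first exact: IHn.
apply: IHn; apply: (model_sub _ _ _ mod_g) => //.
  by move=> e; rewrite mem_filter => /andP[].
apply/withinP => e; rewrite mem_filter => /andP[_ e_g].
exact: (withinP _ _ (model_within mod_g)).
Qed.

Lemma model_minor (K : sgraph) (f : K -> nat) g : model g -> injective f ->
  (forall x, f x \in g.1) -> (forall x y, adj x y -> adjacent g.2 (f x) (f y)) ->
  minor K (induced A).
Proof.
move=> [B [w B_ok B_dis B_adj]] f_inj f_g f_adj.
apply: (@minor_of_branch_sets _ _ A (fun x => B (f x))).
- by move=> x; have [] := B_ok _ (f_g x).
- by move=> x; have [] := B_ok _ (f_g x).
- by move=> x; have [] := B_ok _ (f_g x).
- by move=> x y z zx zy; apply: f_inj; apply: B_dis zx zy.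
move=> x y /f_adj/orP[]/B_adj[u [v [/= uB vB uv]]]; first by exists u, v.
by exists v, u; rewrite adj_sym.
Qed.

(** The abstract graph is realized on [seq_sub vs] as a minor of the subgraph induced on [A], and
    the bound passes to minors. *)
Lemma model_cyc k g : uniq g.1 -> simple g.2 -> model g -> cyc_le adj A k -> cyc g.2 <= k.
Proof.
case: g => vs es /= u_vs sim mod_g cA; have w := model_within mod_g.
case: vs => [|x0 vs0] in u_vs mod_g w *; first by case: es w {sim mod_g}.
set vs := x0 :: vs0 in u_vs mod_g w *.
pose T := seq_sub vs.
pose e : rel T := fun x y => (val x != val y) && adjacent es (val x) (val y).
have sym_e : symmetric e by move=> x y; rewrite /e eq_sym /adjacent orbC.
have irr_e : irreflexive e by move=> x; rewrite /e eqxx.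
pose K := SGraph sym_e irr_e.
have : minor K (induced A).
  apply: (@model_minor K (fun x : T => val x) _ mod_g) => [|x|x y /andP[]] //.
    exact: val_inj.
  exact: valP x.
move/cyc_le_minor => /(_ k) cK.
pose t0 : T := SeqSub (mem_head x0 vs0).
have bE i : i \in vs -> val (insubd t0 i) = i by move=> i_vs; rewrite val_insubd i_vs.
apply: (@cyc_le_cyc T e setT k (insubd t0) vs es) => //.
- by move=> i j i_vs j_vs /(congr1 val); rewrite !bE.
- move=> i j ij; have [/= i_vs j_vs] := withinP _ _ w _ ij.
  rewrite /e !bE //; have [_ sim'] := simpleP _ sim; have [-> _] := sim' i j ij.
  by rewrite /adjacent ij.
apply: cK; apply/(cyc_le_preim val_inj (@adj G)).
rewrite val_imsetT setCT imset0 setD0 (_ : [set x | _] = A) //.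
by apply/setP => x; rewrite inE.
Qed.
End Models.

Section ModelOfEmbedding.
Variables (G : sgraph).
Implicit Types (b : nat -> G) (ms : seq (strand G)).

(** The branch set of [i] consists of [b i] and the inner vertices of the strands starting at [i];
    the last step of a strand leads to the branch set of its other end. *)
Lemma embedding_model b vs ms : embedding b vs ms ->
  model [set u in points b vs ms] (vs, edges_of ms).
Proof.
move=> emb; have [u_p w paths sim] := emb; have b_inj := embedding_inj emb.
pose B i := [set u | (u == b i) || has (fun m => (m.1.1 == i) && (u \in m.2)) ms].
have Bb i : b i \in B i by rewrite inE eqxx.
have u_int : uniq (interiors ms) by move: u_p; rewrite cat_uniq => /and3P[].
have strand_B m u : m \in ms -> u \in m.2 -> u \in B m.1.1.
  by move=> m_ms um; rewrite inE; apply/orP; right; apply/hasP; exists m; rewrite ?eqxx.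
exists B; split=> //=.
- move=> i i_vs; split; first by apply/set0Pn; exists (b i).
    apply/subsetP => u; rewrite !inE mem_cat => /orP[/eqP->|/hasP[m m_ms /andP[_ um]]].
      by rewrite map_f.
    by apply/orP; right; apply/interiorsP; exists m.
  have sym_c : connect_sym [rel a c | [&& a \in B i, c \in B i & adj a c]].
    by apply: sym_connect_sym => a c /=; rewrite adj_sym andbCA.
  have from_b u : u \in B i -> connect [rel a c | [&& a \in B i, c \in B i & adj a c]] (b i) u.
    rewrite inE => /predU1P[->|/hasP[[[k l] s] m_ms /= /andP[/eqP eq_k us]]].
      exact: connect0.
    subst k; have sB z : z \in s -> z \in B i by apply: (strand_B ((i, l), s)).
    have := allP paths _ m_ms; rewrite /strand_path /= rcons_path => /andP[path_s _].
    move: path_s us sB (Bb i); elim: s (b i) {m_ms} => //= a s IHs c /andP[ca path_s].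
    rewrite inE => us sB cB; have aB : a \in B i by apply: sB; apply: mem_head.
    apply: (@connect_trans _ _ a); first by apply: connect1; rewrite /= cB aB ca.
    case/predU1P: us => [->|us]; first exact: connect0.
    by apply: IHs => // z zs; apply: sB; rewrite inE zs orbT.
  by move=> a c aB cB; apply: connect_trans (from_b c cB); rewrite sym_c from_b.
- move=> i j u i_vs j_vs; rewrite !inE.
  have not_int k m : k \in vs -> m \in ms -> u \in m.2 -> u == b k = false.
    move=> k_vs m_ms um; apply/negbTE; apply: (interior_not_vertex emb) => //.
    by apply/interiorsP; exists m.
  case/predU1P=> [->|/hasP[m m_ms /andP[/eqP mi um]]].
    case/predU1P=> [/b_inj->//|/hasP[m m_ms /andP[_ um]]].
    have : b i \in interiors ms by apply/interiorsP; exists m.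
    by move/(interior_not_vertex emb)/(_ i_vs); rewrite eqxx.
  rewrite (not_int j m) //= => /hasP[m' m'_ms /andP[/eqP m'j um']].
  rewrite -mi -m'j; have eq_ms := perm_to_rem m_ms.
  have [->//|ne] := eqVneq m' m.
  have : m' \in rem m ms.
    by move: m'_ms; rewrite (perm_mem eq_ms) inE (negbTE ne).
  move: u_int; rewrite (perm_uniq (perm_flatten (perm_map snd eq_ms))) /= cat_uniq.
  case/and3P=> _ /hasPn dis _ m'_rem.
  have /dis : u \in flatten (map snd (rem m ms)) by apply/interiorsP; exists m'.
  by rewrite /= um.
move=> e /mapP[[[i j] s] m_ms ->] /=.
have := allP paths _ m_ms; rewrite /strand_path /= rcons_path => /andP[_ last_j].
exists (last (b i) s), (b j); split=> //.
case: s m_ms {last_j} => [|a s] m_ms //=.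
by apply: (strand_B _ _ m_ms); apply: mem_last.
Qed.

Lemma model_mono (A A' : {set G}) g : A \subset A' -> model A g -> model A' g.
Proof.
move=> sub [B [w B_ok B_dis B_adj]]; exists B; split=> // i /B_ok[? BA ?].
by split=> //; apply: subset_trans sub.
Qed.

Lemma perm_model (A : {set G}) vs es es' : perm_eq es es' ->
  model A (vs, es) -> model A (vs, es').
Proof.
move=> eq_es mod; apply: (model_sub _ _ _ mod) => //=.
  by move=> e; rewrite (perm_mem eq_es).
by rewrite /within -(perm_all _ eq_es); apply: model_within mod.
Qed.

Lemma embedding_avoid b vs ms x : x \in vs -> embedding b vs ms ->
  model (~: [set b x]) ([seq z <- vs | z != x], avoid x (edges_of ms)).
Proof.
move=> x_vs emb; have [u_p w paths /simpleP[u_es sim]] := emb.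
pose ms' := [seq m <- ms | (m.1.1 != x) && (m.1.2 != x)].
have edgesE : edges_of ms' = avoid x (edges_of ms) by rewrite /edges_of /avoid filter_map.
have sub_ms m : m \in ms' -> m \in ms by rewrite mem_filter => /andP[].
have sub_es e : e \in avoid x (edges_of ms) -> e \in edges_of ms.
  by rewrite mem_filter => /andP[].
have emb' : embedding b [seq z <- vs | z != x] ms'.
  split.
  - apply: subseq_uniq u_p; apply: cat_subseq.
      by apply: map_subseq; apply: filter_subseq.
    rewrite /interiors /ms'; elim: (ms) => //= m ms1 IHms.
    case: ifP => _; last exact: subseq_trans IHms (suffix_subseq _ _).
    by apply: cat_subseq.
  - rewrite edgesE; apply/withinP => e; rewrite !mem_filter => /andP[/andP[-> ->] e_ms].
    exact: (withinP _ _ w).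
  - by apply/allP => m /sub_ms; apply: (allP paths).
  rewrite edgesE; apply/simpleP; split; first exact: filter_uniq.
  move=> i j ij; have [-> nji] := sim _ _ (sub_es _ ij); split=> //.
  by apply: contra nji; apply: sub_es.
have := embedding_model emb'; rewrite edgesE; apply: model_mono.
apply/subsetP => u; rewrite !inE mem_cat => /orP[/mapP[i]|].
  rewrite mem_filter => /andP[ix i_vs] ->; apply: contraNneq ix.
  by move/(embedding_inj emb)->.
case/interiorsP=> m /sub_ms m_ms um; apply: (interior_not_vertex emb) => //.
by apply/interiorsP; exists m.
Qed.
End ModelOfEmbedding.

(** * The search *)

Ltac edge_list G :=
  let t := eval unfold G in G in
  match t with of_edges ?n ?s => exact (n, s) end.

(** All 29 graphs as explicit edge lists on which the checks can compute, in the order of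
    [L0 ++ L1]; [listed_isomorphic] compares them with the graphs of the statement. *)
Definition listed_edges : seq (nat * seq edge) := [::
  (9, [:: (1, 2); (1, 3); (2, 3); (4, 5); (4, 6); (5, 6); (7, 8); (7, 9); (8, 9)]);
  (8, [:: (1, 2); (1, 3); (2, 3); (2, 4); (3, 4); (5, 6); (5, 7); (6, 7); (6, 8); (7, 8)]);
  (10, [:: (1, 2); (1, 3); (2, 3); (3, 4); (3, 5); (4, 5);
           (6, 7); (6, 8); (7, 8); (8, 9); (8, 10); (9, 10)]);
  (9, [:: (1, 2); (1, 3); (2, 3); (2, 4); (3, 4);
          (5, 6); (5, 7); (6, 7); (7, 8); (7, 9); (8, 9)]);
  (7, [:: (1, 2); (1, 3); (1, 4); (2, 3); (2, 4); (3, 4); (5, 6); (5, 7); (6, 7)]);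
  (9, [:: (1, 2); (1, 3); (2, 3); (4, 5); (4, 6); (5, 6); (4, 7); (5, 7);
          (5, 8); (6, 8); (4, 9); (6, 9)]);
  ltac:(edge_list O1_1); ltac:(edge_list O1_2); ltac:(edge_list O1_3);
  ltac:(edge_list O1_4);
  ltac:(edge_list L1_1); ltac:(edge_list L1_2); ltac:(edge_list L1_3);
  ltac:(edge_list L1_4); ltac:(edge_list L1_5); ltac:(edge_list L1_6);
  ltac:(edge_list L1_7); ltac:(edge_list L1_8); ltac:(edge_list L1_9);
  ltac:(edge_list L1_10); ltac:(edge_list L1_11); ltac:(edge_list L1_12);
  ltac:(edge_list L1_13); ltac:(edge_list L1_14); ltac:(edge_list L1_15);
  ltac:(edge_list L1_16); ltac:(edge_list prism);
  (6, [:: (1, 4); (1, 5); (1, 6); (2, 4); (2, 5); (2, 6); (3, 4); (3, 5); (3, 6)]);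
  (5, [:: (1, 2); (1, 3); (1, 4); (2, 3); (2, 4); (2, 5); (3, 4); (3, 5); (4, 5)])].

(* [of_edges] numbers the vertices from 1, abstract graphs from 0.              *)
Definition graph_of (t : nat * seq edge) : graph :=
  (iota 0 t.1, [seq (e.1.-1, e.2.-1) | e <- t.2]).

Definition degree es (x : nat) := count (incident x) es.

(* Signatures and keys only guide the search for an isomorphism; the map found  *)
(* is always verified by [is_image].                                            *)
Definition signature es (x : nat) :=
  sumn [seq 5 + degree es (other_end x e) | e <- es & incident x e].

Definition key g := sort leq [seq s <- [seq signature g.2 x | x <- g.1] | s != 0].

Definition place_ok es m (c : nat) es' :=
  if c \in m then false else
    all (fun e => if e.1 == size m then
                    if size m <= e.2 then true else adjacent es' c (nth 0 m e.2)
                  else if e.2 == size m then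
                    if size m <= e.1 then true else adjacent es' (nth 0 m e.1) c
                  else true) es.

Fixpoint search es es' (cand : seq (nat * nat)) (sigs m : seq nat) : option (seq nat) :=
  if sigs is s :: sigs' then
    (fix try cs :=
       if cs is (c, s') :: cs' then
         if s == s' then
           if place_ok es m c es' then
             if search es es' cand sigs' (rcons m c) is Some r then Some r else try cs'
           else try cs'
         else try cs'
       else None) cand
  else Some m.

(* [m0] is the beginning of the map searched for; [:: 0] forces root to root.   *)
Definition occurs h m0 g :=
  let cand := [seq (x, signature g.2 x) | x <- g.1] in
  let sigs := [seq signature h.2 x | x <- h.1] in
  if search h.2 g.2 cand (drop (size m0) sigs) m0 is Some m then
    if (h.1 == iota 0 (size m)) && (nth 1 m 0 == nth (nth 1 m 0) m0 0)
    then is_image h.2 m g else false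
  else false.

(* Unlike [has], this does not evaluate the tail eagerly under [vm_compute].    *)
Fixpoint find_first (T : Type) (p : pred T) (s : seq T) :=
  if s is x :: s' then if p x then true else find_first p s' else false.

Definition same_key_and (p : pred graph) k (h : seq nat * graph) :=
  if h.1 == k then p h.2 else false.

(** A graph is dropped when some [h] of the level occurs in it with root on root: an embedding of
    the dropped graph restricts to one of [h]. *)
Definition add_state g (level : seq (seq nat * graph)) :=
  let k := key g in
  if find_first (same_key_and (fun h => occurs h [:: 0] g) k) level
  then level else (k, g) :: level.

Definition merge_states level : seq graph := map snd (foldr add_state [::] level).

(** One apex is enough: the image of that vertex is not an apex of [G], and this alone forces an
    enlargement avoiding it. *)
Definition step g : seq graph :=
  if apex_of g is Some x then successors x g else [::].

(* Necessary for g to embed with 0 sent to v when G - v has cyclomatic number   *)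
(* at most 2; the comparison of sizes is a shortcut.                            *)
Definition live g :=
  let es := avoid 0 g.2 in if size g.1 < size es then false else cyc es <= 2.

Definition listed_keys : seq (seq nat * graph) :=
  [seq (key (graph_of t), graph_of t) | t <- listed_edges].

Definition reduces_to_listed (keys : seq (seq nat * graph)) g :=
  let r := reduce (size g.2) g.2 g in
  find_first (same_key_and (fun h => occurs h [::] r) (key r)) keys.

Definition survivors (level : seq graph) := [seq g <- flatten (map step level) | live g].

Fixpoint explore keys n level : bool :=
  if level is [::] then true else
  if n is n'.+1 then
    if all has_apex level then
      let next := survivors level in
      if all (reduces_to_listed keys) [seq g <- next | ~~ has_apex g] then
        explore keys n' (merge_states (map normalize [seq g <- next | has_apex g]))
      else false
    else false
  else false.

Lemma find_firstP (T : eqType) (p : pred T) s : find_first p s -> exists2 x, x \in s & p x.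
Proof.
elim: s => //= x s IHs; case: ifPn => [px _|_ /IHs[y ys py]]; first by exists x; rewrite ?mem_head.
by exists y; rewrite // inE ys orbT.
Qed.

(** For [m0 = [:: 0]] the middle equation says [nth 1 m 0 = 0]; for empty [m0] its default value
    makes it hold trivially. *)
Lemma occursP h m0 g : occurs h m0 g -> exists m,
  [/\ h.1 = iota 0 (size m), nth 1 m 0 = nth (nth 1 m 0) m0 0 & is_image h.2 m g].
Proof.
rewrite /occurs; case: search => // m.
by case: ifP => // /andP[/eqP h1 /eqP m00]; exists m.
Qed.

Lemma add_stateP g l : add_state g l = (key g, g) :: l \/
  (exists2 h, h \in l & occurs h.2 [:: 0] g) /\ add_state g l = l.
Proof.
rewrite /add_state; case E: (find_first _ _); [right; split=> // | by left].
have [h h_l] := find_firstP E; rewrite /same_key_and; case: (_ == _) => // occ.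
by exists h.
Qed.

Lemma exploreP keys n level : explore keys n level -> level = [::] \/
  exists n', [/\ n' < n, all has_apex level,
    all (reduces_to_listed keys) [seq g <- survivors level | ~~ has_apex g] &
    explore keys n' (merge_states (map normalize [seq g <- survivors level | has_apex g]))].
Proof.
case: n level => [|n] [|g level] ex; [by left | by move: ex | by left | right; exists n].
(* Exactly one round of [explore] is unfolded; the search functions inside it stay folded. *)
move: ex; cbv beta iota zeta delta [explore]; fold explore.
by case: (all _ _) => //; case: (all _ _).
Qed.

(** * Soundness of the search *)

Section Soundness.

Variables (G : sgraph) (v : G).

Lemma embeds_occurs h g : occurs h [:: 0] g -> embeds v g -> embeds v h.
Proof.
case/occursP=> m [h1 m0 im] emb_g.
by rewrite [h]surjective_pairing h1; apply: embeds_image im m0 emb_g.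
Qed.

Lemma merge_statesP (level : seq graph) g : g \in level -> embeds v g ->
  exists2 h, h \in merge_states level & embeds v h.
Proof.
rewrite /merge_states => g_level emb_g.
suff [h h_l emb_h] : exists2 h, h \in foldr add_state [::] level & embeds v h.2.
  exists h.2; [exact: (map_f snd h_l) | exact: emb_h].
elim: level g_level => [//|f level IHl]; rewrite inE.
have -> : foldr add_state [::] (f :: level) = add_state f (foldr add_state [::] level) by [].
move: IHl; move: (foldr _ _ _) => l IHl.
have [->|[]] := add_stateP f l; last first.
  move=> [h h_l occ] ->; case/predU1P=> [eq_g|/IHl //]; subst f.
  by exists h; [exact: h_l | exact: embeds_occurs occ emb_g].
case/predU1P=> [eq_g|/IHl[h h_l emb_h]].
  by exists (key f, f); [exact: mem_head | rewrite -eq_g].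
by exists h; [rewrite in_cons h_l orbT | exact: emb_h].
Qed.

(** The graph [g] without its root has a model in [G] without [v], and the bound on the cyclomatic
    number passes to models. *)
Lemma embeds_live g : cyc_le adj (~: [set v]) 2 -> embeds v g -> live g.
Proof.
move=> c2 [b [ms [emb eq_es b0 g0]]]; have u_g := embedding_uniq emb.
have eq_av : perm_eq (avoid 0 (edges_of ms)) (avoid 0 g.2) by apply: perm_filter.
have sim : simple (avoid 0 g.2).
  have [_ _ _ /(simple_perm eq_es)/simpleP[u_es sim]] := emb.
  apply/simpleP; split=> [|i j]; first exact: filter_uniq.
  rewrite mem_filter => /andP[_ /sim[ij ji]]; split=> //.
  by apply: contra ji; rewrite mem_filter => /andP[].
have mod : model (~: [set v]) ([seq z <- g.1 | z != 0], avoid 0 g.2).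
  by rewrite -b0; apply: perm_model eq_av _; apply: embedding_avoid.
have u_vs : uniq [seq z <- g.1 | z != 0] by apply: filter_uniq.
have cyc2 : cyc (avoid 0 g.2) <= 2 :=
  @model_cyc _ _ _ ([seq z <- g.1 | z != 0], avoid 0 g.2) u_vs sim mod c2.
rewrite /live /= cyc2; case: ltnP => // lt_g; exfalso; move: lt_g.
(* The constant labelling justifies the size test: the number of edges avoiding 0, plus 1, is at
   most the number of vertices other than 0, plus 2. *)
have := @cyc_ge_labels _ (fun _ => 0) _ _ (model_within mod) u_vs (fun _ _ => erefl).
rewrite /= (size_rem_vertex u_g g0); move: (model_within mod) => /=.
case: [seq z <- g.1 | z != 0] => [|z vs] w; first by case: (avoid 0 g.2) w.
have lab : 0 < size (undup [seq (fun=> 0) i | i <- z :: vs]).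
  have : 0 \in undup [seq (fun=> 0) i | i <- z :: vs] by rewrite mem_undup mem_head.
  by case: (undup _).
move: lab cyc2; set d := size (undup _); set k := cyc _; set s := size (avoid _ _); lia.
Qed.

(** The embedding gives a model of [g], [reduce] preserves models, and the listed graph found by
    [occurs] is a subgraph of the reduced one. *)
Lemma embeds_reduces g : reduces_to_listed listed_keys g -> embeds v g ->
  exists2 t, t \in listed_edges & minor (of_edges t.1 t.2) G.
Proof.
case/find_firstP => _ /mapP[t t_l ->]; rewrite /same_key_and /=; case: ifP => // _.
case/occursP=> m [/= m_t _ /and5P[_ w u_m /allP m_r /allP adj_r]] [b [ms [emb eq_es _ _]]].
exists t => //.
have size_m : size m = t.1 by have := congr1 size m_t; rewrite !size_iota.
have mod : model [set: G] (reduce (size g.2) g.2 g).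
  apply: model_reduce; rewrite [g]surjective_pairing; apply: perm_model eq_es _.
  by apply: model_mono (embedding_model emb); apply: subsetT.
pose f (i : of_edges t.1 t.2) := nth 0 m (nat_of_ord i).
apply: minor_subgraph (induced_subgraph setT).
apply: (@model_minor _ _ (of_edges t.1 t.2) f _ mod).
- move=> i j /eqP; rewrite /f nth_uniq ?size_m ?ltn_ord // => /eqP.
  exact: val_inj.
- by move=> i; apply: m_r; apply: mem_nth; rewrite size_m ltn_ord.
move=> i j /andP[_ /orP[] ij].
  by apply: (adj_r (nat_of_ord i, nat_of_ord j)); apply/mapP; exists (i.+1, j.+1).
rewrite /adjacent orbC.
by apply: (adj_r (nat_of_ord j, nat_of_ord i)); apply/mapP; exists (j.+1, i.+1).
Qed.

Hypothesis c2 : cyc_le adj (~: [set v]) 2.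
Hypothesis no_apex : forall x : G, ~ cyc_le adj (~: [set x]) 1.

(** The invariant is that the level contains a graph embedded with its root at [v]. Since [G] has no
    apex, some successor is embedded too, and it is live by [c2]; it either survives, up to
    normalization and merging, into the next level or yields a listed minor. An empty level
    contradicts the invariant. *)
Lemma explore_sound n (level : seq graph) : explore listed_keys n level ->
  (exists2 g, g \in level & embeds v g) ->
  exists2 t, t \in listed_edges & minor (of_edges t.1 t.2) G.
Proof.
have [k le_k] := ubnP n; elim: k n le_k level => // k IHk n le_k level ex [g g_l emb_g].
have [l0|[n' [lt_n' /allP apex_l /allP red ex_n]]] := exploreP ex; first by rewrite l0 in g_l.
have [b [ms root]] := emb_g.
have := apex_l g g_l; rewrite /has_apex; case def_x: (apex_of g) => [x|] // _.
have [x_g c1] := apex_ofP def_x.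
have [g' g'_s emb_g'] := successors_complete root x_g c1 (@no_apex (b x)).
have g'_next : g' \in survivors level.
  rewrite mem_filter (embeds_live c2 emb_g'); apply/flattenP.
  by exists (step g); rewrite ?map_f // /step def_x.
have [apex_g'|no_apex_g'] := boolP (has_apex g').
  apply: IHk ex_n _; first exact: leq_trans lt_n' le_k.
  apply: (merge_statesP (g := normalize g')); last exact: embeds_normalize.
  by apply: map_f; rewrite mem_filter apex_g'.
by apply: (embeds_reduces (g := g')) => //; apply: red; rewrite mem_filter no_apex_g'.
Qed.
End Soundness.

(** * The listed graphs are obstructions *)

(** Converse of [cyc_le_cyc], for a relation that agrees with the abstract edges on the image of
    [vs]. *)
Lemma cyc_le_of_cyc (T : finType) (e : rel T) k (b : nat -> T) vs es :
  {in vs &, injective b} -> uniq vs -> within vs es ->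
  {in vs &, forall i j, e (b i) (b j) = adjacent es i j} -> cyc es <= k ->
  cyc_le e [set u in map b vs] k.
Proof.
move=> b_inj u_vs w eE ck L f f_const; set A := [set u in map b vs] in f_const *.
have bA i : i \in vs -> b i \in A by move=> i_vs; rewrite inE map_f.
have card_A : #|A| = size vs.
  by rewrite cardsE (card_uniqP _) ?size_map // map_inj_in_uniq.
have card_arcs : #|arcs e A| <= (size es).*2.
  pose l := [seq (b p.1, b p.2) | p <- es] ++ [seq (b p.2, b p.1) | p <- es].
  have <- : size l = (size es).*2 by rewrite size_cat !size_map addnn.
  apply: leq_trans (card_size l); apply/subset_leq_card/subsetP => -[u u'].
  rewrite !inE /= => /and3P[/mapP[i i_vs ->] /mapP[j j_vs ->]]; rewrite eE //.
  rewrite mem_cat => /orP[] ij; apply/orP; [left|right]; apply/mapP.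
    by exists (i, j).
  by exists (j, i).
have fb_const p : p \in es -> f (b p.1) = f (b p.2).
  case: p => i j ij; have [/= i_vs j_vs] := withinP _ _ w _ ij.
  by apply: f_const; rewrite ?bA ?eE // /adjacent ij.
have im_f : #|f @: A| <= size (undup (map (f \o b) vs)).
  apply: leq_trans (card_size _); apply/subset_leq_card/subsetP => _ /imsetP[u uA ->].
  move: uA; rewrite inE => /mapP[i i_vs ->]; rewrite mem_undup.
  exact: (map_f (f \o b)).
have le_labels := @cyc_ge_labels _ (f \o b) _ _ w u_vs fb_const.
have arith (a s d n v c : nat) : a <= s.*2 -> n <= d -> s + d <= v + c -> c <= k ->
  a + n.*2 <= (v + k).*2 by lia.
by rewrite card_A; apply: arith card_arcs im_f le_labels ck.
Qed.

(** Stated for a bare relation [e], so that it covers both an edge deletion and a contraction on the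
    vertex type of the original graph. *)
Lemma apex_inj_set (H : sgraph) (T : finType) (f : H -> T) (e : rel T) (A : {set T}) (a : T) :
  symmetric e -> irreflexive e -> injective f -> {homo f : x y / adj x y >-> e x y} ->
  (forall u, f u != a -> f u \in A) -> cyc_le e A 1 -> apex 1 sub_unicyclic H.
Proof.
move=> sym_e irr_e f_inj f_hom fA cA; apply/apexP; exists (f @^-1: [set a]); split.
  rewrite -(card_imset _ f_inj) -(cards1 a); apply/subset_leq_card/subsetP.
  by move=> _ /imsetP[u + ->]; rewrite !inE.
apply: (cyc_le_inj f_inj sym_e irr_e _ _ cA) => [u v _ _|]; first exact: f_hom.
by apply/subsetP => _ /imsetP[u + ->]; rewrite !inE; apply: fA.
Qed.

Lemma not_apexP (G : sgraph) : ~ apex 1 sub_unicyclic G <->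
  ~ cyc_le (@adj G) setT 1 /\ forall x : G, ~ cyc_le adj (~: [set x]) 1.
Proof.
split=> [not_apex|[not_T not_x] /apexP[X [X1 cX]]].
  split=> [cT|x cx]; apply/not_apex/apexP.
    by exists set0; rewrite cards0 setC0.
  by exists [set x]; rewrite cards1.
have [X0|[x xX]] := set_0Vmem X; first by apply: not_T; rewrite -(setC0 G) -X0.
apply: (not_x x); suff <- : X = [set x] by [].
by apply/eqP; rewrite eq_sym eqEcard sub1set xX cards1.
Qed.

Lemma simplify_adjacent es x y : (x, y) \in es -> x != y -> adjacent (simplify es) x y.
Proof.
move=> xy_es xy; elim: es xy_es => //= f es IHes; rewrite inE => /predU1P[<-|/IHes] /=.
  by rewrite (negbTE xy); case: ifP => // _; rewrite /adjacent mem_head.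
case: ifP => // _; case: ifP => // _; rewrite /adjacent !inE.
by case/orP=> ->; rewrite !orbT.
Qed.

(** Contractions are tested in both orientations because [contract_edge] is not symmetric in its
    vertices. The test [has (incident x)] excludes isolated vertices, so that a subgraph with all
    the edges has all the vertices. *)
Definition check_listed (t : nat * seq edge) :=
  let g := graph_of t in
  [&& 0 < t.1, all (fun e => (0 < e.1) && (0 < e.2)) t.2, simple g.2, within g.1 g.2,
      all (fun x => (1 < cyc (avoid x g.2)) && has (incident x) g.2) g.1 &
      all (fun e => [&& has_apex (delete_edge e.1 e.2 g), has_apex (contract_edge e.1 e.2 g)
        & has_apex (contract_edge e.2 e.1 g)]) g.2].

Lemma has_apexP g : has_apex g -> exists2 x, x \in g.1 & cyc (avoid x g.2) <= 1.
Proof.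
rewrite /has_apex; case def_x: (apex_of g) => [x|] // _.
by have [] := apex_ofP def_x; exists x.
Qed.

Section CheckListed.
Variable t : nat * seq edge.
Hypothesis ok : check_listed t.
Let g := graph_of t.
Let K := of_edges t.1 t.2.

Let x0 : K := Ordinal (proj1 (andP ok)).
Let b (i : nat) : K := insubd x0 i.

Lemma listed_val i : i \in g.1 -> nat_of_ord (b i) = i.
Proof. by rewrite mem_iota add0n /= => i_n; rewrite val_insubd i_n. Qed.

Lemma listed_ord (i : K) : b (nat_of_ord i) = i.
Proof. by apply: val_inj; rewrite /= val_insubd ltn_ord. Qed.

Lemma listed_in (i : K) : nat_of_ord i \in g.1.
Proof. by rewrite mem_iota add0n /= ltn_ord. Qed.

Lemma listed_inj vs : {subset vs <= g.1} -> {in vs &, injective b}.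
Proof.
by move=> sub i j /sub i_g /sub j_g /(congr1 (@nat_of_ord _)); rewrite !listed_val.
Qed.

Lemma listed_mem i j : ((i.+1, j.+1) \in t.2) = ((i, j) \in g.2).
Proof.
case/and3P: ok => _ /allP pos _; apply/idP/mapP => [ij|[[[|k] [|l]] kl [-> ->]] //].
- by exists (i.+1, j.+1).
- by have := pos _ kl.
- by have := pos _ kl.
by have := pos _ kl.
Qed.

Lemma listed_adj (i j : K) : adj i j = adjacent g.2 (nat_of_ord i) (nat_of_ord j).
Proof.
rewrite /= /edge_list_rel !listed_mem -/(adjacent g.2 i j).
case: eqP => // ->; case/and4P: ok => _ _ /simpleP[_ sim] _.
by symmetry; apply/negP => /orP[]/sim[]; rewrite eqxx.
Qed.

Lemma adj_listed i j : i \in g.1 -> j \in g.1 -> adj (b i) (b j) = adjacent g.2 i j.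
Proof. by move=> i_g j_g; rewrite listed_adj !listed_val. Qed.

Lemma listed_rel i j : i \in g.1 -> j \in g.1 ->
  edge_list_rel t.2 (b i) (b j) = adjacent g.2 i j.
Proof. exact: adj_listed. Qed.

Lemma listed_within : within g.1 g.2.
Proof. by case/and5P: ok. Qed.

Lemma listed_simple : simple g.2.
Proof. by case/and4P: ok. Qed.

Lemma within_avoid x vs es : within vs es -> within [seq z <- vs | z != x] (avoid x es).
Proof.
move=> /withinP w; apply/withinP => e; rewrite !mem_filter => /andP[/andP[-> ->]].
exact: w.
Qed.

Lemma adjacent_avoid x es i j : i != x -> j != x -> adjacent (avoid x es) i j = adjacent es i j.
Proof. by move=> ix jx; rewrite /adjacent !mem_filter /= ix jx. Qed.

Lemma listed_set vs : {subset vs <= g.1} -> [set u in map b vs] = [set u : K | nat_of_ord u \in vs].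
Proof.
move=> sub; apply/setP => u; rewrite !inE; apply/mapP/idP => [[i i_vs ->]|u_vs].
  by rewrite listed_val // sub.
by exists (nat_of_ord u); rewrite ?listed_ord.
Qed.

Lemma listed_not_apex : ~ apex 1 sub_unicyclic K.
Proof.
have not_x (x : K) : ~ cyc_le adj (~: [set x]) 1.
  case/and5P: ok => _ _ sim w /andP[/allP/(_ _ (listed_in x))/andP[+ _] _].
  rewrite ltnNge => /negP c2 c1; case: c2.
  pose vs := [seq z <- g.1 | z != nat_of_ord x].
  have sub : {subset vs <= g.1} by move=> z; rewrite mem_filter => /andP[].
  apply: (@cyc_le_cyc _ (@adj K) (~: [set x]) 1 b vs) => //.
  - exact: adj_sym.
  - exact: adj_irrefl.
  - exact: listed_inj.
  - by rewrite filter_uniq ?iota_uniq.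
  - move=> i; rewrite mem_filter => /andP[ix i_g]; rewrite !inE.
    by apply: contraNneq ix => <-; rewrite listed_val.
  - exact: within_avoid.
  - have [u_es sim'] := simpleP _ sim.
    apply/simpleP; split=> [|i j]; first exact: filter_uniq.
    rewrite mem_filter => /andP[_ /sim'[ij ji]]; split=> //.
    by apply: contra ji; rewrite mem_filter => /andP[].
  move=> i j; rewrite mem_filter => /andP[_ ij]; have [/= i_g j_g] := withinP _ _ w _ ij.
  suff : adj (b i) (b j) by [].
  by rewrite adj_listed // /adjacent ij.
apply/not_apexP; split=> // cT; apply: (not_x x0).
by apply: (cyc_le_sub (@adj_sym K) (@adj_irrefl K) _ (subsetT _) cT).
Qed.

Lemma listed_edge_of (u v : K) : adj u v ->
  exists2 e, e \in g.2 & (u = b e.1 /\ v = b e.2) \/ (u = b e.2 /\ v = b e.1).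
Proof.
rewrite listed_adj => /orP[] uv; [exists (nat_of_ord u, nat_of_ord v) => //; left
  | exists (nat_of_ord v, nat_of_ord u) => //; right]; by rewrite /= !listed_ord.
Qed.

Lemma listed_delete (u v : K) : adj u v ->
  exists a : K, cyc_le (without_arc adj u v) (~: [set a]) 1.
Proof.
move=> /listed_edge_of[[i j] ij_g uv].
have [/= i_g j_g] := withinP _ _ listed_within _ ij_g.
case/and5P: ok => _ _ _ _ /andP[_ /allP/(_ _ ij_g)/and3P[/has_apexP[/= a a_g ca] _ _]].
exists (b a); pose vs := [seq z <- g.1 | z != a].
have sub : {subset vs <= g.1} by move=> z; rewrite mem_filter => /andP[].
have -> : ~: [set b a] = [set u in map b vs].
  rewrite listed_set //; apply/setP => k; rewrite !inE mem_filter listed_in andbT.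
  by congr (~~ _); apply/eqP/eqP => [->|<-]; rewrite ?listed_val ?listed_ord.
apply: (cyc_le_of_cyc (es := avoid a (delete_edge i j g).2)) => //.
- exact: listed_inj.
- by rewrite filter_uniq ?iota_uniq.
- apply: within_avoid; apply/withinP => e; rewrite mem_filter => /andP[_ e_g].
  exact: (withinP _ _ listed_within).
move=> k l; rewrite !mem_filter => /andP[ka k_g] /andP[la l_g].
rewrite adjacent_avoid // /without_arc listed_rel // /adjacent !mem_filter !xpair_eqE.
have bE p q : p \in g.1 -> q \in g.1 -> (b p == b q) = (p == q).
  by move=> p_g q_g; apply/eqP/eqP => [/(listed_inj (fun _ h => h) p_g q_g)|->].
have -> : (b k == u) && (b l == v) || (b k == v) && (b l == u) =
    (k == i) && (l == j) || (k == j) && (l == i).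
  by case: uv => -[-> ->]; rewrite !bE //= orbC.
case: (k == i); case: (k == j); case: (l == i); case: (l == j);
  by case: (_ \in _); case: (_ \in _).
Qed.

Lemma listed_contract_edge i j : (i, j) \in g.2 \/ (j, i) \in g.2 ->
  has_apex (contract_edge i j g) ->
  exists a : K, cyc_le (contracted_rel adj (b i) (b j)) (~: [set a; b j]) 1.
Proof.
move=> ij_g /has_apexP[a]; rewrite /= mem_filter => /andP[aj a_g] ca.
have [i_g j_g] : i \in g.1 /\ j \in g.1.
  by case: ij_g => /(withinP _ _ listed_within)[].
have ij : i != j.
  by have [_ sim] := simpleP _ listed_simple; case: ij_g => /sim[]; rewrite 1?eq_sym.
exists (b a); pose vs := [seq z <- [seq z <- g.1 | z != j] | z != a].
have sub : {subset vs <= g.1} by move=> z; rewrite !mem_filter => /and3P[].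
have bE p q : p \in g.1 -> q \in g.1 -> (b p == b q) = (p == q).
  by move=> p_g q_g; apply/eqP/eqP => [/(listed_inj (fun _ h => h) p_g q_g)|->].
have -> : ~: [set b a; b j] = [set u in map b vs].
  rewrite listed_set //; apply/setP => k; rewrite !inE !mem_filter listed_in andbT negb_or.
  by rewrite -!(bE (nat_of_ord k)) ?listed_in // listed_ord.
have w := within_merge i_g ij listed_within.
apply: (cyc_le_of_cyc (es := avoid a (contract_edge i j g).2)) => //.
- exact: listed_inj.
- by rewrite !filter_uniq ?iota_uniq.
- apply: within_avoid; apply/withinP => e /simplifyP[e_g _].
  exact: (withinP _ _ w).
move=> k l; rewrite !mem_filter => /and3P[ka kj k_g] /and3P[la lj l_g].
rewrite adjacent_avoid // /contracted_rel !bE // !listed_rel //.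
have mergeE p q : (p, q) \in g.2 -> merge_into i j p != merge_into i j q ->
    adjacent (simplify (map (merge_edge i j) g.2)) (merge_into i j p) (merge_into i j q).
  move=> pq; apply: simplify_adjacent.
  by apply/mapP; exists (p, q).
have mergeA p q : adjacent g.2 p q -> merge_into i j p != merge_into i j q ->
    adjacent (simplify (map (merge_edge i j) g.2)) (merge_into i j p) (merge_into i j q).
  case/orP=> [/mergeE//|/mergeE qp]; rewrite eq_sym => /qp.
  by rewrite /adjacent orbC.
have mE z : z != j -> merge_into i j z = z by rewrite /merge_into => /negbTE->.
have mj : merge_into i j j = i by rewrite /merge_into eqxx.
have adjC p q : adjacent g.2 p q = adjacent g.2 q p by rewrite /adjacent orbC.
apply/idP/idP => [/andP[kl]|].
  case/or3P=> [kl_g|/andP[/eqP ki jl]|/andP[/eqP li jk]].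
  - by have := mergeA k l kl_g; rewrite !mE //; apply.
  - have := mergeA j l jl; rewrite mj mE // => merged.
    by rewrite ki; apply: merged; rewrite -ki.
  have := mergeA j k jk; rewrite mj mE // => merged.
  by rewrite li /adjacent orbC; apply: merged; rewrite -li eq_sym.
have back p q : (p, q) \in simplify (map (merge_edge i j) g.2) -> p != j -> q != j ->
    (p != q) && [|| adjacent g.2 p q, (p == i) && adjacent g.2 j q |
      (q == i) && adjacent g.2 j p].
  case/simplifyP=> /mapP[[p' q'] pq' [ep eq_]] /= pq pj qj; rewrite pq /=.
  have adj' : adjacent g.2 p' q' by rewrite /adjacent pq'.
  move: ep eq_; rewrite /merge_into.
  case: (eqVneq p' j) adj' => [->|_] adj'; case: (eqVneq q' j) adj' => [->|_] adj' ep eq_.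
  - by rewrite ep eq_ eqxx in pq.
  - by rewrite ep eqxx eq_ adj' orbT.
  - by rewrite eq_ eqxx ep [adjacent g.2 j p']adjC adj' !orbT.
  by rewrite ep eq_ adj'.
case/orP=> /back; rewrite kj lj => /(_ isT isT) //.
by rewrite eq_sym [adjacent g.2 l k]adjC [(l == i) && _ || _]orbC.
Qed.

Lemma listed_contract (u v : K) : adj u v ->
  exists a : K, cyc_le (contracted_rel adj u v) (~: [set a; v]) 1.
Proof.
move=> /listed_edge_of[[i j] ij_g uv].
case/and5P: ok => _ _ _ _ /andP[_ /allP/(_ _ ij_g)/and3P[_ /= cij cji]].
case: uv => -[/= -> ->]; apply: listed_contract_edge => //; first by left.
by right.
Qed.

Lemma listed_covered (u : K) : exists v, adj u v.
Proof.
case/and5P: ok => _ _ _ _ /andP[/allP/(_ _ (listed_in u))/andP[_ /hasP[[i j] ij_g inc]] _].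
have [i_g j_g] := withinP _ _ listed_within _ ij_g.
have [iu|ju] : i = nat_of_ord u \/ j = nat_of_ord u.
  by move: inc; rewrite /incident /=; case: eqP => [|_ /eqP]; [left | right].
- by exists (b j); rewrite listed_adj listed_val // -iu /adjacent ij_g.
by exists (b i); rewrite listed_adj listed_val // -ju /adjacent ij_g orbT.
Qed.

Lemma contracts_toP (G H : sgraph) : contracts_to G H ->
  H = G \/ exists x y : G, adj x y /\ contracts_to (contract x y) H.
Proof. by case=> [|{}G {}H x y xy c]; [left | right; exists x, y]. Qed.

(** A proper minor comes from a subgraph that misses an edge, or from one with all edges by at least
    one contraction. So it is a minor of the listed graph with one edge deleted or contracted, which
    has an apex by the check, and the class is closed under minors. *)
Lemma listed_obs : obs (apex 1 sub_unicyclic) K.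
Proof.
split=> [|H [[G' [K' [[f [f_inj f_hom]] c_to isoHK']]] notHK]]; first exact: listed_not_apex.
have apex_H : apex 1 sub_unicyclic G' -> apex 1 sub_unicyclic H.
  apply: apex_minor; exists G', K'; split=> //.
  by exists id; split.
have [/existsP[u /existsP[v /andP[uv /forallP missed]]]|all_hit] :=
    boolP [exists u : K, exists v : K, adj u v &&
      [forall x : G', forall y : G', ~~ [&& f x == u, f y == v & adj x y]]].
  have [a ca] := listed_delete uv.
  apply: apex_H; apply: (apex_inj_set (a := a) _ _ f_inj _ _ ca).
  - by apply: without_arc_sym; apply: adj_sym.
  - by apply: without_arc_irr; apply: adj_irrefl.
  - move=> x y xy; rewrite /without_arc f_hom //= negb_or.
    have := forallP (missed x) y; rewrite xy andbT => ->.
    by have := forallP (missed y) x; rewrite adj_sym xy andbT andbC => ->.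
  by move=> x; rewrite !inE.
have hit u v : adj u v -> exists x y, [/\ f x = u, f y = v & adj x y].
  move=> uv; move: all_hit; rewrite negb_exists => /forallP/(_ u).
  rewrite negb_exists => /forallP/(_ v); rewrite uv /= negb_forall => /existsP[x].
  rewrite negb_forall => /existsP[y]; rewrite negbK => /and3P[/eqP fx /eqP fy xy].
  by exists x, y.
have f_surj u : exists x, f x == u.
  by have [v /hit[x [y [<- _ _]]]] := listed_covered u; exists x.
have f_mono : {mono f : x y / adj x y}.
  move=> x y; apply/idP/idP => [/hit[x' [y' [/f_inj-> /f_inj->]]] //|]; exact: f_hom.
have f_bij : bijective f.
  exists (fun u => xchoose (f_surj u)) => [x|u]; last exact/eqP/(xchooseP (f_surj u)).
  exact/f_inj/eqP/(xchooseP (f_surj (f x))).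
(* By now [f] is an isomorphism, so without any contraction the minor would not be proper. *)
have [eqK|[x [y [xy c_to']]]] := contracts_toP c_to.
  case: notHK; rewrite eqK in isoHK'; case: isoHK' => h [h_bij h_mono].
  exists (f \o h); split; first exact: bij_comp.
  by move=> p q; rewrite -h_mono -f_mono.
have [a ca] := listed_contract (f_hom _ _ xy).
apply: (@apex_minor (contract x y)).
  by exists (contract x y), K'; split=> //; exists id; split.
have inj_fval : injective (fun p : contract x y => f (val p)).
  by move=> p q /f_inj/val_inj.
apply: (@apex_inj_set (contract x y) K _ _ _ a _ _ inj_fval _ _ ca).
- exact: contracted_adj_sym.
- exact: contracted_adj_irrefl.
- move=> p q /andP[pq pq_adj]; rewrite /contracted_rel !f_mono !(inj_eq f_inj).
  by rewrite pq_adj andbT; apply: contra pq => /eqP/val_inj->.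
by move=> p pa; rewrite !inE negb_or pa (inj_eq f_inj) (valP p).
Qed.
End CheckListed.

Lemma check_listed_all : all check_listed listed_edges.
Proof. by vm_compute. Qed.

(** The search starts from the root alone; 9 is fuel for the number of rounds. *)
Lemma explore_ok : explore listed_keys 9 [:: ([:: 0], [::])].
Proof. by vm_compute. Qed.

(** * Agreement with the graphs of the statement, and conclusion *)

Lemma isomorphic_refl (G : sgraph) : isomorphic G G.
Proof. by exists id; split; first by exists id. Qed.

Lemma isomorphic_trans (G H K : sgraph) : isomorphic G H -> isomorphic H K -> isomorphic G K.
Proof.
move=> [f [f_bij f_mono]] [h [h_bij h_mono]]; exists (h \o f).
by split; [apply: bij_comp | move=> x y; rewrite -f_mono -h_mono].
Qed.

Definition shift_edges (n : nat) es : seq edge := [seq (e.1 + n, e.2 + n) | e <- es].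

Definition in_range n es := all (fun e => (0 < e.1 <= n) && (0 < e.2 <= n)) es.

Lemma isomorphic_union n m s t (G H : sgraph) :
  isomorphic (of_edges n s) G -> isomorphic (of_edges m t) H ->
  in_range n s -> in_range m t ->
  isomorphic (of_edges (n + m) (s ++ shift_edges n t)) (disjoint_union G H).
Proof.
move=> [f [f_bij f_mono]] [h [h_bij h_mono]] /allP s_n /allP t_m.
pose F (i : 'I_(n + m)) : G + H := match split i with inl a => inl (f a) | inr c => inr (h c) end.
have [f' fK f'K] := f_bij; have [h' hK h'K] := h_bij.
pose F' (u : G + H) : 'I_(n + m) :=
  match u with inl x => lshift m (f' x) | inr y => rshift n (h' y) end.
have Fl a : F (lshift m a) = inl (f a) by rewrite /F -[lshift m a]/(unsplit (inl a)) unsplitK.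
have Fr c : F (rshift n c) = inr (h c) by rewrite /F -[rshift n c]/(unsplit (inr c)) unsplitK.
exists F; split.
  exists F' => [i|[x|y]] /=; last 2 first.
  - by rewrite Fl f'K.
  - by rewrite Fr h'K.
  by case: (split_ordP i) => [a|c] ->; rewrite ?Fl ?Fr /= ?fK ?hK.
have out_s i j : (n <= i) || (n <= j) -> (i.+1, j.+1) \in s = false.
  by move=> n_ij; apply/negP => /s_n /=; lia.
have out_t i j : (i < n) || (j < n) -> (i.+1, j.+1) \in shift_edges n t = false.
  move=> ij_n; apply/negP => /mapP[[k l] /t_m /= kl [ei ej]]; lia.
have in_t i j : ((n + i).+1, (n + j).+1) \in shift_edges n t = ((i.+1, j.+1) \in t).
  have inj : injective (fun e : edge => (e.1 + n, e.2 + n)).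
    by move=> [k l] [k' l'] [/addIn-> /addIn->].
  by rewrite -!addnS ![n + _]addnC; apply: (mem_map inj t (i.+1, j.+1)).
have lt_l (a : 'I_n) : lshift m a < n := ltn_ord a.
move=> i j; case: (split_ordP i) => [a|c] ->; case: (split_ordP j) => [a'|c'] ->;
  rewrite ?Fl ?Fr /= /edge_list_rel ?mem_cat.
- rewrite -[LHS]/(adj (f a) (f a')) f_mono /= /edge_list_rel.
  by rewrite ![_ \in shift_edges n t]out_t ?lt_l // !orbF.
- by rewrite !out_s ?leq_addr ?orbT // !out_t ?lt_l ?orbT // ?andbF.
- by rewrite !out_s ?leq_addr ?orbT // !out_t ?lt_l ?orbT // ?andbF.
rewrite -[LHS]/(adj (h c) (h c')) h_mono /= /edge_list_rel !in_t.
by rewrite !out_s ?leq_addr //= eq_rshift.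
Qed.

Lemma K3_edges : isomorphic (of_edges 3 [:: (1, 2); (1, 3); (2, 3)]) K3.
Proof. by exists id; split; [exists id | case=> [[|[|[|//]]] ?] [[|[|[|//]]] ?]]. Qed.

Lemma K4_edges :
  isomorphic (of_edges 4 [:: (1, 2); (1, 3); (1, 4); (2, 3); (2, 4); (3, 4)]) K4.
Proof. by exists id; split; [exists id | case=> [[|[|[|[|//]]]] ?] [[|[|[|[|//]]]] ?]]. Qed.

Lemma K4_minus_edges :
  isomorphic (of_edges 4 [:: (1, 2); (1, 3); (2, 3); (2, 4); (3, 4)]) K4_minus.
Proof. by exists id; split; [exists id | case=> [[|[|[|[|//]]]] ?] [[|[|[|[|//]]]] ?]]. Qed.

Lemma K5_minus_edges : isomorphic (of_edges 5
  [:: (1, 2); (1, 3); (1, 4); (2, 3); (2, 4); (2, 5); (3, 4); (3, 5); (4, 5)]) K5_minus.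
Proof.
by exists id; split; [exists id | case=> [[|[|[|[|[|//]]]]] ?] [[|[|[|[|[|//]]]]] ?]].
Qed.

Lemma K33_edges : isomorphic (of_edges 6
  [:: (1, 4); (1, 5); (1, 6); (2, 4); (2, 5); (2, 6); (3, 4); (3, 5); (3, 6)]) K33.
Proof.
apply: isomorphic_sym; exists (fun u : 'I_3 + 'I_3 => unsplit u : 'I_6); split.
  by exists (@split 3 3); [apply: unsplitK | apply: splitK].
by case=> -[[|[|[|//]]] ?] [] [[|[|[|//]]] ?].
Qed.

Lemma listed_isomorphic :
  List.Forall2 (fun t K => isomorphic (of_edges t.1 t.2) K) listed_edges (L0 ++ L1).
Proof.
repeat apply: List.Forall2_cons; last exact: List.Forall2_nil.
(* This settles the graphs that the statement gives by edge lists; the disjoint unions, [K33] and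
   [K5_minus] remain. *)
all: try exact: isomorphic_refl.
- exact: (isomorphic_union K3_edges (isomorphic_union K3_edges K3_edges isT isT) isT isT).
- exact: (isomorphic_union K4_minus_edges K4_minus_edges isT isT).
- exact: (isomorphic_union (isomorphic_refl butterfly) (isomorphic_refl butterfly) isT isT).
- exact: (isomorphic_union K4_minus_edges (isomorphic_refl butterfly) isT isT).
- exact: (isomorphic_union K4_edges K3_edges isT isT).
- exact: (isomorphic_union K3_edges (isomorphic_refl triangle_with_ears) isT isT).
- exact: K33_edges.
exact: K5_minus_edges.
Qed.

Lemma Forall2_ex1 (A B : Type) (R : A -> B -> Prop) s t y :
  List.Forall2 R s t -> List.In y t -> exists2 x, List.In x s & R x y.
Proof.
elim=> // x z s' t' xz _ IH [<-|/IH[x' x's x'y]]; first by exists x => //; left.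
by exists x' => //; right.
Qed.

Lemma Forall2_ex2 (A B : Type) (R : A -> B -> Prop) s t x :
  List.Forall2 R s t -> List.In x s -> exists2 y, List.In y t & R x y.
Proof.
elim=> // z y s' t' zy _ IH [<-|/IH[y' y't xy']]; first by exists y => //; left.
by exists y' => //; right.
Qed.

Lemma mem_In (T : eqType) (x : T) s : x \in s <-> List.In x s.
Proof.
elim: s => [|y s IHs] /=; first by split.
by rewrite inE; split=> [/predU1P[->|/IHs]|[->|/IHs->]]; rewrite ?eqxx ?orbT //; auto.
Qed.

Lemma In_cat (T : Type) (x : T) s t : List.In x (s ++ t) <-> List.In x s \/ List.In x t.
Proof. by elim: s => [|y s IHs] /=; [split; auto; case | rewrite IHs or_assoc]. Qed.

Lemma listed_inP (G : sgraph) :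
  isomorphic_to_one_of L0 G \/ isomorphic_to_one_of L1 G <->
  exists2 t, t \in listed_edges & isomorphic (of_edges t.1 t.2) G.
Proof.
apply: (@iff_trans _ (isomorphic_to_one_of (L0 ++ L1) G)).
  split=> [[[K K_l i]|[K K_l i]]|[K /In_cat[] K_l i]].
  - by exists K => //; apply/In_cat; left.
  - by exists K => //; apply/In_cat; right.
  - by left; exists K.
  by right; exists K.
split=> [[K K_l i]|[t /mem_In t_l i]].
  have [t t_l i'] := Forall2_ex1 listed_isomorphic K_l.
  exists t; first by apply/mem_In.
  exact: isomorphic_trans i' (isomorphic_sym i).
have [K K_l i'] := Forall2_ex2 listed_isomorphic t_l.
by exists K => //; apply: isomorphic_trans (isomorphic_sym i) i'.
Qed.

Lemma minor_iso (G G' H : sgraph) : isomorphic G G' -> minor H G -> minor H G'.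
Proof. by move=> /isomorphic_subgraph i m; apply: minor_subgraph m i. Qed.

Lemma subgraph_minor (G H : sgraph) : subgraph H G -> minor H G.
Proof. by move=> sub; exists H, H; split=> //; [apply: contracts_refl | apply: isomorphic_refl]. Qed.

Lemma obs_iso (G H : sgraph) :
  isomorphic G H -> obs (apex 1 sub_unicyclic) G -> obs (apex 1 sub_unicyclic) H.
Proof.
move=> i [not_G min_G]; split.
  by move/(apex_minor (subgraph_minor (isomorphic_subgraph i))).
move=> K [m_K not_i]; apply: min_G; split.
  exact: minor_iso (isomorphic_sym i) m_K.
by move=> i'; apply: not_i; apply: isomorphic_trans i' i.
Qed.

(** Deciding isomorphism keeps the final argument by contradiction constructive. *)
Definition isomorphicb (G H : sgraph) := (#|G| == #|H|) &&
  [exists f : {ffun G -> H}, injectiveb f &&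
    [forall x, forall y, adj (f x) (f y) == adj x y]].

Lemma isomorphicP (G H : sgraph) : reflect (isomorphic G H) (isomorphicb G H).
Proof.
apply: (iffP andP) => [[/eqP card_GH /existsP[f /andP[/injectiveP f_inj /forallP f_mono]]]|].
  exists f; split; first by apply: inj_card_bij; rewrite // card_GH.
  by move=> x y; have /forallP/(_ y)/eqP := f_mono x.
case=> f [f_bij f_mono]; split; first exact/eqP/(bij_eq_card f_bij).
apply/existsP; exists (finfun f); apply/andP; split.
  by apply/injectiveP => x y; rewrite !ffunE => /(bij_inj f_bij).
by apply/forallP => x; apply/forallP => y; rewrite !ffunE f_mono.
Qed.

(** By minimality [G] minus an edge has an apex, and restoring the edge raises the bound from 1 to
    2. A graph without edges would be a forest and hence in the class. *)
Lemma obs_root (G : sgraph) : obs (apex 1 sub_unicyclic) G ->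
  exists v : G, cyc_le adj (~: [set v]) 2.
Proof.
move=> [not_G min_G]; have [not_T _] := (not_apexP G).1 not_G.
have [/existsP[x /existsP[y xy]]|no_edge] := boolP [exists x : G, exists y : G, adj x y].
  have : apex 1 sub_unicyclic (del_edge x y).
    apply: min_G; split.
      by apply: subgraph_minor; exists id; split=> // u u' /andP[].
    case=> f [[f' fK f'K] f_mono].
    have inj : injective (fun p : G * G => (f p.1, f p.2)).
      by move=> [a c] [a' c'] [/(can_inj fK)-> /(can_inj fK)->].
    (* The number of arcs is invariant under isomorphism but drops with the deleted edge, so this
       minor is proper. *)
    have : #|arcs (@adj (del_edge x y)) setT| = #|arcs (@adj G) setT|.
      rewrite -(card_imset _ inj); congr #|pred_of_set _|; apply/setP => -[a c].
      rewrite !inE /=; apply/imsetP/idP => [[[p q]]|ac].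
        by rewrite inE => /and3P[_ _ pq] [-> ->]; rewrite f_mono.
      exists (f' a, f' c); last by rewrite !f'K.
      have := f_mono (f' a) (f' c); rewrite !f'K ac => /esym pq.
      by rewrite inE !in_setT.
    apply/eqP; rewrite neq_ltn; apply/orP; left; apply: proper_card.
    apply/properP; split.
      by apply/subsetP => -[a c]; rewrite !inE /= => /andP[].
    by exists (x, y); rewrite !inE //= /del_edge_rel /= !eqxx xy.
  case/apexP=> X [X1 cX].
  have [v sub] : exists v : G, ~: [set v] \subset ~: X.
    have [->|[v vX]] := set_0Vmem X; first by exists x; rewrite setC0 subsetT.
    exists v; rewrite setCS; apply/subsetP => u uX; rewrite inE.
    by rewrite (card_le1_eqP X1 v u vX uX) ?eqxx.
  exists v; apply: (@cyc_le_without_arc _ _ _ x y).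
  exact: (cyc_le_sub (@del_edge_sym G x y) (@del_edge_irrefl G x y) _ sub cX).
case: not_T; have [c0|[s [sz /andP[cyc_s _] _]]] := forest_or_cycle (@adj_sym G) (@adj_irrefl G) setT.
  exact: cyc_leW c0.
case: s sz cyc_s => [|a [|c s]] //= _ /andP[ac _].
by case/negP: no_edge; apply/existsP; exists a; apply/existsP; exists c.
Qed.

Theorem theorem9 (G : sgraph) :
  obs (apex 1 sub_unicyclic) G <->
  isomorphic_to_one_of L0 G \/ isomorphic_to_one_of L1 G.
Proof.
apply: (iff_trans _ (iff_sym (listed_inP G))); split=> [obs_G|[t t_l i]]; last first.
  by apply: obs_iso i _; apply: listed_obs; apply: (allP check_listed_all).
have [v c2] := obs_root obs_G; have [not_G min_G] := obs_G.
have [not_T not_x] := (not_apexP G).1 not_G.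
have [t t_l m_t] : exists2 t, t \in listed_edges & minor (of_edges t.1 t.2) G.
  apply: (explore_sound c2 not_x explore_ok); exists ([:: 0], [::]); first exact: mem_head.
  by exists (fun=> v), [::].
(* Were the listed minor not isomorphic to [G], it would be a proper minor and so in the class by
   minimality of [G], whereas no listed graph has an apex. *)
exists t => //; apply/isomorphicP/negPn/negP => not_iso.
apply: (listed_not_apex (allP check_listed_all t t_l)).
by apply: min_G; split=> // /isomorphicP; apply/negP.
Qed.
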